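(* Fix an integer $d\ge1$ and a multi-index $\vec\kappa\in\mathbb{N}^d$. Let $P_0\in\operatorname{span}\{\Phi_{\vec\kappa,\vec\alpha}:\vec\alpha\in\mathbb{N}^d\}$ be an element of the finite linear span (over $\mathbb{C}$) of the canonical basis vectors of $\mathcal{H}_{\vec\kappa}(\mathbb{C}^d)$. There exists a constant $M=M(d,\vec\kappa,P_0)>0$ such that for every $F\in\mathcal{H}_{\vec\kappa}(\mathbb{C}^d)$ we have \[ \inf_{\lambda\in\mathbb{C},\,|\lambda|=1}\lVert F-\lambda P_0\rVert_{\gamma_d}\;\le\; M\,\bigl\|\,\lvert F\rvert-\lvert P_0\rvert\,\bigr\|_{\gamma_d}. \]
   Context: Here $\mathbb{N}=\{0,1,2,\dots\}$. For integers $k,n\ge0$ and $z\in\mathbb{C}$, define \[ \Phi_{k,n}(z)=\frac{1}{\sqrt{k!\,n!}}\sum_{j=0}^{\min(k,n)}(-1)^j\binom{k}{j}\frac{n!}{(n-j)!}\,z^{n-j}\,\overline{z}^{\,k-j}. \] For $d\ge1$ and multi-indices $\vec\kappa=(\kappa_0,\dots,\kappa_{d-1})$, $\vec\alpha=(\alpha_0,\dots,\alpha_{d-1})\in\mathbb{N}^d$, define for $\vec z=(z_0,\dots,z_{d-1})\in\mathbb{C}^d$ \[ \Phi_{\vec\kappa,\vec\alpha}(\vec z):=\prod_{q=0}^{d-1}\Phi_{\kappa_q,\alpha_q}(z_q). \] For measurable $F:\mathbb{C}^d\to\mathbb{C}$ put \[ \lVert F\rVert_{\gamma_d}^2:=\frac{1}{\pi^d}\int_{\mathbb{C}^d}|F(\vec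 z)|^2e^{-\lVert\vec z\rVert^2}\,dm(\vec z), \] with $m$ the Lebesgue measure on $\mathbb{C}^d\cong\mathbb{R}^{2d}$ and $\lVert\vec z\rVert^2=\sum_{q}|z_q|^2$. The space $\mathcal{H}_{\vec\kappa}(\mathbb{C}^d)$ is the closure of $\operatorname{span}\{\Phi_{\vec\kappa,\vec\alpha}:\vec\alpha\in\mathbb{N}^d\}$ in the norm $\lVert\cdot\rVert_{\gamma_d}$ (i.e. in $L^2$ of the Gaussian measure $\pi^{-d}e^{-\lVert\vec z\rVert^2}dm$). *)

(* Defs.v *)
From HB Require Import structures.
From mathcomp Require Import all_boot all_order all_algebra.
From mathcomp Require Import complex.
From mathcomp Require Import all_classical all_reals all_analysis.

Set Implicit Arguments.
Unset Strict Implicit.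
Unset Printing Implicit Defensive.

Import Order.TTheory GRing.Theory Num.Theory.
Import numFieldNormedType.Exports.

Local Open Scope classical_set_scope.
Local Open Scope ring_scope.
Local Open Scope complex_scope.

HB.instance Definition _ (R : pointedType) :=
  isPointed.Build R[i] (point +i* point).

Definition measure_complex_display : measure_display -> measure_display.
Proof. exact. Qed.

(* The Borel sigma-algebra of R[i], transported from R * R along
   z |-> (Re z, Im z). *)
Section measurable_complex.
Context {R : realType}.

Definition Cpair (z : R[i]) : R * R := (complex.Re z, complex.Im z).
Definition pairC (x : R * R) : R[i] := x.1 +i* x.2.

Lemma pairCK : cancel pairC Cpair. Proof. by case. Qed.

Definition measurableC_sets : set (set R[i]) :=
  preimage_set_system setT Cpair measurable.

Let sigmaC : sigma_algebra setT measurableC_sets.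
Proof. exact/sigma_algebra_preimage/sigma_algebra_measurable. Qed.

Let measurableC0 : measurableC_sets set0. Proof. by case: sigmaC. Qed.

Let measurableCC A : measurableC_sets A -> measurableC_sets (~` A).
Proof. by case: sigmaC => _ + _ => /[apply]; rewrite setTD. Qed.

Let measurableC_bigcup (F : (set R[i])^nat) :
  (forall i, measurableC_sets (F i)) -> measurableC_sets (\bigcup_i F i).
Proof. by case: sigmaC => _ _; apply. Qed.

HB.instance Definition _ := isMeasurable.Build
  (measure_complex_display (R.-ocitv.-measurable).-sigma) R[i]
  measurableC0 measurableCC measurableC_bigcup.

Lemma measurable_Cpair : measurable_fun [set: R[i]] Cpair.
Proof. by move=> _ B mB; exists B. Qed.

Lemma measurable_pairC : measurable_fun [set: R * R] pairC.
Proof.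
by move=> _ _ [B mB <-]; rewrite !setTI -comp_preimage (_ : _ \o _ = id) //;
  apply/funext => -[].
Qed.

End measurable_complex.

Section prod_image_measure.
Context d1 d2 d3 (T1 : measurableType d1) (T2 : measurableType d2)
  (T3 : measurableType d3) (R : realType).
Variables (m1 : {sigma_finite_measure set T1 -> \bar R})
  (m2 : {sigma_finite_measure set T2 -> \bar R}).
Variables (f : T1 * T2 -> T3) (g : T3 -> T1 * T2).
Hypotheses (mf : measurable_fun setT f) (mg : measurable_fun setT g).
Hypothesis fK : cancel f g.

(* The image of the product measure by f. The hypotheses on g make it
   sigma-finite, as needed to form further products. *)
Definition prod_image of measurable_fun setT f & measurable_fun setT g &
  cancel f g : set T3 -> \bar R := pushforward (m1 \x m2)%E f.

Local Notation nu := (prod_image mf mg fK).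

Let nu0 : nu set0 = 0%E.
Proof. exact: measure0. Qed.

Let nu_ge0 A : (0 <= nu A)%E.
Proof. exact: measure_ge0. Qed.

Let nu_sigma_additive : semi_sigma_additive nu.
Proof. exact: measure_semi_sigma_additive. Qed.

HB.instance Definition _ :=
  isMeasure.Build _ _ _ nu nu0 nu_ge0 nu_sigma_additive.

Let nu_sigma_finite : sigma_finite setT nu.
Proof.
have [F UF mF] := sigma_finiteT m1; have [G UG mG] := sigma_finiteT m2.
pose H p := g @^-1` (F p.1 `*` G p.2).
exists (fun k => if unpickle k is Some p then H p else set0).
  apply/esym/seteqP; split=> // y _.
  have: [set: T1] (g y).1 by [].
  have: [set: T2] (g y).2 by [].
  rewrite UF UG => -[j _ Gj] [i _ Fi].
  by exists (pickle (i, j)) => //; rewrite pickleK.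
move=> k; case: unpickle => [[i j]|]; last by rewrite measure0.
have [[mFi Fioo] [mGj Gjoo]] := (mF i, mG j); split.
  by rewrite -[X in measurable X]setTI; apply: mg => //; exact: measurableX.
rewrite /prod_image /pushforward -comp_preimage (_ : _ \o _ = id) ?preimage_id.
  rewrite product_measure1E //= lte_mul_pinfty //.
  by rewrite ge0_fin_numE.
by apply/funext => x /=; rewrite fK.
Qed.

HB.instance Definition _ :=
  Measure_isSigmaFinite.Build _ _ _ nu nu_sigma_finite.

Definition prod_image_measure : {sigma_finite_measure set T3 -> \bar R} := nu.

End prod_image_measure.

Section tuple_measure.
Context d (T : measurableType d) (R : realType).
Variable mu : {sigma_finite_measure set T -> \bar R}.

Definition tuple_of_pair n (x : T * n.-tuple T) : n.+1.-tuple T :=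
  [tuple of x.1 :: x.2].
Definition pair_of_tuple n (t : n.+1.-tuple T) : T * n.-tuple T :=
  (thead t, [tuple of behead t]).

Lemma tuple_of_pairK n : cancel (@tuple_of_pair n) (@pair_of_tuple n).
Proof. by case=> x t; congr (_, _); exact/val_inj. Qed.

Lemma measurable_tuple_of_pair n : measurable_fun setT (@tuple_of_pair n).
Proof. exact: measurable_cons. Qed.

Lemma measurable_pair_of_tuple n : measurable_fun setT (@pair_of_tuple n).
Proof.
apply/measurable_fun_pair; first exact: measurable_tnth.
exact: measurable_behead.
Qed.

(* The product measure mu \x ... \x mu on n.-tuple T. *)
Fixpoint tuple_measure n : {sigma_finite_measure set (n.-tuple T) -> \bar R} :=
  if n is m.+1 return {sigma_finite_measure set (n.-tuple T) -> \bar R} then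
    prod_image_measure mu (tuple_measure m) (@measurable_tuple_of_pair m)
      (@measurable_pair_of_tuple m) (@tuple_of_pairK m)
  else \d_ [tuple].

Lemma tuple_measureE n (A : 'I_n -> set T) : (forall i, measurable (A i)) ->
  tuple_measure n [set t | forall i, A i (tnth t i)] =
  (\big[*%E/1%E]_(i < n) mu (A i))%E.
Proof.
elim: n A => [|n IHn] A mA.
  by rewrite /= diracE big_ord0 mem_set //= => -[].
have mB (k : nat) (B : 'I_k -> set T) : (forall i, measurable (B i)) ->
    measurable [set t : k.-tuple T | forall i, B i (tnth t i)].
  move=> mB; rewrite (_ : mkset _ =
      \bigcap_(i in [set: 'I_k]) ((tnth (T:=T))^~ i @^-1` B i)); last first.
    by apply/seteqP; split=> [t Bt i _|t Bt i]; exact: Bt.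
  apply: fin_bigcap_measurable => [|i _]; first exact: finite_finset.
  rewrite -[X in measurable X]setTI.
  by apply: measurable_tnth => //; exact: mB.
rewrite big_ord_recl -IHn // -product_measure1E //; last first.
  by apply: (mB n (fun i => A (lift ord0 i))) => i; exact: mA.
rewrite /= /prod_image /pushforward; congr (product_measure1 _ _ _).
apply/seteqP; split=> -[x t] /=.
  move=> At; split=> [|i]; first exact: (At ord0).
  by have := At (lift ord0 i); rewrite tnthS.
move=> [A0 At] i; case: (unliftP ord0 i) => [j|] -> //.
by rewrite tnthS.
Qed.

End tuple_measure.

Section Landau_level_space.
Variable R : realType.
Local Notation C := R[i].

Definition lebesgueC : {sigma_finite_measure set C -> \bar R} :=
  prod_image_measure lebesgue_measure lebesgue_measure
    measurable_pairC measurable_Cpair pairCK.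

Definition lebesgueCn (d : nat) :
    {sigma_finite_measure set (d.-tuple C) -> \bar R} :=
  tuple_measure lebesgueC d.

Definition Phi1 (k n : nat) (z : C) : C :=
  (Num.sqrt (k`! * n`!)%:R)^-1%:C *
  \sum_(0 <= j < (minn k n).+1)
    (-1) ^+ j * 'C(k, j)%:R * (n`!%:R / (n - j)`!%:R) *
    z ^+ (n - j) * z^*%C ^+ (k - j).

Definition Phi (d : nat) (kappa alpha : d.-tuple nat) (z : d.-tuple C) : C :=
  \prod_(q < d) Phi1 (tnth kappa q) (tnth alpha q) (tnth z q).

(* Normc.normc is the R-valued modulus, whereas `|z| is R[i]-valued. *)
Definition gauss_norm (d : nat) (F : d.-tuple C -> C) : \bar R :=
  sqrte ((pi ^+ d)^-1%:E * \int[lebesgueCn d]_z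
    (Normc.normc (F z) ^+ 2 *
     expR (- \sum_(q < d) Normc.normc (tnth z q) ^+ 2))%:E)%E.

Definition Phi_span (d : nat) (kappa : d.-tuple nat) : set (d.-tuple C -> C) :=
  [set P | exists (s : seq (d.-tuple nat)) (c : d.-tuple nat -> C),
    P = fun z => \sum_(alpha <- s) c alpha * Phi kappa alpha z].

(* The closure of the span in L^2, whose elements are represented by Borel
   functions. *)
Definition Hspace (d : nat) (kappa : d.-tuple nat) : set (d.-tuple C -> C) :=
  [set F : d.-tuple C -> C | [/\ measurable_fun setT F,
    (gauss_norm F < +oo)%E &
    forall e : R, 0 < e -> exists2 P, Phi_span kappa P &
      (gauss_norm (fun z => F z - P z)%R < e%:E)%E]].

End Landau_level_space.

(* Main.v *)
(* By density, as [‖|F| - |P0|‖] is 1-Lipschitz in [F], one may take [F] in the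
   span. Put [e = F - lambda P0] and [u = |F| - |P0|], where [lambda] makes the
   coefficient of [e] at a fixed index of [P0] a real multiple of that of [P0].

   High frequencies. Rotating one coordinate of [z] turns [e] and [P0] into
   polynomials in a unimodular variable, the latter, [p], of bounded degree. If
   [e] has a frequency band above that of [p], a nonnegative Jackson type kernel
   annihilates [Re (e conj p)], and [Re (e conj p) <= |p| |u|]; hence [|e p|] is
   controlled by averages of [|p| |u|]. As [Phi_{k,n}] lives near [|z|^2 = n]
   with variance [O(n)], localising in [|z|] gives
   [‖e‖^2 <= K (‖u‖^2 + ‖Q e‖^2)], with [Q] the projection to a finite box.

   Low frequencies. One has
   [e conj P0 + P0 conj e = u^2 + 2 u |P0| - |e|^2]. Averaging against a
   character of the torus isolates the products [Phi_a conj Phi_b] with [a - b]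
   fixed, which are independent because of their growth at infinity. So the
   coefficients of the left-hand side, and with them [‖Q e‖], are at most
   [K (‖u‖ + ‖e‖^2)], and the quadratic term is absorbed when [e] is small.

   That [e] is small when [u] is follows from the same coefficient bound for
   [|F|^2 - |P0|^2], since [F] inherits the tightness of [P0]. When [u] is not
   small, the triangle inequality suffices. *)

Require Import Defs.
From mathcomp Require Import all_boot all_order all_algebra.
From mathcomp Require Import complex.
From mathcomp Require Import all_classical all_reals all_analysis.
From mathcomp Require Import cyclic separable cyclotomic measurable_realfun gauss_integral.
From mathcomp Require Import ring lra zify.

Set Implicit Arguments.
Unset Strict Implicit.
Unset Printing Implicit Defensive.

Import Order.TTheory GRing.Theory Num.Theory.
Import numFieldNormedType.Exports.

Local Open Scope classical_set_scope.
Local Open Scope ring_scope.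

(** * The modulus and roots of unity *)

(** On the circle the obstacle is that [p] may vanish, so that a bound on [|e p|] is not one on
    [|e|]. Two facts overcome it. Away from its at most [m] zeros, [p] changes from [X] to [Y] by a
    factor at most polynomial of degree [m] in [s |X - Y|], which the Dirichlet kernel of length [s]
    to the power [2 (m + 1)] absorbs. Close to the zeros there are few points, and [e], with [O(t)]
    coefficients, cannot have more than half of its energy there. Both need a band of the form
    [[t, O(t)]]: the kernel then has degree of order [t], and all ratios of degrees are bounded in
    terms of [m] alone.

    The circle is replaced throughout by the [L]-th roots of unity, with [L] above all degrees.
    Orthogonality stays exact, averages are finite sums, and the invariance of the Gaussian measure
    is used for finitely many rotations at a time. As the average is taken before the integral, only
    nonnegative functions are ever integrated against the weight on the torus side. No constant
    depends on [L] or on the support of [F], which is what the passage to the closure requires. *)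

Section Modulus.
Variable R : realType.
Local Notation C := R[i].
Local Open Scope complex_scope.
Implicit Types z w : C.

Local Notation nm := (@Normc.normc R).
Local Notation cj := (@conjc R).

Lemma normcE z : `|z| = (nm z)%:C.
Proof. by case: z. Qed.

Lemma nm_ge0 z : 0 <= nm z.
Proof. by rewrite -ler0c -normcE. Qed.

Lemma nmM z w : nm (z * w) = nm z * nm w.
Proof. exact: Normc.normcM. Qed.

Lemma nmD z w : nm (z + w) <= nm z + nm w.
Proof. exact: le_normcD. Qed.

Lemma nmN z : nm (- z) = nm z.
Proof. exact: normcN. Qed.

Lemma nmB z w : nm (z - w) <= nm z + nm w.
Proof. by rewrite -(nmN w) nmD. Qed.

Lemma nm_distC z w : nm (z - w) = nm (w - z).
Proof. by rewrite -nmN opprB. Qed.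

Lemma nm0 : nm 0 = 0.
Proof. exact: Normc.normc0. Qed.

Lemma nm1 : nm 1 = 1.
Proof. exact: Normc.normc1. Qed.

Lemma nm_eq0 z : (nm z == 0) = (z == 0).
Proof. by apply/eqP/eqP => [/Normc.eq0_normc|->]; rewrite ?nm0. Qed.

Lemma nmX z n : nm (z ^+ n) = nm z ^+ n.
Proof. by elim: n => [|n IHn]; rewrite ?expr0 ?nm1// !exprS nmM IHn. Qed.

Lemma nmJ z : nm (cj z) = nm z.
Proof. by case: z => a b /=; rewrite sqrrN. Qed.

Lemma nm_real (x : R) : nm x%:C = `|x|.
Proof. by rewrite /= expr0n addr0 sqrtr_sqr. Qed.

Lemma nm_nat n : nm n%:R = n%:R.
Proof. by rewrite -(rmorph_nat (real_complex R)) nm_real ger0_norm. Qed.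

Lemma conjK z : cj (cj z) = z.
Proof. exact: conjcK. Qed.

Lemma nm_sum I (r : seq I) P (F : I -> C) :
  nm (\sum_(i <- r | P i) F i) <= \sum_(i <- r | P i) nm (F i).
Proof.
elim/big_rec2: _ => [|i y x _ h]; first by rewrite nm0.
by apply: le_trans (nmD _ _) _; rewrite lerD2l.
Qed.

Lemma nm_prod I (r : seq I) P (F : I -> C) :
  nm (\prod_(i <- r | P i) F i) = \prod_(i <- r | P i) nm (F i).
Proof.
by elim/big_rec2: _ => [|i y x _ h]; rewrite ?nm1// nmM h.
Qed.

Lemma nm_sqrC z : (nm z ^+ 2)%:C = z * cj z.
Proof. by rewrite rmorphXn/= -normcE sqr_normc. Qed.

Lemma nm_sqr z : nm z ^+ 2 = complex.Re z ^+ 2 + complex.Im z ^+ 2.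
Proof. by case: z => a b /=; rewrite sqr_sqrtr// addr_ge0 ?sqr_ge0. Qed.

Lemma Re_le_nm z : `|complex.Re z| <= nm z.
Proof. by rewrite -lecR -normcE; exact: normc_ge_Re. Qed.

Lemma nm_lip z w : `|nm z - nm w| <= nm (z - w).
Proof.
have h a b : nm a - nm b <= nm (a - b).
  by rewrite lerBlDr; apply: le_trans (nmD _ _); rewrite subrK.
by rewrite ler_norml h andbT lerNl opprB (le_trans (h _ _))// nm_distC.
Qed.

Lemma nm_abs_sub z w : nm (`|z| - `|w|) = `|nm z - nm w|.
Proof. by rewrite !normcE -rmorphB nm_real. Qed.

Lemma mulzJ (z : C) : nm z = 1 -> z * cj z = 1.
Proof. by rewrite -nm_sqrC => ->; rewrite expr1n. Qed.

End Modulus.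

Section RootsOfUnity.
Variable R : realType.
Local Notation C := R[i].
Local Open Scope complex_scope.
Local Notation nm := (@Normc.normc R).
Local Notation cj := (@conjc R).

Definition rootsU (zeta : C) (L : nat) : seq C := [seq zeta ^+ j | j <- iota 0 L].

(** ['X^L - 1] splits over [C] and is separable in characteristic zero, and [L] distinct [L]-th
    roots of unity include a primitive one. *)
Lemma exists_prim_root (L : nat) :
  (0 < L)%N -> exists zeta : C, L.-primitive_root zeta.
Proof.
move=> L0; have [rs hrs] := closed_field_poly_normal ('X^L - 1 : {poly C}).
have monP : ('X^L - 1 : {poly C}) \is monic by rewrite monicXnsubC.
move: hrs; rewrite (monicP monP) scale1r => hrs.
have szrs : size rs = L.
  by apply: succn_inj; rewrite -(size_prod_XsubC rs id) -hrs size_XnsubC.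
have : has L.-primitive_root rs.
  apply: has_prim_root => //; last by rewrite szrs.
  - apply/allP => x xrs; rewrite unity_rootE -subr_eq0.
    have : root ('X^L - 1) x by rewrite hrs root_prod_XsubC.
    by rewrite rootE !hornerE.
  - rewrite -separable_prod_XsubC -hrs.
    by apply: separable_Xn_sub_1; rewrite pnatr_eq0 -lt0n.
by case/hasP => z _ hz; exists z.
Qed.

Variables (L : nat) (zeta : C).
Hypothesis hz : L.-primitive_root zeta.
Local Notation mu := (rootsU zeta L).

Let L0 : (0 < L)%N. Proof. exact: prim_order_gt0 hz. Qed.

Lemma mem_mu X : (X \in mu) = (X ^+ L == 1).
Proof.
apply/idP/eqP => [/mapP[j _ ->]|/(prim_rootP hz)[i ->]].
  by rewrite -exprM mulnC exprM (prim_expr_order hz) expr1n.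
by apply/mapP; exists (i : nat); rewrite // mem_iota ltn_ord.
Qed.

Lemma uniq_mu : uniq mu.
Proof.
rewrite map_inj_in_uniq ?iota_uniq// => i j; rewrite !mem_iota !add0n /=.
move=> iL jL /eqP; rewrite (eq_prim_root_expr hz).
by rewrite !modn_small// => /eqP.
Qed.

Lemma size_mu : size mu = L.
Proof. by rewrite size_map size_iota. Qed.

Lemma nm_mu X : X \in mu -> nm X = 1.
Proof.
rewrite mem_mu => /eqP h; apply/eqP.
by rewrite -(@pexpr_eq1 _ _ L)// ?nm_ge0// -nmX h nm1.
Qed.

Lemma mu_mul X Y : X \in mu -> Y \in mu -> X * Y \in mu.
Proof. by rewrite !mem_mu exprMn => /eqP -> /eqP ->; rewrite mul1r. Qed.

Lemma mu_conj X : X \in mu -> cj X \in mu.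
Proof. by rewrite !mem_mu -rmorphXn/= => /eqP ->; rewrite rmorph1. Qed.

Lemma mu_exp X n : X \in mu -> X ^+ n \in mu.
Proof. by rewrite !mem_mu exprAC => /eqP ->; rewrite expr1n. Qed.

Lemma mu_mulJ X : X \in mu -> X * cj X = 1.
Proof. by move=> /nm_mu/mulzJ. Qed.

Lemma sum_mu_mul (T : nmodType) (f : C -> T) X : X \in mu ->
  \sum_(Y <- mu) f (X * Y) = \sum_(Y <- mu) f Y.
Proof.
move=> Xmu; rewrite -(big_map ( *%R X) xpredT f).
have X0 : X != 0.
  apply/eqP => X0; have /eqP := mu_mulJ Xmu.
  by rewrite X0 mul0r eq_sym oner_eq0.
apply: perm_big; apply: uniq_perm; rewrite ?uniq_mu//.
  by rewrite map_inj_uniq ?uniq_mu//; exact: mulfI.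
move=> Z; apply/mapP/idP => [[Y Ymu ->]|Zmu]; first exact: mu_mul.
exists (cj X * Z); first by rewrite mu_mul// mu_conj.
by rewrite mulrA mu_mulJ// mul1r.
Qed.

Lemma sum_mu_conj (T : nmodType) (f : C -> T) :
  \sum_(Y <- mu) f (cj Y) = \sum_(Y <- mu) f Y.
Proof.
rewrite -(big_map (@conjc R) xpredT f).
apply: perm_big; apply: uniq_perm; rewrite ?uniq_mu//.
  by rewrite map_inj_uniq ?uniq_mu//; exact: (can_inj (@conjcK R)).
move=> Z; apply/mapP/idP => [[Y Ymu ->]|Zmu]; first exact: mu_conj.
by exists (cj Z); rewrite ?mu_conj// conjcK.
Qed.

Lemma sum_mu_div (T : nmodType) (f : C -> T) X : X \in mu ->
  \sum_(Y <- mu) f (X * cj Y) = \sum_(Y <- mu) f Y.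
Proof. by move=> Xmu; rewrite (sum_mu_conj (fun Y => f (X * Y))) sum_mu_mul. Qed.

Lemma sum_mu_divC (T : nmodType) (f : C -> T) Y : Y \in mu ->
  \sum_(X <- mu) f (X * cj Y) = \sum_(X <- mu) f X.
Proof.
move=> Ymu; rewrite -(sum_mu_mul f (mu_conj Ymu)).
by apply: eq_bigr => X _; rewrite mulrC.
Qed.

(** The substitution [Y -> zeta Y] multiplies the sum by [zeta ^+ n], which differs from 1. *)
Lemma sum_mu_exp n : ~~ (L %| n)%N -> \sum_(Y <- mu) Y ^+ n = 0.
Proof.
move=> Ln.
have zmu : zeta \in mu by rewrite mem_mu (prim_expr_order hz).
have := sum_mu_mul (fun Y => Y ^+ n) zmu.
under eq_bigr do rewrite exprMn; rewrite -mulr_sumr => /eqP.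
rewrite -subr_eq0 -[X in _ - X]mul1r -mulrBl mulf_eq0 subr_eq0.
rewrite -(prim_order_dvd hz) (negPf Ln) /= => /eqP; exact.
Qed.

Lemma sum_mu_orth a b : (a < L)%N -> (b < L)%N ->
  \sum_(Y <- mu) Y ^+ a * cj Y ^+ b = if a == b then L%:R else 0.
Proof.
wlog ab : a b / (b <= a)%N => [hw aL bL|].
  have [/hw->//|/ltnW/hw hba] := leqP b a.
  rewrite eq_sym -hba// -(sum_mu_conj (fun Y => Y ^+ b * cj Y ^+ a)).
  by apply: eq_bigr => Y _; rewrite conjK mulrC.
move=> aL bL.
transitivity (\sum_(Y <- mu) Y ^+ (a - b)).
  rewrite !big_seq; apply: eq_bigr => Y Ymu.
  by rewrite -{1}(subnK ab) exprD -mulrA -exprMn mu_mulJ// expr1n mulr1.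
case: eqVneq => [->|nab].
  by rewrite subnn; under eq_bigr do rewrite expr0;
    rewrite big_const_seq count_predT size_mu iter_addr_0.
apply: sum_mu_exp; apply: contra_neqN nab => /dvdn_leq.
by case: (posnP (a - b)) => [|ab0 /(_ isT)]; lia.
Qed.

Lemma parseval (a : {poly C}) n : (size a <= n)%N -> (n <= L)%N ->
  \sum_(Y <- mu) nm a.[Y] ^+ 2 = L%:R * \sum_(i < n) nm a`_i ^+ 2.
Proof.
move=> an nL; apply: (@complexI R).
rewrite rmorphM rmorph_nat !rmorph_sum /=.
transitivity (\sum_(Y <- mu) \sum_(i < n) \sum_(j < n)
    a`_i * cj a`_j * (Y ^+ i * cj Y ^+ j)).
  apply: eq_bigr => Y _; rewrite nm_sqrC (horner_coef_wide _ an).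
  rewrite rmorph_sum /= mulr_suml; apply: eq_bigr => i _.
  rewrite mulr_sumr; apply: eq_bigr => j _.
  rewrite rmorphM rmorphXn /=; ring.
rewrite exchange_big /= mulr_sumr; apply: eq_bigr => i _.
rewrite exchange_big /= (bigD1 i)//= -mulr_sumr sum_mu_orth ?eqxx; last 2 first.
- exact: leq_trans nL.
- exact: leq_trans nL.
rewrite big1 ?addr0 ?nm_sqrC 1?mulrC// => j ji.
rewrite -mulr_sumr sum_mu_orth; last 2 first.
- exact: leq_trans nL.
- exact: leq_trans nL.
by rewrite (_ : (i == j :> nat) = false) ?mulr0//; apply: contra_neqF ji => /eqP/val_inj.
Qed.

End RootsOfUnity.

(** * Dirichlet and Jackson kernels *)

Section Kernel.
Variable R : realType.
Local Notation C := R[i].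
Local Open Scope complex_scope.
Local Notation nm := (@Normc.normc R).
Local Notation cj := (@conjc R).

(** The one-sided Dirichlet kernel. Being a polynomial it needs no negative exponents, and its
    modulus on the circle is that of a centred kernel. *)
Definition dirichlet (s : nat) : {poly C} := \poly_(i < s) 1.

Lemma dirichletE s Z : (dirichlet s).[Z] = \sum_(i < s) Z ^+ i.
Proof.
rewrite /dirichlet horner_poly; apply: eq_bigr => i _; exact: mul1r.
Qed.

Lemma dirichletJ s Z : cj (dirichlet s).[Z] = (dirichlet s).[cj Z].
Proof.
rewrite !dirichletE rmorph_sum; apply: eq_bigr => i _; exact: rmorphXn.
Qed.

Lemma dirichlet1 Z : (dirichlet 1).[Z] = 1.
Proof. by rewrite dirichletE big_ord1. Qed.

Lemma dirichlet_at1 s : (dirichlet s).[1] = s%:R.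
Proof.
rewrite dirichletE; under eq_bigr do rewrite expr1n.
by rewrite sumr_const card_ord.
Qed.

Lemma nm_dirichlet_le s Z : nm Z = 1 -> nm (dirichlet s).[Z] <= s%:R.
Proof.
move=> Z1; rewrite dirichletE (le_trans (nm_sum _ _ _))//.
rewrite (eq_bigr (fun=> 1)) => [|i _]; last by rewrite nmX Z1 expr1n.
by rewrite sumr_const card_ord.
Qed.

Lemma nm_dirichlet_decay s Z : nm Z = 1 ->
  nm (dirichlet s).[Z] * nm (Z - 1) <= 2.
Proof.
move=> Z1; rewrite mulrC -nmM dirichletE -subrX1.
by rewrite (le_trans (nmB _ _))// nmX Z1 expr1n nm1.
Qed.

Definition jackson s q : {poly C} := dirichlet s ^+ q.

Lemma jacksonJ s q Z : cj (jackson s q).[Z] = (jackson s q).[cj Z].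
Proof. by rewrite /jackson !horner_exp rmorphXn/= -dirichletJ. Qed.

Lemma size_jackson s q B : (q * s.-1 <= B)%N ->
  (size (jackson s q) <= B.+1)%N.
Proof.
rewrite -ltnS; apply: leq_trans.
apply: leq_trans (size_poly_exp_leq _ _) _.
have h : (size (dirichlet s) <= s)%N := size_poly _ _.
by rewrite ltnS mulnC leq_mul2l -!subn1 leq_sub2r ?orbT.
Qed.

(** An analogue of the de la Vallee Poussin kernel. On the circle the last two factors give
    [|jackson|^2], with frequencies in [[-B, B]] for [B = q (s - 1)]. The Dirichlet factor adds up
    [T] shifts of it, so the coefficients are constant on [[B, T - B)] and vanish below [-B]. *)
Definition kern T s q Z : C :=
  (dirichlet T).[Z] * ((jackson s q).[Z] * (jackson s q).[cj Z]).

Definition wt s q Z : R := nm (jackson s q).[Z] ^+ 2.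

Lemma kern1 s q Z : kern 1 s q Z = (wt s q Z)%:C.
Proof. by rewrite /kern dirichlet1 mul1r -jacksonJ nm_sqrC. Qed.

Lemma nm_kern T s q Z : nm Z = 1 -> nm (kern T s q Z) <= T%:R * wt s q Z.
Proof.
move=> Z1; rewrite /kern nmM -jacksonJ -nm_sqrC nm_real ger0_norm ?sqr_ge0//.
by rewrite ler_wpM2r ?sqr_ge0// nm_dirichlet_le.
Qed.

Lemma wt_ge0 s q Z : 0 <= wt s q Z.
Proof. exact: sqr_ge0. Qed.

(** Of the [2 q + 2] factors [x], two are kept because the sum of [x ^+ 2] over the roots of unity
    is known. Each of the others pays for one factor [1 + s |Z - 1|]: by the two bounds on the
    Dirichlet kernel, [x (1 + s |Z - 1|) <= s + 2 s]. *)
Lemma wt_decay s q m Z : (m <= q.*2)%N -> nm Z = 1 ->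
  wt s q.+1 Z * (1 + s%:R * nm (Z - 1)) ^+ m <=
  (3 * s%:R) ^+ q.*2 * nm (dirichlet s).[Z] ^+ 2.
Proof.
move=> mq Z1; set x := nm (dirichlet s).[Z].
have x0 : 0 <= x := nm_ge0 _.
have -> : wt s q.+1 Z = x ^+ q.*2 * x ^+ 2.
  by rewrite /wt /jackson horner_exp nmX -/x -exprM -exprD; congr (_ ^+ _); lia.
have y1 : 1 <= 1 + s%:R * nm (Z - 1) by rewrite lerDl mulr_ge0 ?nm_ge0.
have y0 : 0 <= 1 + s%:R * nm (Z - 1) := le_trans ler01 y1.
rewrite mulrAC ler_wpM2r ?sqr_ge0//.
apply: (@le_trans _ _ ((x * (1 + s%:R * nm (Z - 1))) ^+ q.*2)).
  by rewrite exprMn ler_wpM2l ?exprn_ge0// ler_weXn2l.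
rewrite lerXn2r ?nnegrE ?mulr_ge0//.
have h1 := nm_dirichlet_le s Z1; have h2 := nm_dirichlet_decay s Z1.
rewrite (_ : x * _ = x + s%:R * (x * nm (Z - 1))); last by ring.
rewrite (_ : 3 * s%:R = s%:R + s%:R * 2); last by ring.
by rewrite lerD// ler_wpM2l.
Qed.

Variables (L : nat) (zeta : C).
Hypothesis hz : L.-primitive_root zeta.
Local Notation mu := (rootsU zeta L).

Lemma kern_expand T s q N (f : C -> C) X :
  (size (jackson s q) <= N)%N ->
  let g := jackson s q in
  \sum_(Y <- mu) kern T s q (X * cj Y) * f Y =
  \sum_(t < T) \sum_(a < N) \sum_(b < N) g`_a * g`_b *
    (X ^+ (t + a) * cj X ^+ b) *
    \sum_(Y <- mu) (Y ^+ b * cj Y ^+ (t + a) * f Y).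
Proof.
move=> sN g.
transitivity (\sum_(Y <- mu) \sum_(t < T) \sum_(a < N) \sum_(b < N)
    g`_a * g`_b * (X ^+ (t + a) * cj X ^+ b) *
    (Y ^+ b * cj Y ^+ (t + a) * f Y)).
  apply: eq_bigr => Y _; rewrite /kern dirichletE.
  rewrite !(horner_coef_wide _ sN) big_distrlr /= [X in X * _]mulr_suml.
  rewrite mulr_suml; apply: eq_bigr => t _.
  rewrite mulr_sumr mulr_suml; apply: eq_bigr => a _.
  rewrite mulr_sumr mulr_suml; apply: eq_bigr => b _.
  rewrite rmorphM/= conjK !exprMn !exprD -/g; ring.
rewrite exchange_big; apply: eq_bigr => t _.
rewrite exchange_big; apply: eq_bigr => a _.
rewrite exchange_big; apply: eq_bigr => b _.
by rewrite mulr_sumr.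
Qed.

(** For given [a] and [b] only the shift [t = l + b - a] contributes, and the conditions on [l]
    place it in [[0, T)]. What remains is the square of the coefficient sum of [jackson s q], that
    is of its value [s ^+ q] at 1. *)
Lemma kern_reproduces T s q B l X : (q * s.-1 <= B)%N -> X \in mu ->
  (B <= l)%N -> (l + B < T)%N -> (T + B <= L)%N ->
  \sum_(Y <- mu) kern T s q (X * cj Y) * Y ^+ l =
  (L%:R * s%:R ^+ q.*2) * X ^+ l.
Proof.
move=> hB Xmu Bl lT TL.
rewrite (kern_expand _ _ _ (size_jackson hB)).
rewrite exchange_big /=; set g := jackson s q.
transitivity (\sum_(a < B.+1) \sum_(b < B.+1) g`_a * g`_b * (L%:R * X ^+ l)).
  apply: eq_bigr => a _; rewrite exchange_big /=; apply: eq_bigr => b _.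
  have aB := ltn_ord a; have bB := ltn_ord b.
  have tT : (l + b - a < T)%N by lia.
  rewrite (bigD1 (Ordinal tT))//= [X in _ + X]big1 ?addr0 => [|t tn].
    rewrite -[LHS]mulrA; congr (_ * _).
    under eq_bigr do rewrite mulrAC -exprD.
    rewrite (sum_mu_orth hz); [|lia|lia].
    rewrite (_ : (_ == _)%N); last by apply/eqP; lia.
    rewrite [(l + b - a + a)%N](_ : _ = (l + b)%N); last by lia.
    by rewrite exprD -mulrA -exprMn (mu_mulJ hz)// expr1n mulr1 mulrC.
  under eq_bigr do rewrite mulrAC -exprD.
  rewrite (sum_mu_orth hz); [|lia|have := ltn_ord t; lia].
  rewrite ifF ?mulr0//; apply/negP => /eqP h; move/eqP: tn; apply.
  by apply/val_inj => /=; lia.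
under eq_bigr do rewrite -mulr_suml -mulr_sumr.
rewrite -mulr_suml -mulr_suml.
have -> : \sum_(i < B.+1) g`_i = s%:R ^+ q.
  have := horner_coef_wide 1 (size_jackson hB).
  rewrite horner_exp dirichlet_at1 => ->.
  by apply: eq_bigr => i _; rewrite expr1n mulr1.
by rewrite -addnn exprD; ring.
Qed.

(** The frequency [i - n] is below [-B], the lowest one of the kernel; [n + T + B < L] excludes
    coincidences modulo [L]. *)
Lemma kern_kills T s q B n i X : (q * s.-1 <= B)%N ->
  (B + i < n)%N -> (n + T + B < L)%N ->
  \sum_(Y <- mu) kern T s q (X * cj Y) * (cj Y ^+ n * Y ^+ i) = 0.
Proof.
move=> hB h1 h2; rewrite (kern_expand _ _ _ (size_jackson hB)).
rewrite big1// => t _; rewrite big1// => a _; rewrite big1// => b _.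
have aB := ltn_ord a; have bB := ltn_ord b; have tT := ltn_ord t.
rewrite (eq_bigr (fun Y => Y ^+ (b + i) * cj Y ^+ (t + a + n))); last first.
  by move=> Y _; rewrite !exprD; ring.
rewrite (sum_mu_orth hz); [|lia|lia].
by rewrite ifF ?mulr0//; apply/negP => /eqP; lia.
Qed.

(** With [T = 1] the spectrum is symmetric, so frequencies above [B] are annihilated as well. *)
Lemma kern1_kills s q B n i X : (q * s.-1 <= B)%N ->
  (B + i < n)%N -> (n + B < L)%N ->
  \sum_(Y <- mu) kern 1 s q (X * cj Y) * (Y ^+ n * cj Y ^+ i) = 0.
Proof.
move=> hB h1 h2; rewrite (kern_expand _ _ _ (size_jackson hB)).
rewrite big1// => t _; rewrite big1// => a _; rewrite big1// => b _.
have aB := ltn_ord a; have bB := ltn_ord b; have tT := ltn_ord t.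
rewrite (eq_bigr (fun Y => Y ^+ (b + n) * cj Y ^+ (t + a + i))); last first.
  by move=> Y _; rewrite !exprD; ring.
rewrite (sum_mu_orth hz); [|lia|lia].
by rewrite ifF ?mulr0//; apply/negP => /eqP; lia.
Qed.

Lemma sum_mu_bilin (k : C -> C) (a b : {poly C}) Na Nb :
  (size a <= Na)%N -> (size b <= Nb)%N ->
  \sum_(Y <- mu) k Y * (a.[Y] * cj b.[Y]) =
  \sum_(n < Na) \sum_(i < Nb) a`_n * cj b`_i *
    \sum_(Y <- mu) k Y * (Y ^+ n * cj Y ^+ i).
Proof.
move=> aN bN.
transitivity (\sum_(Y <- mu) \sum_(n < Na) \sum_(i < Nb)
   a`_n * cj b`_i * (k Y * (Y ^+ n * cj Y ^+ i))).
  apply: eq_bigr => Y _.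
  rewrite (horner_coef_wide _ aN) (horner_coef_wide _ bN) rmorph_sum/=.
  rewrite mulr_suml mulr_sumr; apply: eq_bigr => n _.
  rewrite !mulr_sumr; apply: eq_bigr => i _.
  rewrite rmorphM rmorphXn/=; ring.
rewrite exchange_big; apply: eq_bigr => n _.
by rewrite exchange_big; apply: eq_bigr => i _; rewrite mulr_sumr.
Qed.

Section Band.
Variables (s q B m N1 N2 : nat) (e p : {poly C}).
Local Notation T := (N2 + B).+1.
Hypothesis hB : (q * s.-1 <= B)%N.
Hypothesis N1B : (B + m < N1)%N.
Hypothesis LN : (N2 + T + B + B + m < L)%N.
Hypothesis sp : (size p <= m.+1)%N.
Hypothesis se : (size e <= N2.+1)%N.
Hypothesis eband : forall n, (n < N1)%N -> e`_n = 0.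

Let v Y := complex.Re (e.[Y] * cj p.[Y]).

Let twov Y : (2 * v Y)%:C = e.[Y] * cj p.[Y] + p.[Y] * cj e.[Y].
Proof.
by rewrite rmorphM rmorph_nat -addcJ rmorphM/= conjK [cj _ * _]mulrC.
Qed.

(** [e conj p] has its frequencies in [[N1 - m, N2]], where the kernel is flat, and [p conj e] has
    the opposite ones, which it kills. The kernel thus recovers [e conj p] from its real part. *)
Lemma kern_band X : X \in mu ->
  \sum_(Y <- mu) kern T s q (X * cj Y) * (2 * v Y)%:C =
  (L%:R * s%:R ^+ q.*2) * (e.[X] * cj p.[X]).
Proof.
move=> Xmu.
under eq_bigr do rewrite twov mulrDr.
rewrite big_split /= [X in _ + X](_ : _ = 0) ?addr0; last first.
  rewrite (sum_mu_bilin _ sp se) big1// => i _; rewrite big1// => n _.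
  have [nN|Nn] := ltnP n N1; first by rewrite eband// rmorph0 mulr0 mul0r.
  rewrite (eq_bigr (fun Y => kern T s q (X * cj Y) * (cj Y ^+ n * Y ^+ i))).
    rewrite (kern_kills _ hB) ?mulr0//; first by have := ltn_ord i; lia.
    by have := ltn_ord n; lia.
  by move=> Y _; rewrite [_ * _ ^+ i]mulrC.
rewrite (sum_mu_bilin _ se sp).
rewrite (horner_coef_wide _ se) (horner_coef_wide _ sp) rmorph_sum/=.
rewrite mulr_suml mulr_sumr; apply: eq_bigr => n _.
rewrite !mulr_sumr; apply: eq_bigr => i _.
have [nN|Nn] := ltnP n N1; first by rewrite eband// !mul0r mulr0.
have im := ltn_ord i; have nN := ltn_ord n.
have mono Y : Y \in mu -> Y ^+ n * cj Y ^+ i = Y ^+ (n - i).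
  move=> Ymu; rewrite -{1}[n : nat](@subnK i); last by lia.
  by rewrite exprD -mulrA -exprMn (mu_mulJ hz)// expr1n mulr1.
under eq_big_seq => Y Ymu do rewrite mono//.
rewrite (kern_reproduces hB)//; [|lia|lia|lia].
rewrite -mono// rmorphM rmorphXn/=; ring.
Qed.

(** The weight has frequencies in [[-B, B]], while all those of [v] exceed [B] in absolute value. *)
Lemma wt_band X : \sum_(Y <- mu) wt s q (X * cj Y) * v Y = 0.
Proof.
apply: (@complexI R); rewrite rmorph0.
suff : \sum_(Y <- mu) kern 1 s q (X * cj Y) * (2 * v Y)%:C = 0.
  move=> /(congr1 (fun z => 2^-1 * z)); rewrite mulr0 => <-.
  rewrite rmorph_sum mulr_sumr; apply: eq_bigr => Y _.
  rewrite kern1 !rmorphM rmorph_nat/= [RHS]mulrCA mulKf//.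
under eq_bigr do rewrite twov mulrDr.
rewrite big_split /= (sum_mu_bilin _ sp se) (sum_mu_bilin _ se sp).
rewrite !big1 ?addr0// => i _; rewrite big1// => n _.
- have [nN|Nn] := ltnP n N1; first by rewrite eband// rmorph0 mulr0 mul0r.
  rewrite (eq_bigr (fun Y => kern 1 s q (X * cj Y) * (cj Y ^+ n * Y ^+ i))).
    rewrite (kern_kills _ hB) ?mulr0//; first by have := ltn_ord i; lia.
    by have := ltn_ord n; lia.
  by move=> Y _; rewrite [_ * _ ^+ i]mulrC.
- have [nN|Nn] := ltnP i N1; first by rewrite eband// !mul0r.
  rewrite (kern1_kills _ hB) ?mulr0//; first by have := ltn_ord n; lia.
  by have := ltn_ord i; lia.
Qed.

Let u Y := nm (p.[Y] + e.[Y]) - nm p.[Y].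

(** From [v + |p|^2 = Re ((p + e) conj p) <= |p + e| |p|]. There is no such bound from below: if
    [p + e] is a rotation of [p], then [u = 0] while [v] may be negative. *)
Let v_le Y : v Y <= nm p.[Y] * `|u Y|.
Proof.
apply: (@le_trans _ _ (nm p.[Y] * u Y)); last first.
  by rewrite ler_wpM2l ?nm_ge0// ler_norm.
rewrite /u mulrBr lerBrDr -expr2.
rewrite -(nmJ p.[Y]) -nmM mulrC (le_trans _ (le_trans (ler_norm _) (Re_le_nm _)))//.
rewrite mulrDl raddfD /= addrC lerD2r.
by rewrite -nm_sqrC /= nmJ.
Qed.

(* The kernel [wt] is nonnegative and annihilates [v], so [|v|] is controlled
   by the one-sided bound [v_le]. *)
Lemma band_pointwise X : X \in mu ->
  L%:R * s%:R ^+ q.*2 * (nm e.[X] * nm p.[X]) <=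
  4 * T%:R * \sum_(Y <- mu) wt s q (X * cj Y) * (nm p.[Y] * `|u Y|).
Proof.
move=> Xmu.
have -> : L%:R * s%:R ^+ q.*2 * (nm e.[X] * nm p.[X]) =
    nm (\sum_(Y <- mu) kern T s q (X * cj Y) * (2 * v Y)%:C).
  by rewrite kern_band// !nmM nmX !nm_nat nmJ.
apply: le_trans (nm_sum _ _ _) _.
apply: (@le_trans _ _ (2 * T%:R * \sum_(Y <- mu) wt s q (X * cj Y) * `|v Y|)).
  rewrite mulr_sumr !big_seq; apply: ler_sum => Y Ymu.
  rewrite nmM nm_real normrM ger0_norm//.
  have k0 := nm_kern T s q (nm_mu hz (mu_mul hz Xmu (mu_conj hz Ymu))).
  have := ler_wpM2r (normr_ge0 (v Y)) k0; lra.
have -> : 4 * T%:R = 2 * T%:R * 2 :> R by ring.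
rewrite -[X in _ <= X]mulrA ler_wpM2l ?mulr_ge0//.
(* Subtracting the vanishing sum of [wt * v] leaves [|v| + v <= 2 |p| |u|] to be checked
   termwise. *)
rewrite -[leRHS]subr0 -[X in _ - X](wt_band X) mulr_sumr -sumrB.
apply: ler_sum => Y _.
rewrite mulrCA -mulrBr ler_wpM2l ?wt_ge0//.
have := v_le Y; have : 0 <= nm p.[Y] * `|u Y| by rewrite mulr_ge0 ?nm_ge0.
by case: (ler0P (v Y)); lra.
Qed.

End Band.

End Kernel.

(** * A stability estimate on the circle *)

Section Circle.
Variable R : realType.
Local Notation C := R[i].
Local Open Scope complex_scope.
Local Notation nm := (@Normc.normc R).
Local Notation cj := (@conjc R).

(** Lagrange's identity: twice the difference of the two sides is the double sum of
    [w i * w j * (f i - f j) ^+ 2]. *)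
Lemma weighted_CS I (r : seq I) (w f : I -> R) : (forall i, 0 <= w i) ->
  (\sum_(i <- r) w i * f i) ^+ 2 <=
  (\sum_(i <- r) w i) * \sum_(i <- r) w i * f i ^+ 2.
Proof.
move=> w0; rewrite -subr_ge0 -(pmulr_rge0 _ (ltr0n R 2)).
suff -> : 2 * ((\sum_(i <- r) w i) * (\sum_(i <- r) w i * f i ^+ 2) -
   (\sum_(i <- r) w i * f i) ^+ 2) =
   \sum_(i <- r) \sum_(j <- r) w i * w j * (f i - f j) ^+ 2.
  by apply: sumr_ge0 => i _; apply: sumr_ge0 => j _; rewrite mulr_ge0 ?sqr_ge0 ?mulr_ge0.
transitivity (\sum_(i <- r) \sum_(j <- r) (w i * (w j * f j ^+ 2) +
   (w i * f i ^+ 2) * w j - 2 * ((w i * f i) * (w j * f j)))); last first.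
  by apply: eq_bigr => i _; apply: eq_bigr => j _; ring.
under [RHS]eq_bigr do rewrite sumrB big_split /= -!mulr_sumr.
rewrite sumrB big_split /= -!mulr_suml -!mulr_sumr -mulr_suml; ring.
Qed.

Lemma nm_unit_exp_sub1 (Z : C) i : nm Z = 1 -> nm (Z ^+ i - 1) <= i%:R * nm (Z - 1).
Proof.
move=> Z1; rewrite subrX1 nmM mulrC ler_wpM2r ?nm_ge0// -dirichletE.
exact: nm_dirichlet_le.
Qed.

Section Mu.
Variables (L : nat) (zeta : C).
Hypothesis hz : L.-primitive_root zeta.
Local Notation mu := (rootsU zeta L).

Lemma sum_dirichlet_sqr s : (s <= L)%N ->
  \sum_(Y <- mu) nm (dirichlet R s).[Y] ^+ 2 = L%:R * s%:R.
Proof.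
move=> sL; rewrite (parseval hz (size_poly _ _) sL); congr (_ * _).
rewrite (eq_bigr (fun=> 1)) ?sumr_const ?card_ord// => i _.
by rewrite coef_poly ltn_ord nm1 expr1n.
Qed.

(* The points of [mu] near [xi] are near each other, hence the Dirichlet kernel
   centred at one of them is large at all of them. *)
Lemma count_near (xi : C) M : (0 < M <= L)%N ->
  (count (fun X => nm (X - xi) * (4 * M%:R) < 1) mu)%:R * M%:R <= 4 * L%:R :> R.
Proof.
move=> /andP[M0 ML]; set P := fun X => _.
have [/hasP[X0 X0mu PX0]|] := boolP (has P mu); last first.
  by rewrite has_count -leqNgt leqn0 => /eqP ->; rewrite mul0r mulr_ge0.
have MR : (0 : R) < M%:R by rewrite ltr0n.
have large X : X \in mu -> P X -> M%:R ^+ 2 / 4 <= nm (dirichlet R M).[X * cj X0] ^+ 2.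
  move=> Xmu PX; set Z := X * cj X0.
  have Z1 : nm Z = 1 by rewrite nmM nmJ (nm_mu hz)// (nm_mu hz)// mulr1.
  have hZ : nm (Z - 1) = nm (X - X0).
    rewrite -[RHS]mulr1 -[X in _ * X](nm_mu hz X0mu) -(nmJ X0) -nmM mulrBl.
    by rewrite (mu_mulJ hz X0mu).
  have hXX : nm (X - X0) * (2 * M%:R) <= 1.
    have := nmD (X - xi) (xi - X0); rewrite addrA subrK (nm_distC xi X0) => h.
    have := ler_wpM2r (ltW MR) h; move: PX PX0; rewrite /P; lra.
  (* Each of the [M] terms [Z ^+ i - 1] is at most [M |X - X0| <= 1 / 2] in modulus. *)
  have hd : nm ((dirichlet R M).[Z] - M%:R) <= M%:R / 2.
    have -> : (dirichlet R M).[Z] - M%:R = \sum_(i < M) (Z ^+ i - 1).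
      by rewrite dirichletE sumrB sumr_const card_ord.
    apply: le_trans (nm_sum _ _ _) _.
    apply: (@le_trans _ _ (\sum_(i < M) (M%:R * nm (X - X0)))).
      apply: ler_sum => i _; rewrite -hZ.
      apply: le_trans (nm_unit_exp_sub1 _ Z1) _.
      by rewrite ler_wpM2r ?nm_ge0// ler_nat ltnW.
    rewrite sumr_const card_ord -mulr_natl.
    have := ler_wpM2l (ltW MR) hXX; lra.
  have : M%:R / 2 <= nm (dirichlet R M).[Z].
    have := nmB (dirichlet R M).[Z] ((dirichlet R M).[Z] - M%:R).
    rewrite opprB addrCA subrr addr0 nm_nat; lra.
  move=> h; have -> : M%:R ^+ 2 / 4 = (M%:R / 2) ^+ 2 :> R by field.
  by rewrite lerXn2r ?nnegrE ?nm_ge0// divr_ge0.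
have : (count P mu)%:R * (M%:R ^+ 2 / 4) <= L%:R * M%:R :> R.
  rewrite -sum_dirichlet_sqr// -(sum_mu_divC hz _ X0mu).
  rewrite -sum1_count natr_sum mulr_suml big_mkcond/= !big_seq.
  apply: ler_sum => X Xmu; case: ifP => [PX|_]; last exact: sqr_ge0.
  by rewrite mul1r large.
rewrite expr2 -[X in X / 4]mulrC => h.
by rewrite -(ler_pM2r MR); lra.
Qed.

(** Factor by factor: [|Y - xi| <= |X - xi| + |Y - X|], and the distance of [X] to [xi] turns the
    last term into at most [4 J s |Y - X|] times [|X - xi|]. *)
Lemma poly_ratio (rs : seq C) (k s J : R) X Y : 1 <= J -> 0 <= s ->
  (forall xi, xi \in rs -> 1 <= nm (X - xi) * (4 * (J * s))) ->
  nm (\prod_(xi <- rs) (Y - xi)) <= nm (\prod_(xi <- rs) (X - xi)) *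
    (4 * J * (1 + s * nm (Y - X))) ^+ size rs.
Proof.
move=> J1 s0; elim: rs => [|xi rs IH] h; first by rewrite !big_nil mulr1.
rewrite !big_cons !nmM exprS mulrACA ler_pM ?nm_ge0//; last first.
  by apply: IH => x xrs; apply: h; rewrite inE xrs orbT.
have h1 := h xi (mem_head _ _).
have h2 : nm (Y - xi) <= nm (X - xi) + nm (Y - X).
  by have := nmD (X - xi) (Y - X); rewrite addrAC addrCA subrr addr0.
have d0 := nm_ge0 (Y - X); have x0 := nm_ge0 (X - xi).
apply: le_trans h2 _.
have := ler_wpM2r d0 h1; have := ler_wpM2l x0 J1.
have : 0 <= nm (X - xi) * J by rewrite mulr_ge0//; lra.
rewrite mul1r mulr1; lra.
Qed.

Section Band.
Variables (s B T m N1 N2 J : nat) (e p : {poly C}).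
Hypothesis s0 : (0 < s)%N.
Hypothesis hB : (m.+1 * s.-1 <= B)%N.
Hypothesis hT : T = (N2 + B).+1.
Hypothesis N1B : (B + m < N1)%N.
Hypothesis LN : (N2 + T + B + B + m < L)%N.
Hypothesis LJ : (J * s <= L)%N.
Hypothesis J0 : (0 < J)%N.
Hypothesis J1 : (8 * m * N2.+1 <= J * s)%N.
Hypothesis sp : (size p <= m.+1)%N.
Hypothesis se : (size e <= N2.+1)%N.
Hypothesis eband : forall n, (n < N1)%N -> e`_n = 0.
Let u Y := nm (p.[Y] + e.[Y]) - nm p.[Y].
Let S := \sum_(Y <- mu) nm e.[Y] ^+ 2.
Let c : R := 4 * T%:R * (4 * J%:R * 9) ^+ m.

(** Here [rs] will be the zeros of [p]. The threshold is that of [count_near] with [M = J * s]; a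
    large [J] makes the other points few. *)
Let good (rs : seq C) X := all (fun xi => 1 <= nm (X - xi) * (4 * (J%:R * s%:R))) rs.

Let S0 : 0 <= S. Proof. by apply: sumr_ge0 => Y _; rewrite sqr_ge0. Qed.

Let L0 : (0 : R) < L%:R. Proof. by rewrite ltr0n; lia. Qed.

Let sR : (0 : R) < s%:R. Proof. by rewrite ltr0n. Qed.

Let c0 : 0 <= c.
Proof. by rewrite !mulr_ge0// exprn_ge0// !mulr_ge0. Qed.

(** A Nikolskii inequality: Cauchy-Schwarz on the coefficients, then Parseval. *)
Let sup_e X : X \in mu -> nm e.[X] ^+ 2 <= N2.+1%:R / L%:R * S.
Proof.
move=> Xmu; rewrite /S (parseval hz se); last by lia.
rewrite mulrA divfK ?gt_eqF//.
apply: (@le_trans _ _ ((\sum_(i < N2.+1) 1 * nm e`_i) ^+ 2)).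
  rewrite lerXn2r ?nnegrE ?nm_ge0 ?sumr_ge0// => [i _|].
    by rewrite mulr_ge0 ?nm_ge0.
  rewrite (horner_coef_wide _ se) (le_trans (nm_sum _ _ _))//.
  by apply: ler_sum => i _; rewrite nmM nmX (nm_mu hz Xmu) expr1n mul1r mulr1.
apply: le_trans (weighted_CS _ _ _) _ => //.
rewrite sumr_const card_ord; apply: ler_wpM2l => //.
by apply: ler_sum => i _; rewrite mul1r.
Qed.

(** At most [4 m L / (J s)] points are bad and each carries at most [(N2 + 1) / L] of [S]. The
    product is at most one half because [8 m (N2 + 1) <= J s]. *)
Let bad_sum rs : (size rs <= m)%N ->
  \sum_(X <- mu | ~~ good rs X) nm e.[X] ^+ 2 <= S / 2.
Proof.
move=> rsm; set P := fun xi X => nm (X - xi) * (4 * (J * s)%:R) < 1.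
have cnt : (count (predC (good rs)) mu)%:R * (J * s)%:R <= m%:R * (4 * L%:R) :> R.
  apply: (@le_trans _ _ ((size rs)%:R * (4 * L%:R))); last first.
    by rewrite ler_wpM2r ?mulr_ge0// ler_nat.
  apply: (@le_trans _ _ (\sum_(xi <- rs) (count (P xi) mu)%:R * (J * s)%:R)).
    rewrite -mulr_suml ler_wpM2r// -natr_sum ler_nat.
    elim: rs {rsm} => [|xi rs IH]; first by rewrite big_nil (@eq_count _ _ pred0) ?count_pred0.
    rewrite big_cons; apply: leq_trans (leq_add (leqnn _) IH).
    rewrite -count_predUI; apply: leq_trans (leq_addr _ _).
    apply: sub_count => X /=; rewrite negb_and -ltNge -natrM /P.
    by case/orP => ->; rewrite ?orbT.
  have -> : (size rs)%:R * (4 * L%:R) = \sum_(xi <- rs) (4 * L%:R) :> R.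
    by rewrite big_const_seq count_predT iter_addr_0 mulr_natl.
  rewrite big_seq [leRHS]big_seq.
  by apply: ler_sum => xi _; apply: count_near; rewrite muln_gt0 J0 s0.
have Js : (0 : R) < (J * s)%:R by rewrite ltr0n muln_gt0 J0.
apply: (@le_trans _ _ ((count (predC (good rs)) mu)%:R * (N2.+1%:R / L%:R * S))).
  rewrite -sum1_count natr_sum mulr_suml big_seq_cond [leRHS]big_seq_cond.
  by apply: ler_sum => X /andP[Xmu _]; rewrite mul1r sup_e.
rewrite -(ler_pM2r Js) mulrAC.
apply: le_trans (ler_wpM2r _ cnt) _; first by rewrite mulr_ge0// divr_ge0.
have -> : m%:R * (4 * L%:R) * (N2.+1%:R / L%:R * S) = (8 * m * N2.+1)%:R * (S / 2).
  by rewrite !natrM; field; rewrite gt_eqF.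
by rewrite [leRHS]mulrC ler_wpM2r ?divr_ge0// ler_nat.
Qed.

(** [band_pointwise] divided by [|p X|]. By [poly_ratio] the quotient [|p Y| / |p X|] is at most
    [(4 J (1 + s |Y - X|))^m], and [wt_decay] absorbs its growth at the price of [3^(2 m) = 9^m]. *)
Let good_pointwise rs a X : (size rs <= m)%N -> a != 0 ->
  p = a *: \prod_(xi <- rs) ('X - xi%:P) -> X \in mu -> good rs X ->
  L%:R * s%:R ^+ 2 * nm e.[X] <=
  c * \sum_(Y <- mu) nm (dirichlet R s).[X * cj Y] ^+ 2 * `|u Y|.
Proof.
move=> rsm a0 pE Xmu /allP gX.
have pval Y : p.[Y] = a * \prod_(xi <- rs) (Y - xi).
  by rewrite pE hornerZ horner_prod; under eq_bigr do rewrite hornerXsubC.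
have J1' : (1 : R) <= J%:R by rewrite ler1n.
have px0 : 0 < nm p.[X].
  rewrite lt_def nm_ge0 andbT nm_eq0 pval mulf_neq0//.
  rewrite prodf_seq_neq0; apply/allP => xi xirs /=.
  apply/eqP => h; have := gX _ xirs; rewrite h nm0 mul0r; lra.
have ratio Y : Y \in mu -> nm p.[Y] <= nm p.[X] *
    ((4 * J%:R) ^+ m * (1 + s%:R * nm (X * cj Y - 1)) ^+ m).
  move=> Ymu; rewrite !pval !nmM -mulrA ler_wpM2l ?nm_ge0//.
  apply: le_trans (poly_ratio 0 Y J1' (ltW sR) gX) _.
  rewrite ler_wpM2l ?nm_ge0// -exprMn.
  have -> : nm (X * cj Y - 1) = nm (Y - X).
    rewrite nm_distC -[RHS]mulr1 -[X in _ = _ * X](nm_mu hz (mu_conj hz Ymu)) -nmM.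
    by rewrite mulrBl (mu_mulJ hz Ymu).
  apply: ler_weXn2l rsm.
  have : 0 <= s%:R * nm (Y - X) by rewrite mulr_ge0 ?nm_ge0.
  nra.
have := band_pointwise hz hB N1B _ sp se eband Xmu; rewrite -hT => /(_ LN).
rewrite -/u => h.
have s2m : 0 < s%:R ^+ m.*2 :> R by rewrite exprn_gt0.
rewrite -(ler_pM2l s2m) -(ler_pM2l px0).
apply: (@le_trans _ _ (4 * T%:R * \sum_(Y <- mu) wt s m.+1 (X * cj Y) *
    (nm p.[Y] * `|u Y|))).
  apply: le_trans h; rewrite doubleS (exprD _ 2 m.*2).
  rewrite le_eqVlt; apply/orP; left; apply/eqP; ring.
have -> : nm p.[X] * (s%:R ^+ m.*2 *
      (c * \sum_(Y <- mu) nm (dirichlet R s).[X * cj Y] ^+ 2 * `|u Y|)) =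
    4 * T%:R * \sum_(Y <- mu) (nm p.[X] * (4 * J%:R * 9) ^+ m *
      (s%:R ^+ m.*2 * nm (dirichlet R s).[X * cj Y] ^+ 2)) * `|u Y|.
  rewrite /c [in RHS](eq_bigr (fun Y => (nm p.[X] * (4 * J%:R * 9) ^+ m * s%:R ^+ m.*2) *
    (nm (dirichlet R s).[X * cj Y] ^+ 2 * `|u Y|))).
    by rewrite -mulr_sumr; move: (_ ^+ m) (_ ^+ m.*2) => a' b'; ring.
  by move=> Y _; rewrite !mulrA.
rewrite ler_wpM2l ?mulr_ge0// !big_seq; apply: ler_sum => Y Ymu.
have hZ : nm (X * cj Y) = 1.
  by rewrite nmM nmJ (nm_mu hz Xmu) (nm_mu hz Ymu) mulr1.
have h1 := ler_wpM2l (wt_ge0 s m.+1 (X * cj Y)) (ratio _ Ymu).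
have mm : (m <= m.*2)%N by rewrite -addnn leq_addr.
have h2 := wt_decay s mm hZ.
rewrite [leLHS]mulrA; apply: ler_wpM2r => //.
apply: le_trans h1 _.
have J4 : 0 <= (4 * J%:R) ^+ m :> R by rewrite exprn_ge0// mulr_ge0.
have := ler_wpM2l (mulr_ge0 (ltW px0) J4) h2.
rewrite [(3 * _) ^+ _]exprMn [(3 : R) ^+ m.*2](_ : _ = 9 ^+ m); last first.
  by rewrite -mul2n exprM; congr (_ ^+ _); ring.
rewrite [(_ * 9) ^+ m]exprMn.
move: ((4 * J%:R) ^+ m : R) ((9 : R) ^+ m) (s%:R ^+ m.*2 : R) ((1 + _) ^+ m) => a1 a2 a3 a4; lra.
Qed.

Let good_sum rs a : (size rs <= m)%N -> a != 0 ->
  p = a *: \prod_(xi <- rs) ('X - xi%:P) ->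
  \sum_(X <- mu | good rs X) nm e.[X] ^+ 2 <=
  (c / s%:R) ^+ 2 * \sum_(Y <- mu) u Y ^+ 2.
Proof.
move=> rsm a0 pE.
pose D Z := nm (dirichlet R s).[Z] ^+ 2.
pose V X := \sum_(Y <- mu) D (X * cj Y) * `|u Y|.
have V0 X : 0 <= V X by apply: sumr_ge0 => Y _; rewrite mulr_ge0 ?sqr_ge0.
have sL : (s <= L)%N by apply: leq_trans LJ; rewrite leq_pmull.
(* Young's inequality: [V] is the convolution of [|u|] with [D], whose total mass is [L s]. *)
have young : \sum_(X <- mu) V X ^+ 2 <= (L%:R * s%:R) ^+ 2 * \sum_(Y <- mu) u Y ^+ 2.
  apply: (@le_trans _ _ (\sum_(X <- mu) (L%:R * s%:R) *
      \sum_(Y <- mu) D (X * cj Y) * u Y ^+ 2)).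
    rewrite !big_seq; apply: ler_sum => X Xmu.
    apply: le_trans (weighted_CS _ _ _) _ => [Y|]; first exact: sqr_ge0.
    rewrite (sum_mu_div hz D Xmu) sum_dirichlet_sqr//.
    by under eq_bigr do rewrite real_normK ?num_real//.
  rewrite -mulr_sumr (expr2 (L%:R * s%:R)) -[leRHS]mulrA ler_wpM2l ?mulr_ge0// exchange_big/=.
  rewrite mulr_sumr !big_seq; apply: ler_sum => Y Ymu.
  by rewrite -mulr_suml (sum_mu_divC hz D Ymu) sum_dirichlet_sqr.
have Ls2 : 0 < L%:R * s%:R ^+ 2 :> R by rewrite mulr_gt0// exprn_gt0.
apply: (@le_trans _ _ (\sum_(X <- mu) (c / (L%:R * s%:R ^+ 2)) ^+ 2 * V X ^+ 2)).
  rewrite big_mkcond !big_seq; apply: ler_sum => X Xmu /=.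
  case: ifP => [gX|_]; last by rewrite mulr_ge0 ?sqr_ge0.
  rewrite -exprMn lerXn2r ?nnegrE ?nm_ge0 ?mulr_ge0 ?invr_ge0 ?(ltW Ls2)//.
  rewrite mulrAC ler_pdivlMr// mulrC.
  exact: good_pointwise pE Xmu gX.
rewrite -mulr_sumr.
apply: le_trans (ler_wpM2l (sqr_ge0 _) young) _.
rewrite le_eqVlt; apply/orP; left; apply/eqP; field.
by rewrite !gt_eqF.
Qed.

Lemma circle_band : S <= (2 * (c / s%:R) ^+ 2 + 1) * \sum_(Y <- mu) u Y ^+ 2.
Proof.
have u0 : 0 <= \sum_(Y <- mu) u Y ^+ 2 by apply: sumr_ge0 => Y _; exact: sqr_ge0.
(* The zero polynomial has no factorisation to use, but then [|u| = |e|]; the [+ 1] in the constant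
   covers this case. *)
have [p0|p0] := eqVneq p 0.
  have -> : S = \sum_(Y <- mu) u Y ^+ 2.
    by apply: eq_bigr => Y _; rewrite /u p0 horner0 add0r nm0 subr0.
  rewrite mulrDl [1 * _]mul1r lerDr; apply: mulr_ge0 => //; apply: mulr_ge0 => //; exact: sqr_ge0.
have [rs pE] := closed_field_poly_normal p.
have rsm : (size rs <= m)%N.
  move: sp; rewrite {1}pE size_scale ?lead_coef_eq0//.
  by rewrite (size_prod_XsubC rs id).
have a0 : lead_coef p != 0 by rewrite lead_coef_eq0.
have := good_sum rsm a0 pE; have := bad_sum rsm.
have : S = \sum_(X <- mu | good rs X) nm e.[X] ^+ 2 +
           \sum_(X <- mu | ~~ good rs X) nm e.[X] ^+ 2 by exact: bigID.
move=> SE; set V := \sum_(Y <- mu) _ in u0 *; move: (c / _) => a; lra.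
Qed.

End Band.
End Mu.

(* [4 t + 4 >= 8 (t / 2)] below: when [t] is the integer part of [|z|^2 / 2],
   indices outside [[t, 4 t + 4]] differ from [|z|^2] by a definite factor. *)
Definition in_band (t n : nat) := (t <= n <= 4 * t + 4)%N.

(** Chosen for [8 m (4 t + 5) <= J s]. For [s = t %/ (2 * m.+1)] one has [t < 4 (m + 1) s], so
    [4 t + 5 <= 21 (m + 1) s], and [168 = 8 * 21]. The successor keeps it positive when [m = 0]. *)
Definition circle_J m := (168 * m * m.+1).+1.
(** When [t < N], the part [30 * N.+1 + m] exceeds every degree that occurs, and [circle_J m * N.+1]
    bounds [J * s]. *)
Definition circle_L m N := ((30 + circle_J m) * N.+1 + m)%N.

Lemma circle_estimate (m : nat) : exists2 K : R, 0 < K &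
  forall (N L t : nat) (zeta : C) (e p : {poly C}),
  (circle_L m N <= L)%N -> L.-primitive_root zeta ->
  (2 * m.+1 <= t)%N -> (size e <= N)%N -> (size p <= m.+1)%N ->
  \sum_(n < N) nm e`_n ^+ 2 <=
  K * (L%:R^-1 * \sum_(Y <- rootsU zeta L) (nm (p.[Y] + e.[Y]) - nm p.[Y]) ^+ 2 +
       \sum_(n < N | ~~ in_band t n) nm e`_n ^+ 2).
Proof.
pose J := circle_J m.
(* Bounds the constant of [circle_band] independently of [t]:
   [T = 4 t + 5 + B <= (21 + 1) (m + 1) s]. *)
pose c : R := 4 * (22 * m.+1%:R) * (4 * J%:R * 9) ^+ m.
pose K0 := 2 * c ^+ 2 + 1.
have K00 : 0 < K0 by rewrite ltr_wpDl// mulr_ge0// sqr_ge0.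
exists (2 * K0 + 1); first by rewrite ltr_wpDl// mulr_ge0// ltW.
move=> N L t zeta e p LL hz tm eN sp.
set U := \sum_(Y <- rootsU _ _) _.
have U0 : 0 <= U by apply: sumr_ge0 => Y _; exact: sqr_ge0.
have L0 : (0 : R) < L%:R by rewrite ltr0n (prim_order_gt0 hz).
have iL : 0 <= L%:R^-1 :> R by rewrite invr_ge0 ltW.
(* If [N <= t], all indices lie below the band and the last sum is already the left-hand side. *)
have [Nt|tN] := leqP N t.
  have K1 : 0 <= 2 * K0 + 1 by lra.
  rewrite [leRHS]mulrDr; apply: ler_wpDl.
    by apply: mulr_ge0; [exact: K1|exact: mulr_ge0].
  rewrite [X in _ <= _ * X](_ : _ = \sum_(n < N) nm e`_n ^+ 2).
    by rewrite ler_peMl ?sumr_ge0// => [i _|]; rewrite ?sqr_ge0// lerDr mulr_ge0// ltW.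
  apply: eq_bigl => n; have := ltn_ord n; rewrite /in_band; lia.
(* This gives [B + m < (m + 1) s <= t / 2], so the kernel stays below the band, while [t / s]
   remains bounded. *)
pose s := (t %/ (2 * m.+1))%N.
pose B := (m.+1 * s.-1)%N.
pose N2 := (4 * t + 4)%N.
pose T := (N2 + B).+1.
have s0 : (0 < s)%N by rewrite divn_gt0// ?muln_gt0.
have s1 : (2 * m.+1 * s <= t)%N by rewrite mulnC leq_divM.
have s2 : (t < 4 * m.+1 * s)%N.
  have := ltn_ceil t (isT : (0 < 2 * m.+1)%N); rewrite -/s => h.
  apply: leq_trans h _; rewrite mulSn mulnC.
  have : (2 * m.+1 <= 2 * m.+1 * s)%N by rewrite leq_pmulr.
  lia.
have B1 : (B + m.+1 = m.+1 * s)%N.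
  by rewrite /B -mulnSr prednK.
have hs : (s <= t)%N by apply: leq_div.
have msm : (m.+1 <= m.+1 * s)%N by rewrite leq_pmulr.
pose em := \poly_(n < N2.+1) (if (t <= n)%N then e`_n else 0).
pose er := e - em.
have cem n : em`_n = if in_band t n then e`_n else 0.
  rewrite coef_poly /in_band /N2 ltnS andbC.
  by case: (n <= _)%N => //=; case: ifP.
have cer n : er`_n = if in_band t n then 0 else e`_n.
  by rewrite coefB cem; case: ifP; rewrite ?subrr ?subr0.
have JsN : (J * s <= J * N.+1)%N by rewrite leq_mul2l; lia.
have LLe : ((30 + J) * N.+1 + m <= L)%N by exact: LL.
rewrite mulnDl in LLe.
have JE : J = (168 * m * m.+1).+1 by [].
have hband : \sum_(Y <- rootsU zeta L) nm em.[Y] ^+ 2 <=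
    K0 * \sum_(Y <- rootsU zeta L) (nm (p.[Y] + em.[Y]) - nm p.[Y]) ^+ 2.
  have hJ : (8 * m * N2.+1 <= J * s)%N.
    have -> : (J * s = s + 8 * m * (21 * (m.+1 * s)))%N by rewrite JE; ring.
    by apply: leq_trans (leq_addl _ _); rewrite leq_mul2l /N2; lia.
  apply: le_trans (@circle_band L zeta hz s B T m t N2 J em p s0 _ _ _ _ _ _ _ _ _ _) _ => //.
  - by rewrite /B in B1 *; lia.
  - by rewrite /T /N2; lia.
  - by lia.
  - exact: size_poly.
  - by move=> n nt; rewrite cem /in_band leqNgt nt.
  apply: ler_wpM2r; first by apply: sumr_ge0 => Y _; exact: sqr_ge0.
  have c'0 : 0 <= 4 * T%:R * (4 * J%:R * 9) ^+ m / s%:R :> R.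
    by rewrite divr_ge0// mulr_ge0// exprn_ge0.
  have c'c : 4 * T%:R * (4 * J%:R * 9) ^+ m / s%:R <= c.
    rewrite ler_pdivrMr ?ltr0n// /c [leRHS]mulrAC ler_wpM2r ?exprn_ge0//.
    by rewrite -mulrA ler_wpM2l// -!natrM ler_nat -mulnA /T /N2; lia.
  by rewrite lerD2r ler_wpM2l// lerXn2r ?nnegrE// (le_trans c'0).
(* Dropping the frequencies outside the band changes the difference of moduli by at most [|er|]. *)
have hu : \sum_(Y <- rootsU zeta L) (nm (p.[Y] + em.[Y]) - nm p.[Y]) ^+ 2 <=
    2 * U + 2 * \sum_(Y <- rootsU zeta L) nm er.[Y] ^+ 2.
  rewrite !mulr_sumr -big_split/=; apply: ler_sum => Y _.
  have := nm_lip (p.[Y] + em.[Y]) (p.[Y] + e.[Y]).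
  rewrite opprD addrACA subrr add0r (nm_distC em.[Y]).
  have -> : e.[Y] - em.[Y] = er.[Y] by rewrite hornerD hornerN.
  set a := nm (p.[Y] + em.[Y]); set b := nm (p.[Y] + e.[Y]); set d := nm p.[Y].
  have r0 := nm_ge0 er.[Y].
  move=> h1; have h3 : (a - b) ^+ 2 <= nm er.[Y] ^+ 2.
    by rewrite -[X in X <= _]real_normK ?num_real// lerXn2r ?nnegrE.
  have := sqr_ge0 (a - b - (b - d)); rewrite !expr2 in h3 *; lra.
have pe : L%:R * \sum_(n < N) nm er`_n ^+ 2 = \sum_(Y <- rootsU zeta L) nm er.[Y] ^+ 2.
  rewrite (@parseval _ _ _ hz _ N)//; last by lia.
  apply/leq_sizeP => j Nj; rewrite cer; case: ifP => // _.
  by have /leq_sizeP := eN; apply.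
have pm : \sum_(Y <- rootsU zeta L) nm em.[Y] ^+ 2 = L%:R * \sum_(n < N) nm em`_n ^+ 2.
  rewrite (@parseval _ _ _ hz _ N)//; last by lia.
  apply/leq_sizeP => j Nj; rewrite cem; case: ifP => // _.
  by have /leq_sizeP := eN; apply.
have er_out : \sum_(n < N) nm er`_n ^+ 2 = \sum_(n < N | ~~ in_band t n) nm e`_n ^+ 2.
  rewrite [RHS]big_mkcond; apply: eq_bigr => n _; rewrite cer.
  by case: in_band; rewrite ?nm0 ?(expr0n _ 2).
have esum : \sum_(n < N) nm e`_n ^+ 2 =
    \sum_(n < N) nm em`_n ^+ 2 + \sum_(n < N) nm er`_n ^+ 2.
  rewrite -big_split/=; apply: eq_bigr => n _; rewrite cem cer.
  have z2 : nm 0 ^+ 2 = 0 :> R by rewrite nm0 expr0n.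
  by case: in_band; rewrite z2 ?addr0 ?add0r.
rewrite esum -er_out; set Sr := \sum_(n < N) nm er`_n ^+ 2 in pe *.
have Sr0 : 0 <= Sr by apply: sumr_ge0 => i _; exact: sqr_ge0.
have : \sum_(n < N) nm em`_n ^+ 2 <= K0 * (2 * (L%:R^-1 * U) + 2 * Sr).
  rewrite -(ler_pM2l L0) -pm.
  apply: le_trans hband _; rewrite mulrCA ler_wpM2l ?(ltW K00)//.
  apply: le_trans hu _; rewrite -pe.
  by rewrite le_eqVlt; apply/orP; left; apply/eqP; field; rewrite gt_eqF.
have : 0 <= L%:R^-1 * U by rewrite mulr_ge0.
rewrite mulrDr; lra.
Qed.

End Circle.

(** * Measurability and Lebesgue measure on the complex plane *)

Section MeasurableComplex.
Variable R : realType.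
Local Notation C := R[i].
Local Open Scope complex_scope.
Local Notation nm := (@Normc.normc R).
Local Notation cj := (@conjc R).
Context d (T : measurableType d).
Implicit Types f g : T -> C.

Lemma measurable_Re : measurable_fun [set: C] (@complex.Re R).
Proof. exact: measurableT_comp measurable_fst (@measurable_Cpair R). Qed.

Lemma measurable_Im : measurable_fun [set: C] (@complex.Im R).
Proof. exact: measurableT_comp measurable_snd (@measurable_Cpair R). Qed.

Lemma measurable_complexP f : measurable_fun setT f <->
  measurable_fun setT (@complex.Re R \o f) /\ measurable_fun setT (@complex.Im R \o f).
Proof.
split=> [mf|[mr mi]].
  by split; [exact: measurableT_comp measurable_Re mf|exact: measurableT_comp measurable_Im mf].
rewrite (_ : f = @pairC R \o (fun t => (complex.Re (f t), complex.Im (f t)))).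
  apply: measurableT_comp (@measurable_pairC R) _.
  by apply/measurable_fun_pairP.
by apply/funext => t /=; case: (f t).
Qed.

Lemma measurable_Complex (a b : T -> R) : measurable_fun setT a ->
  measurable_fun setT b -> measurable_fun setT (fun t => a t +i* b t).
Proof. by move=> ma mb; apply/measurable_complexP. Qed.

Lemma measurable_addc f g : measurable_fun setT f -> measurable_fun setT g ->
  measurable_fun setT (fun t => f t + g t).
Proof.
move=> /measurable_complexP[fr fi] /measurable_complexP[gr gi].
apply/measurable_complexP; split.
  rewrite (_ : _ \o _ = (@complex.Re R \o f) \+ (@complex.Re R \o g)).
    exact: measurable_funD.
  by apply/funext => t /=; rewrite raddfD.
rewrite (_ : _ \o _ = (@complex.Im R \o f) \+ (@complex.Im R \o g)).
  exact: measurable_funD.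
by apply/funext => t /=; rewrite raddfD.
Qed.

Lemma measurable_mulc f g : measurable_fun setT f -> measurable_fun setT g ->
  measurable_fun setT (fun t => f t * g t).
Proof.
move=> /measurable_complexP[fr fi] /measurable_complexP[gr gi].
apply/measurable_complexP; split.
  rewrite (_ : _ \o _ = (fun t => (@complex.Re R \o f) t * (@complex.Re R \o g) t -
      (@complex.Im R \o f) t * (@complex.Im R \o g) t)).
    by apply: measurable_funB; exact: measurable_funM.
  by apply/funext => t /=; case: (f t) => a b; case: (g t).
rewrite (_ : _ \o _ = (fun t => (@complex.Re R \o f) t * (@complex.Im R \o g) t +
      (@complex.Im R \o f) t * (@complex.Re R \o g) t)).
  by apply: measurable_funD; exact: measurable_funM.
by apply/funext => t /=; case: (f t) => a b; case: (g t).
Qed.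

Lemma measurable_conjc f : measurable_fun setT f ->
  measurable_fun setT (fun t => cj (f t)).
Proof.
move=> /measurable_complexP[fr fi].
rewrite (_ : (fun _ => _) = (fun t => (@complex.Re R \o f) t +i* (- (@complex.Im R \o f) t))).
  by apply: measurable_Complex => //; exact: measurableT_comp.
by apply/funext => t /=; case: (f t).
Qed.

Lemma measurable_sumc I (s : seq I) (h : I -> T -> C) :
  (forall i, measurable_fun setT (h i)) ->
  measurable_fun setT (fun t => \sum_(i <- s) h i t).
Proof.
move=> mh; elim: s => [|i s IH].
  by under eq_fun do rewrite big_nil; exact: measurable_cst.
by under eq_fun do rewrite big_cons; exact: measurable_addc.
Qed.

Lemma measurable_prodc I (s : seq I) (h : I -> T -> C) :
  (forall i, measurable_fun setT (h i)) ->
  measurable_fun setT (fun t => \prod_(i <- s) h i t).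
Proof.
move=> mh; elim: s => [|i s IH].
  by under eq_fun do rewrite big_nil; exact: measurable_cst.
by under eq_fun do rewrite big_cons; exact: measurable_mulc.
Qed.

Lemma measurable_expc f n : measurable_fun setT f ->
  measurable_fun setT (fun t => f t ^+ n).
Proof.
move=> mf; elim: n => [|n IH].
  by under eq_fun do rewrite expr0; exact: measurable_cst.
by under eq_fun do rewrite exprS; exact: measurable_mulc.
Qed.

Lemma measurable_nm f : measurable_fun setT f ->
  measurable_fun setT (fun t => nm (f t)).
Proof.
move=> /measurable_complexP[fr fi].
rewrite (_ : (fun _ => _) = (@Num.sqrt R) \o
   (fun t => (@complex.Re R \o f) t ^+ 2 + (@complex.Im R \o f) t ^+ 2)).
  apply: measurableT_comp.
    by apply: continuous_measurable_fun; exact: sqrt_continuous.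
  by apply: measurable_funD; exact: measurable_funX.
by apply/funext => t /=; case: (f t).
Qed.

End MeasurableComplex.

(** * Invariance of planar Lebesgue measure under rotations and its scaling *)

Section LebesgueComplex.
Variable R : realType.
Local Notation C := R[i].
Local Open Scope complex_scope.
Local Open Scope ereal_scope.
Local Notation nm := (@Normc.normc R).
Local Notation leb := (@lebesgue_measure R).

(** Both sides are measures in [A], and half-open intervals, on which they agree, determine Lebesgue
    measure. *)
Lemma lebesgue_affine (c b : R) : (0 < c)%R ->
  forall A : set R, measurable A ->
  leb A = c%:E * leb ((fun x : R => c * x + b)%R @^-1` A).
Proof.
move=> c0; pose phi (x : R) : measurableTypeR R := (c * x + b)%R.
have mphi : measurable_fun [set: measurableTypeR R] phi.
  by apply: measurable_funD => //; apply: measurable_funM.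
move=> A mA.
rewrite (lebesgue_measure_unique (mu := mscale (NngNum (ltW c0))
  (pushforward leb phi)))// => _ [[u w]] _ <-.
rewrite -[RHS]/(c%:E * leb (phi @^-1` `]u, w])) 
    (_ : phi @^-1` _ = `]((u - b) / c)%R, ((w - b) / c)%R]%classic).
  rewrite !lebesgue_measure_itv/= !lte_fin ltr_pM2r ?invr_gt0// ltrD2r.
  case: ifP => _; last by rewrite mule0.
  by rewrite -!EFinB -EFinM; congr EFin; field; rewrite gt_eqF.
apply/seteqP; split => x /=; rewrite !in_itv/= ltr_pdivrMr// ler_pdivlMr//;
  by rewrite ltrBlDr lerBrDr mulrC.
Qed.

Lemma integral_affine (c b : R) (f : R -> \bar R) : (0 < c)%R ->
  measurable_fun [set: R] f -> (forall x, 0 <= f x) ->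
  \int[leb]_x f (c * x + b)%R = c^-1%:E * \int[leb]_x f x.
Proof.
move=> c0 mf f0; pose phi (x : R) : measurableTypeR R := (c * x + b)%R.
have mphi : measurable_fun [set: measurableTypeR R] phi.
  by apply: measurable_funD => //; apply: measurable_funM.
have -> : \int[leb]_x f (c * x + b)%R = \int[pushforward leb phi]_x f x.
  by rewrite ge0_integral_pushforward.
pose nu : {measure set (measurableTypeR R) -> \bar R} := pushforward leb phi.
pose nu' : {measure set (measurableTypeR R) -> \bar R} :=
  mscale (NngNum (ltW c0)) (nu mphi).
have -> : \int[leb]_x f x = \int[nu']_x f x.
  apply: eq_measure_integral => A mA _; exact: (lebesgue_affine b c0).
by rewrite ge0_integral_mscale// muleA -EFinM mulVf ?mul1e ?gt_eqF.
Qed.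

Lemma integral_lebesgueC_yx (f : C -> \bar R) : measurable_fun setT f ->
  (forall z, 0 <= f z) ->
  \int[lebesgueC R]_z f z = \int[leb]_y \int[leb]_x f (x +i* y).
Proof.
move=> mf f0.
have -> : \int[lebesgueC R]_z f z = \int[leb \x leb]_x f (pairC x).
  rewrite -[LHS]/(\int[pushforward (leb \x leb) (@pairC R)]_z f z).
  rewrite ge0_integral_pushforward//; exact: measurable_pairC.
rewrite fubini_tonelli2//=.
by apply: measurableT_comp => //; exact: measurable_pairC.
Qed.

Lemma integral_lebesgueC_xy (f : C -> \bar R) : measurable_fun setT f ->
  (forall z, 0 <= f z) ->
  \int[lebesgueC R]_z f z = \int[leb]_x \int[leb]_y f (x +i* y).
Proof.
move=> mf f0.
have -> : \int[lebesgueC R]_z f z = \int[leb \x leb]_x f (pairC x).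
  rewrite -[LHS]/(\int[pushforward (leb \x leb) (@pairC R)]_z f z).
  rewrite ge0_integral_pushforward//; exact: measurable_pairC.
rewrite fubini_tonelli1//=.
by apply: measurableT_comp => //; exact: measurable_pairC.
Qed.

Lemma measurable_slicex (f : C -> \bar R) y : measurable_fun setT f ->
  measurable_fun [set: R] (fun x => f (x +i* y)).
Proof.
move=> mf; apply: (measurableT_comp mf).
exact: measurable_Complex.
Qed.

Lemma measurable_slicey (f : C -> \bar R) x : measurable_fun setT f ->
  measurable_fun [set: R] (fun y => f (x +i* y)).
Proof.
move=> mf; apply: (measurableT_comp mf).
exact: measurable_Complex.
Qed.

(** On each horizontal line the shear is a translation. *)
Lemma integral_shearx (a : R) (f : C -> \bar R) : measurable_fun setT f ->
  (forall z, 0 <= f z) ->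
  \int[lebesgueC R]_z f ((complex.Re z + a * complex.Im z)%R +i* complex.Im z) =
  \int[lebesgueC R]_z f z.
Proof.
move=> mf f0; rewrite !integral_lebesgueC_yx//=.
  apply: eq_integral => y _.
  have := @integral_affine 1 (a * y) _ ltr01 (measurable_slicex y mf) (fun=> f0 _).
  rewrite invr1 mul1e => <-.
  by apply: eq_integral => x _; rewrite mul1r.
apply: (measurableT_comp mf); apply: measurable_Complex; last exact: measurable_Im.
apply: measurable_funD; first exact: measurable_Re.
by apply: measurable_funM => //; exact: measurable_Im.
Qed.

Lemma integral_sheary (a : R) (f : C -> \bar R) : measurable_fun setT f ->
  (forall z, 0 <= f z) ->
  \int[lebesgueC R]_z f (complex.Re z +i* (complex.Im z + a * complex.Re z)%R) =
  \int[lebesgueC R]_z f z.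
Proof.
move=> mf f0; rewrite !integral_lebesgueC_xy//=.
  apply: eq_integral => x _.
  have := @integral_affine 1 (a * x) _ ltr01 (measurable_slicey x mf) (fun=> f0 _).
  rewrite invr1 mul1e => <-.
  by apply: eq_integral => y _; rewrite mul1r.
apply: (measurableT_comp mf); apply: measurable_Complex; first exact: measurable_Re.
apply: measurable_funD; first exact: measurable_Im.
by apply: measurable_funM => //; exact: measurable_Re.
Qed.

Lemma measurable_mulcl (w : C) : measurable_fun setT (fun z : C => (w * z)%R).
Proof. by apply: measurable_mulc => //; exact: measurable_id. Qed.

(* A rotation other than [-1] is a product of three shears. *)
Lemma integral_rotC (w : C) (f : C -> \bar R) : nm w = 1%R ->
  measurable_fun setT f -> (forall z, 0 <= f z) ->
  \int[lebesgueC R]_z f (w * z)%R = \int[lebesgueC R]_z f z.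
Proof.
have main (c s : R) (g : C -> \bar R) : (c ^+ 2 + s ^+ 2 = 1)%R -> (c != -1)%R ->
    measurable_fun setT g -> (forall z, 0 <= g z) ->
    \int[lebesgueC R]_z g ((c +i* s) * z)%R = \int[lebesgueC R]_z g z.
  move=> cs c1 mg g0.
  have c10 : (1 + c != 0)%R by rewrite addrC addr_eq0.
  (* The tangent of half the angle. The shears are by [-t] along the real axis, [s] along the
     imaginary one, and [-t] along the real one again. *)
  pose t := (s / (1 + c))%R.
  pose X (u : C) : C := (complex.Re u + - t * complex.Im u)%R +i* complex.Im u.
  pose Y (u : C) : C := complex.Re u +i* (complex.Im u + s * complex.Re u)%R.
  have mX : measurable_fun setT X.
    apply: measurable_Complex; last exact: measurable_Im.
    apply: measurable_funD; first exact: measurable_Re.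
    by apply: measurable_funM => //; exact: measurable_Im.
  have mY : measurable_fun setT Y.
    apply: measurable_Complex; first exact: measurable_Re.
    apply: measurable_funD; first exact: measurable_Im.
    by apply: measurable_funM => //; exact: measurable_Re.
  rewrite -(integral_shearx (- t) mg g0).
  rewrite -(integral_sheary s (measurableT_comp mg mX) (fun=> g0 _))/=.
  rewrite -(integral_shearx (- t) (measurableT_comp (measurableT_comp mg mX) mY) (fun=> g0 _)).
  apply: eq_integral => -[x y] _ /=; congr g; rewrite /X /Y /=.
  have tE : (t * (1 + c) = s)%R by rewrite /t divfK.
  have ts : (t * s = 1 - c)%R.
    apply: (mulIf c10); rewrite mulrAC tE; rewrite -expr2.
    have -> : (s ^+ 2 = 1 - c ^+ 2)%R by rewrite -cs; ring.
    ring.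
  have yE : (y + s * (x + - t * y) = c * y + s * x)%R.
    have -> : (y + s * (x + - t * y) = s * x + y - (t * s) * y)%R by ring.
    by rewrite ts; ring.
  apply/eqP; rewrite eq_complex /= yE addrC eqxx andbT; apply/eqP.
  have -> : (x + - t * y + - t * (c * y + s * x) =
    x - (t * s) * x - (t * (1 + c)) * y)%R by ring.
  by rewrite ts tE; ring.
move=> w1 mf f0; case: w w1 => c s w1.
have cs : (c ^+ 2 + s ^+ 2 = 1)%R.
  by have := nm_sqr (c +i* s); rewrite w1 expr1n.
have [cN1|] := eqVneq c (-1)%R; last by move=> ?; exact: main.
have s0 : s = 0%R.
  by apply/eqP; rewrite -sqrf_eq0; apply/eqP; move: cs; rewrite cN1; lra.
have i1 : ((0 : R) ^+ 2 + 1 ^+ 2 = 1)%R by rewrite expr0n expr1n add0r.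
have i2 : (0 : R)%R != (-1)%R by rewrite eq_sym oppr_eq0 oner_eq0.
(* The rotation by [-1] is the square of that by [i], to which [main] applies. *)
rewrite -(main 0%R 1%R f)// -(main 0%R 1%R (fun z => f ((0 +i* 1)%C * z)%R))//.
  apply: eq_integral => -[x y] _; congr f; rewrite cN1 s0.
  apply/eqP; rewrite eq_complex /=; apply/andP; split; apply/eqP; ring.
by apply: (measurableT_comp mf); exact: measurable_mulcl.
Qed.

Lemma integral_scaleC (c : R) (f : C -> \bar R) : (0 < c)%R ->
  measurable_fun setT f -> (forall z, 0 <= f z) ->
  \int[lebesgueC R]_z f (c%:C * z)%R = (c ^- 2)%:E * \int[lebesgueC R]_z f z.
Proof.
move=> c0 mf f0.
have mcf : measurable_fun setT (fun z => f (c%:C * z)%R).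
  by apply: (measurableT_comp mf); exact: measurable_mulcl.
rewrite !integral_lebesgueC_yx//.
have mF : measurable_fun setT (fun y => \int[leb]_x f (x +i* y)).
  have mp : measurable_fun setT (f \o @pairC R).
    by apply: measurableT_comp => //; exact: measurable_pairC.
  exact: (measurable_fun_fubini_tonelli_G (m1 := leb) (f \o @pairC R) mp (fun=> f0 _)).
have F0 y : 0 <= \int[leb]_x f (x +i* y) by apply: integral_ge0.
rewrite expr2 invfM EFinM -muleA.
rewrite -[X in _ * X](@integral_affine c 0 _ c0 mF F0).
rewrite -ge0_integralZl_EFin ?invr_ge0 ?(ltW c0)//; last first.
  have mphi : measurable_fun [set: measurableTypeR R]
      (fun y : R => (c * y + 0)%R : measurableTypeR R).
    by apply: measurable_funD => //; apply: measurable_funM.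
  exact: (measurableT_comp mF mphi).
apply: eq_integral => y _.
rewrite -(@integral_affine c 0 _ c0 (measurable_slicex _ mf) (fun=> f0 _)).
by apply: eq_integral => x _; congr f; apply/eqP; rewrite eq_complex /=; apply/andP;
  split; apply/eqP; ring.
Qed.

End LebesgueComplex.

(** * Gaussian moments and complex Hermite polynomials *)

Section GaussianMoments.
Variable R : realType.
Local Notation C := R[i].
Local Open Scope complex_scope.
Local Notation nm := (@Normc.normc R).
Local Notation leb := (@lebesgue_measure R).

Let is_derive_invpow k (x : R) : 0 <= x ->
  is_derive x 1 (fun y : R => ((1 + y) ^+ k.+1)^-1) (- k.+1%:R * ((1 + x) ^+ k.+2)^-1).
Proof.
move=> x0; have x1 : 1 + x != 0 by rewrite gt_eqF// ltr_pwDl.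
pose g : R -> R := cst 1 + id.
have -> : (fun y : R => ((1 + y) ^+ k.+1)^-1) = (fun y => ((g ^+ k.+1) y)^-1).
  by apply/funext => y; rewrite exprfctE.
have gx : (g ^+ k.+1) x != 0 by rewrite exprfctE expf_neq0.
have dg : is_derive x 1 g (0 + 1) by apply: is_deriveD.
apply: is_derive_eq (is_deriveV gx (is_deriveX k.+1 dg)) _.
rewrite add0r /= exprfctE /GRing.scale /= mulr1 -/(1 + x).
have -> : g x = 1 + x by [].
rewrite !exprS; field; by rewrite x1 expf_neq0.
Qed.

Lemma integral_invpow n :
  (\int[leb]_(x in `[0%R, +oo[) (((1 + x) ^+ n.+2)^-1)%:E = (n.+1%:R^-1)%:E)%E.
Proof.
pose F (x : R) : R := - n.+1%:R^-1 * ((1 + x) ^+ n.+1)^-1.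
have dF (x : R) : 0 <= x -> is_derive x 1 F (((1 + x) ^+ n.+2)^-1).
  move=> x0; have -> : F = (- n.+1%:R^-1) \*: (fun y : R => ((1 + y) ^+ n.+1)^-1) by [].
  have h := is_derive_invpow n x0.
  rewrite [X in is_derive _ _ _ X](_ : _ =
    - n.+1%:R^-1 *: (- n.+1%:R * ((1 + x) ^+ n.+2)^-1)); first exact: is_deriveZ.
  by rewrite /GRing.scale /= mulrA mulrNN mulVf ?mul1r// pnatr_eq0.
have cF (x : R) : 0 <= x -> {for x, continuous F}.
  move=> x0; apply/differentiable_continuous/derivable1_diffP.
  by have [] := dF _ x0.
rewrite (@ge0_continuous_FTC2y _ _ F 0 0).
- by rewrite /F addr0 expr1n invr1 mulr1 -EFinB sub0r opprK.
- by move=> x x0; rewrite invr_ge0 exprn_ge0// addr_ge0.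
- apply: derivable_within_continuous => x; rewrite in_itv/= andbT => x0.
  by have [] := is_derive_invpow n.+1 x0.
- rewrite -[X in _ --> X](mulr0 (- n.+1%:R^-1)); apply: cvgM; first exact: cvg_cst.
  apply/gtr0_cvgV0.
    by near=> x; rewrite exprn_gt0// ltr_pwDl//.
  apply/cvgryPge => A; near=> x.
  have x0 : 0 <= x by [].
  have x1 : 1 <= 1 + x by rewrite lerDl.
  apply: (@le_trans _ _ (1 + x)); first by rewrite ler_wpDl.
  by rewrite exprS ler_peMr ?(le_trans ler01)// exprn_ege1.
- by move=> x x0; have [] := dF _ (ltW x0).
- by apply: cvg_at_right_filter; exact: cF.
- move=> x; rewrite in_itv/= andbT => x0.
  by rewrite derive1E; have [_ ->] := dF _ (ltW x0).
Unshelve. all: by end_near.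
Qed.

Definition gauss_moment l : \bar R :=
  (\int[lebesgueC R]_z ((nm z ^+ 2) ^+ l * expR (- nm z ^+ 2))%:E)%E.

Lemma measurable_nmid : measurable_fun [set: C] nm.
Proof. by apply: (@measurable_nm _ _ _ id); exact: measurable_id. Qed.

Lemma measurable_gauss1 : measurable_fun [set: C] (fun z => expR (- nm z ^+ 2)).
Proof.
apply: measurableT_comp; first exact: measurable_expR.
apply: measurableT_comp => //; apply: measurable_funX; exact: measurable_nmid.
Qed.

Lemma measurable_moment l :
  measurable_fun [set: C] (fun z => ((nm z ^+ 2) ^+ l * expR (- nm z ^+ 2))%:E).
Proof.
apply/measurable_EFinP; apply: measurable_funM; last exact: measurable_gauss1.
by do 2 apply: measurable_funX; exact: measurable_nmid.
Qed.

Lemma gauss_moment0 : gauss_moment 0 = pi%:E.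
Proof.
rewrite /gauss_moment integral_lebesgueC_yx; last 2 first.
- exact: measurable_moment.
- by move=> z; rewrite lee_fin mulr_ge0// expr0.
have gE : (Num.sqrt (@pi R))%:E = (\int[leb]_x (expR (- x ^+ 2))%:E)%E.
  by rewrite -integralT_gauss.
have mg : measurable_fun [set: R] (fun x : R => (expR (- x ^+ 2))%:E).
  by apply/measurable_EFinP; exact: measurable_gauss_fun.
transitivity (\int[leb]_y ((Num.sqrt (@pi R))%:E * (expR (- y ^+ 2))%:E))%E.
  apply: eq_integral => y _.
  transitivity (\int[leb]_x ((expR (- y ^+ 2))%:E * (expR (- x ^+ 2))%:E))%E.
    apply: eq_integral => x _; rewrite expr0 mul1r nm_sqr/= -EFinM -expRD.
    by congr (expR _)%:E; ring.
  by rewrite ge0_integralZl_EFin// -?gE 1?muleC// => x _; rewrite lee_fin.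
rewrite ge0_integralZl_EFin ?sqrtr_ge0//.
by rewrite -gE -EFinM -expr2 sqr_sqrtr// pi_ge0.
Qed.

Lemma lebesgueC_point : lebesgueC R [set 0] = 0%E.
Proof.
rewrite -[LHS]/((leb \x leb)%E (@pairC R @^-1` [set 0])).
rewrite (_ : _ @^-1` _ = [set 0] `*` [set 0]).
  by rewrite product_measure1E//= lebesgue_measure_set1 mul0e.
by apply/seteqP; split => -[x y] /= => [[-> ->]|[-> ->]].
Qed.

(** Tonelli for [|z|^(2 l + 2) exp (- |z|^2 (1 + s))] over [z] in [C] and [s >= 0] replaces polar
    coordinates and integration by parts. Integrating first in [s] gives the moment of order [l];
    first in [z], a scaling gives [(1 + s)^-(l + 2)] times the moment of order [l + 1], and the
    integral in [s] is [1 / (l + 1)]. *)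
Lemma gauss_momentS l : gauss_moment l.+1 = (l.+1%:R%:E * gauss_moment l)%E.
Proof.
pose U (p : C * R) : \bar R := ((nm p.1 ^+ 2) ^+ l.+1 *
  expR (- nm p.1 ^+ 2 * (1 + p.2)) * \1_`[0%R, +oo[ p.2)%:E.
have mU : measurable_fun setT U.
  apply/measurable_EFinP; apply: measurable_funM; first apply: measurable_funM.
  - apply: measurable_funX; apply: measurable_funX.
    by apply: measurable_nm; exact: measurable_fst.
  - apply: measurableT_comp; first exact: measurable_expR.
    apply: measurable_funM.
      apply: measurableT_comp => //; apply: measurable_funX.
      by apply: measurable_nm; exact: measurable_fst.
    by apply: measurable_funD => //; exact: measurable_snd.
  - by apply: measurableT_comp; [exact: measurable_indic|exact: measurable_snd].
have U0 p : (0 <= U p)%E.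
  by rewrite lee_fin mulr_ge0// mulr_ge0// exprn_ge0// sqr_ge0.
have := fubini_tonelli (m1 := lebesgueC R) (m2 := leb) U mU U0.
have inner1 z : z != 0 -> (\int[leb]_s U (z, s))%E =
    ((nm z ^+ 2) ^+ l * expR (- nm z ^+ 2))%:E.
  move=> z0; have r0 : 0 < nm z ^+ 2.
    by rewrite exprn_gt0// lt_def nm_ge0 nm_eq0 z0.
  transitivity (\int[leb]_s (((nm z ^+ 2) ^+ l * expR (- nm z ^+ 2))%:E *
      (exponential_pdf (nm z ^+ 2) s)%:E))%E.
    apply: eq_integral => s _; rewrite /U /= -EFinM; congr EFin.
    rewrite /exponential_pdf patchE indicE.
    case: ifP => _; last by rewrite !mulr0.
    by rewrite mulrDr mulr1 expRD exprSr mulr1; ring.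
  rewrite ge0_integralZl_EFin//.
  - by rewrite integral_exponential_pdf// mule1.
  - by move=> s _; rewrite lee_fin exponential_pdf_ge0// ltW.
  - by apply/measurable_EFinP; exact: measurable_exponential_pdf.
  - by rewrite mulr_ge0// exprn_ge0// sqr_ge0.
(* The equality [inner1] can fail at the origin, a null set: for [l = 0] the integrand on the right
   is 1 there. *)
rewrite (_ : (\int[lebesgueC R]_x _)%E = gauss_moment l); last first.
  apply: ge0_ae_eq_integral => //.
  - exact: measurable_fun_fubini_tonelli_F.
  - exact: measurable_moment.
  - by move=> z _; exact: integral_ge0.
  - by move=> z _; rewrite lee_fin mulr_ge0// exprn_ge0// sqr_ge0.
  - exists [set 0]; split; [|exact: lebesgueC_point|].
      rewrite -[X in measurable X](_ : @Cpair R @^-1` ([set 0] `*` [set 0]) = _).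
        rewrite -[X in measurable X]setTI; apply: measurable_Cpair => //.
        exact: measurableX.
      by apply/seteqP; split => -[x y] /= => [[-> ->]|[-> ->]].
    move=> z /= h; apply: contrapT => /eqP z0; apply: h => _; exact: inner1.
(* The absolute value makes the weight continuous on the whole line, whence its measurability. *)
have inner2 s : (\int[lebesgueC R]_z U (z, s))%E =
    (gauss_moment l.+1 * (((1 + `|s|) ^+ l.+2)^-1 * \1_`[0%R, +oo[ s)%:E)%E.
  have [s0|s0] := leP 0 s; last first.
    rewrite [X in (_ * X%:E)%E](_ : _ = 0) ?mule0; last first.
      by rewrite indicE memNset ?mulr0//= in_itv/= andbT leNgt s0.
    rewrite integral0_eq// => z _; rewrite /U/= indicE memNset ?mulr0//=.
    by rewrite in_itv/= andbT leNgt s0.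
  have s1 : 0 < 1 + s by rewrite ltr_pwDl.
  have c0 : 0 < Num.sqrt (1 + s) by rewrite sqrtr_gt0.
  have ind1 : \1_(`[0%R, +oo[ : set R) s = 1 :> R.
    by rewrite indicE mem_set//= in_itv/= andbT.
  rewrite ind1 mulr1 ger0_norm//.
  transitivity (\int[lebesgueC R]_z (((1 + s) ^- l.+1)%:E *
      ((nm ((Num.sqrt (1 + s))%:C * z) ^+ 2) ^+ l.+1 *
        expR (- nm ((Num.sqrt (1 + s))%:C * z) ^+ 2))%:E))%E.
    apply: eq_integral => z _; rewrite /U /= ind1 mulr1 -EFinM; congr EFin.
    have -> : nm ((Num.sqrt (1 + s))%:C * z) ^+ 2 = (1 + s) * nm z ^+ 2.
      by rewrite nmM nm_real ger0_norm ?sqrtr_ge0// exprMn sqr_sqrtr ?ltW.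
    rewrite [in RHS]exprMn -[in RHS]mulrA mulKf; last by rewrite expf_neq0// gt_eqF.
    by congr (_ * expR _); ring.
  rewrite ge0_integralZl_EFin//; last 3 first.
  - by move=> z _; rewrite lee_fin mulr_ge0// exprn_ge0// sqr_ge0.
  - by apply: (measurableT_comp (measurable_moment l.+1)); exact: measurable_mulcl.
  - by rewrite invr_ge0 exprn_ge0// ltW.
  rewrite (integral_scaleC c0 (measurable_moment l.+1)) => [|z]; last first.
    by rewrite lee_fin mulr_ge0// exprn_ge0// sqr_ge0.
  rewrite sqr_sqrtr ?ltW// muleA muleC -EFinM; congr (_ * _%:E)%E.
  by rewrite [in RHS]exprS invfM mulrC.
rewrite [X in _ = X -> _](_ : _ = (gauss_moment l.+1 * (l.+1%:R^-1)%:E)%E); last first.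
  under eq_integral do rewrite /fubini_G inner2.
  have mg : measurable_fun [set: R] (fun x : R => ((1 + `|x|) ^+ l.+2)^-1).
    apply: continuous_measurable_fun => x.
    apply: cvgV; first by rewrite expf_neq0// gt_eqF// ltr_pwDl.
    apply: (@continuous_comp _ _ _ (fun x : R => 1 + `|x|) (fun y => y ^+ l.+2)).
      by apply: cvgD; [exact: cvg_cst|exact: norm_continuous].
    exact: exprn_continuous.
  have mh : measurable_fun [set: R]
      (fun x : R => (((1 + `|x|) ^+ l.+2)^-1 * \1_`[0%R, +oo[ x)%:E).
    by apply/measurable_EFinP; apply: measurable_funM => //; exact: measurable_indic.
  rewrite (@ge0_integralZl _ _ _ leb setT measurableT _ mh)//; last first.
    by apply: integral_ge0 => z _; rewrite lee_fin mulr_ge0// exprn_ge0// sqr_ge0.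
  rewrite -integral_invpow [in RHS]integral_mkcond; congr (_ * _)%E.
  apply: eq_integral => x _; rewrite patchE indicE.
  case: ifPn => [|_]; last by rewrite mulr0.
  by rewrite inE/= in_itv/= andbT => x0; rewrite mulr1 ger0_norm.
by move=> ->; rewrite muleC -muleA -EFinM mulVf ?mule1.
Qed.

Lemma gauss_momentE l : gauss_moment l = (pi * l`!%:R)%:E.
Proof.
elim: l => [|l IH]; first by rewrite gauss_moment0 fact0 mulr1.
by rewrite gauss_momentS IH -EFinM factS natrM; congr EFin; ring.
Qed.

End GaussianMoments.

(** * Complex Hermite polynomials: norm, recurrences and variance *)

Section ComplexHermite.
Variable R : realType.
Local Notation C := R[i].
Local Open Scope complex_scope.
Local Notation nm := (@Normc.normc R).
Local Notation cj := (@conjc R).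

Lemma nmD3_sqr (a b d : C) :
  nm (a + b + d) ^+ 2 <= 3 * (nm a ^+ 2 + nm b ^+ 2 + nm d ^+ 2).
Proof.
have : nm (a + b + d) <= nm a + nm b + nm d.
  by apply: le_trans (nmD _ _) _; rewrite lerD2r nmD.
move: (nm_ge0 (a + b + d)); move: (nm a) (nm b) (nm d) (nm _) => x y w v v0 vle.
have := sqr_ge0 (x - y); have := sqr_ge0 (x - w); have := sqr_ge0 (y - w).
have : v ^+ 2 <= (x + y + w) ^+ 2 by rewrite lerXn2r ?nnegrE// (le_trans v0).
by rewrite !expr2; lra.
Qed.

Lemma cjM (a b : C) : cj (a * b) = cj a * cj b.
Proof. exact: rmorphM. Qed.

Lemma cjX (a : C) n : cj (a ^+ n) = cj a ^+ n.
Proof. exact: rmorphXn. Qed.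

(** The unnormalised complex Hermite (Ito) polynomials, [(conj z - d/dz)^k] applied to [z^n]. At
    [n = 0] the default [0.-1 = 0] is harmless, since its coefficient is zero. *)
Fixpoint hermite k n (z : C) : C :=
  if k is k'.+1 then cj z * hermite k' n z - n%:R * hermite k' n.-1 z else z ^+ n.

Lemma hermiteS k n z :
  hermite k.+1 n z = cj z * hermite k n z - n%:R * hermite k n.-1 z.
Proof. by []. Qed.

(** With [A = conj z - d/dz] the commutator of [z] and [A] is 1, hence
    [z A^k = A^k z + k A^(k - 1)]. *)
Lemma mulz_hermite k n z :
  z * hermite k n z = hermite k n.+1 z + k%:R * hermite k.-1 n z.
Proof.
elim: k n => [|k IH] n; first by rewrite /= mul0r addr0 exprS.
have h1 : n%:R * (z * hermite k n.-1 z) =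
    n%:R * (hermite k n z + k%:R * hermite k.-1 n.-1 z).
  by case: n => [|n]; rewrite ?mul0r// IH.
have h2 : k%:R * hermite k n z = cj z * (k%:R * hermite k.-1 n z) -
    n%:R * (k%:R * hermite k.-1 n.-1 z).
  by case: k {IH h1} => [|k]; rewrite ?mul0r ?mulr0 ?subrr// hermiteS; ring.
rewrite !hermiteS mulrBr mulrCA IH [z * (n%:R * _)]mulrCA h1 /= -!natr1.
transitivity (cj z * hermite k n.+1 z - n%:R * hermite k n z + k%:R * hermite k n z).
  by rewrite h2; ring.
ring.
Qed.

Lemma mulzJ_hermite k n z :
  cj z * hermite k n z = hermite k.+1 n z + n%:R * hermite k n.-1 z.
Proof. by rewrite hermiteS subrK. Qed.

Lemma rho_hermite k n z : z * cj z * hermite k n z =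
  hermite k.+1 n.+1 z + (n + k).+1%:R * hermite k n z +
  (n * k)%:R * hermite k.-1 n.-1 z.
Proof.
rewrite -mulrA mulzJ_hermite mulrDr mulz_hermite mulrCA mulz_hermite /=.
have -> : (n + k).+1%:R = n%:R + k%:R + 1 :> C by rewrite -natr1 natrD.
have -> : k.+1%:R = k%:R + 1 :> C by rewrite -natr1.
by rewrite natrM; case: n => [|n] /=; ring.
Qed.

Definition hcoef k n j : R := (-1) ^+ j * 'C(k, j)%:R * (n ^_ j)%:R.

Lemma hcoefSS k n j :
  hcoef k.+1 n j.+1 = hcoef k n j.+1 - n%:R * hcoef k n.-1 j.
Proof. by rewrite /hcoef binS natrD ffactnS natrM exprS; ring. Qed.

Lemma hcoef_gt k n j : (k < j)%N -> hcoef k n j = 0.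
Proof. by move=> kj; rewrite /hcoef bin_small// mulr0 mul0r. Qed.

Lemma hcoef_gtr k n j : (n < j)%N -> hcoef k n j = 0.
Proof. by move=> nj; rewrite /hcoef ffact_small// mulr0. Qed.

Lemma hermiteE k n z :
  hermite k n z = \sum_(j < k.+1) (hcoef k n j)%:C * z ^+ (n - j) * cj z ^+ (k - j).
Proof.
elim: k n => [|k IH] n.
  rewrite big_ord1 /=; have -> : hcoef 0 n 0 = 1.
    by rewrite /hcoef bin0 ffactn0 expr0 !mulr1.
  by rewrite subn0 subnn expr0 mulr1 mul1r.
rewrite hermiteS !IH [RHS]big_ord_recl /=.
under [in RHS]eq_bigr do rewrite hcoefSS.
transitivity (\sum_(j < k.+1) (hcoef k n j)%:C * z ^+ (n - j) * cj z ^+ (k.+1 - j) -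
  n%:R * \sum_(j < k.+1) (hcoef k n.-1 j)%:C * z ^+ (n.-1 - j) * cj z ^+ (k - j)).
  congr (_ - n%:R * _); rewrite mulr_sumr; apply: eq_bigr => j _.
  by rewrite subSn ?exprS; [ring|rewrite -ltnS].
have -> : \sum_(j < k.+1) (hcoef k n j)%:C * z ^+ (n - j) * cj z ^+ (k.+1 - j) =
    (hcoef k n 0)%:C * z ^+ n * cj z ^+ k.+1 +
    \sum_(j < k.+1) (hcoef k n j.+1)%:C * z ^+ (n - j.+1) * cj z ^+ (k - j).
  rewrite big_ord_recl subn0; congr (_ + _).
  rewrite [RHS]big_ord_recr/= (hcoef_gt n (ltnSn k)) mul0r mul0r addr0.
  by apply: eq_bigr => j _; rewrite subSS.
rewrite -addrA; congr (_ + _).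
  by rewrite subn0 /hcoef !bin0.
rewrite mulr_sumr -sumrB; apply: eq_bigr => j _.
rewrite subSS (_ : (n.-1 - j)%N = (n - j.+1)%N); last by lia.
have -> : (hcoef k n j.+1 - n%:R * hcoef k n.-1 j)%:C =
    (hcoef k n j.+1)%:C - n%:R * (hcoef k n.-1 j)%:C.
  by rewrite rmorphB/= [X in _ - X]rmorphM rmorph_nat.
by rewrite /bump leq0n add1n; ring.
Qed.

(* A summation by parts identity behind the orthonormality of the [Phi1]. *)
Lemma hcoef_fact_sum k n s : (k <= n + s)%N ->
  \sum_(j < k.+1) hcoef k n j * (n + s - j)`!%:R = (s ^_ k * (n + s - k)`!)%:R.
Proof.
elim: k n s => [|k IH] n s kns.
  by rewrite big_ord1 /hcoef bin0 !ffactn0 !mul1r subn0 mul1n.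
rewrite big_ord_recl /= subn0.
under eq_bigr do rewrite hcoefSS mulrBl.
rewrite sumrB addrA.
have -> : hcoef k.+1 n 0 * (n + s)`!%:R +
    \sum_(i < k.+1) hcoef k n i.+1 * (n + s - bump 0 i)`!%:R =
    (s ^_ k * (n + s - k)`!)%:R.
  rewrite -IH; last by lia.
  rewrite [RHS]big_ord_recl /= subn0 big_ord_recr/= (hcoef_gt n (ltnSn k)) mul0r addr0.
  by congr (_ + _); rewrite /hcoef !bin0.
case: n kns => [|n] kns /=.
  rewrite big1 ?subr0; last by move=> j _; rewrite mulr0n !mul0r.
  by rewrite !add0n !ffact_fact//; lia.
under eq_bigr do rewrite -mulrA.
rewrite -mulr_sumr.
rewrite (eq_bigr (fun j : 'I_k.+1 => hcoef k n j * (n + s - j)`!%:R)); last first.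
  by move=> j _; rewrite /bump leq0n add1n addSn subSS.
rewrite IH; last by lia.
have [sk|ks] := ltnP s k.
  by rewrite !ffact_small ?mul0n ?mulr0 ?subrr//; lia.
have -> : (n.+1 + s - k = (n + s - k).+1)%N by lia.
have -> : (n.+1 + s - k.+1 = n + s - k)%N by lia.
rewrite factS ffactnSr !natrM.
have -> : (n + s - k).+1%:R = n.+1%:R + (s - k)%:R :> R.
  by rewrite -natrD; congr _%:R; lia.
ring.
Qed.

Lemma nm_hermite_sqr k n z : nm (hermite k n z) ^+ 2 =
  \sum_(i < k.+1) \sum_(j < k.+1)
    hcoef k n i * hcoef k n j * (nm z ^+ 2) ^+ (n + (k - i) - j).
Proof.
apply: (@complexI R); rewrite nm_sqrC hermiteE rmorph_sum/= big_distrlr/=.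
rewrite exchange_big/= rmorph_sum/=; apply: eq_bigr => i _.
rewrite rmorph_sum/=; apply: eq_bigr => j _.
(* Indices above [n], for which the exponents would be truncated, have zero coefficients. *)
have [ni|iN] := ltnP n i; first by rewrite (hcoef_gtr _ ni) !(rmorph0, mul0r, mulr0).
have [nj|jN] := ltnP n j; first by rewrite [hcoef _ _ j]hcoef_gtr// rmorph0 mulr0 !mul0r rmorph0.
have hr N : ((nm z ^+ 2) ^+ N)%:C = (z * cj z) ^+ N.
  by rewrite rmorphXn/= nm_sqrC.
rewrite [RHS]rmorphM/= hr [X in _ = X * _]rmorphM/=.
have -> : cj ((hcoef k n i)%:C * z ^+ (n - i) * cj z ^+ (k - i)) =
    (hcoef k n i)%:C * cj z ^+ (n - i) * z ^+ (k - i).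
  have hreal : cj (hcoef k n i)%:C = (hcoef k n i)%:C := conjc_real _.
  by rewrite !cjM !cjX conjK hreal.
have ik := ltn_ord i; have jk := ltn_ord j.
have -> : (n + (k - i) - j = (n - j) + (k - i))%N by lia.
rewrite exprMn exprD.
have -> : cj z ^+ (n - j + (k - i)) = cj z ^+ (k - j) * cj z ^+ (n - i).
  by rewrite -exprD; congr (_ ^+ _); lia.
ring.
Qed.

Lemma measurable_hermite k n : measurable_fun [set: C] (hermite k n).
Proof.
elim: k n => [|k IH] n /=; first by apply: measurable_expc; exact: measurable_id.
under eq_fun do rewrite -mulNr.
apply: measurable_addc; apply: measurable_mulc => //.
by apply: measurable_conjc; exact: measurable_id.
Qed.

Lemma Phi1E k n z :
  Phi1 k n z = ((Num.sqrt (k`! * n`!)%:R)^-1)%:C * hermite k n z.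
Proof.
rewrite /Phi1; congr (_ * _); rewrite hermiteE.
rewrite -(big_mkord xpredT
  (fun j => (hcoef k n j)%:C * z ^+ (n - j) * cj z ^+ (k - j))).
rewrite [RHS](@big_cat_nat _ _ _ (minn k n).+1)//=; last by rewrite ltnS geq_minl.
rewrite [X in _ = _ + X]big_nat_cond [X in _ = _ + X]big1 ?addr0; last first.
  move=> j /andP[/andP[h h'] _]; rewrite hcoef_gtr ?rmorph0 ?mul0r//.
  by move: h h'; rewrite /minn; case: ifP; lia.
rewrite !big_nat; apply: eq_bigr => j /andP[_ h].
have jn : (j <= n)%N by move: h; rewrite /minn; case: ifP; lia.
congr (_ * _ * _); rewrite /hcoef !rmorphM !rmorph_nat rmorphXn rmorphN rmorph1.
by congr (_ * _); rewrite -(ffact_fact jn) natrM mulfK.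
Qed.

Lemma nm_Phi1_sqr k n z : nm (Phi1 k n z) ^+ 2 =
  (k`! * n`!)%:R^-1 * nm (hermite k n z) ^+ 2.
Proof.
rewrite Phi1E nmM nm_real exprMn; congr (_ * _).
by rewrite real_normK ?num_real// exprVn sqr_sqrtr.
Qed.

Lemma measurable_Phi1 k n : measurable_fun [set: C] (Phi1 k n).
Proof.
rewrite (funext (Phi1E k n)).
by apply: measurable_mulc => //; exact: measurable_hermite.
Qed.

Local Open Scope ereal_scope.

Lemma integral_hermite_sqr k n :
  \int[lebesgueC R]_z (nm (hermite k n z) ^+ 2 * expR (- nm z ^+ 2))%:E =
  (pi * (k`! * n`!)%:R)%:E.
Proof.
have int_mom l : (lebesgueC R).-integrable setT
    (fun z => ((nm z ^+ 2) ^+ l * expR (- nm z ^+ 2))%:E).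
  apply/integrableP; split; first exact: measurable_moment.
  have := gauss_momentE R l; rewrite /gauss_moment => h.
  under eq_integral => z _.
    rewrite gee0_abs; last by rewrite lee_fin mulr_ge0// exprn_ge0// sqr_ge0.
    over.
  by rewrite h ltry.
transitivity (\int[lebesgueC R]_z (\sum_(i < k.+1) \sum_(j < k.+1)
    (hcoef k n i * hcoef k n j)%:E *
      ((nm z ^+ 2) ^+ (n + (k - i) - j) * expR (- nm z ^+ 2))%:E)).
  apply: eq_integral => z _; rewrite nm_hermite_sqr mulr_suml -sumEFin.
  apply: eq_bigr => i _; rewrite mulr_suml -sumEFin; apply: eq_bigr => j _.
  by rewrite -EFinM; congr EFin; exact/esym/mulrA.
rewrite integral_sum//; last first.
  by move=> i; apply: integrable_sum => // j _; apply: integrableZl.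
transitivity (\sum_(i < k.+1) \sum_(j < k.+1)
    (hcoef k n i * hcoef k n j * (pi * (n + (k - i) - j)`!%:R))%:E).
  apply: eq_bigr => i _; rewrite integral_sum//; last first.
    by move=> j; apply: integrableZl.
  apply: eq_bigr => j _; rewrite integralZl//.
  by have := gauss_momentE R (n + (k - i) - j); rewrite /gauss_moment => ->; rewrite -EFinM.
under eq_bigr do rewrite sumEFin.
rewrite sumEFin; congr EFin.
transitivity (pi * \sum_(i < k.+1) hcoef k n i *
    \sum_(j < k.+1) hcoef k n j * (n + (k - i) - j)`!%:R)%R.
  rewrite mulr_sumr; apply: eq_bigr => i _.
  rewrite !mulr_sumr; apply: eq_bigr => j _; ring.
(* The inner sum contains the falling factorial [(k - i) ^_ k], so only [i = 0] survives. *)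
congr (_ * _)%R; rewrite big_ord_recl/= subn0 hcoef_fact_sum; last by lia.
rewrite big1 ?addr0 => [|i _]; last first.
  have [ni|iN] := ltnP n (bump 0 i); first by rewrite hcoef_gtr// mul0r.
  rewrite hcoef_fact_sum; last by have := ltn_ord i; move: iN; rewrite /bump; lia.
  by rewrite ffact_small ?mul0n ?mulr0// /bump; have := ltn_ord i; lia.
by rewrite /hcoef bin0 ffactn0 expr0 !mul1r addnK ffactnn.
Qed.

Definition gint (f : C -> R) : \bar R :=
  (@pi R)^-1%:E * \int[lebesgueC R]_z (f z * expR (- nm z ^+ 2))%:E.

Lemma gint_Phi1_sqr k n : gint (fun z => nm (Phi1 k n z) ^+ 2)%R = 1.
Proof.
rewrite /gint.
transitivity ((@pi R)^-1%:E * \int[lebesgueC R]_z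
   (((k`! * n`!)%:R^-1)%:E * (nm (hermite k n z) ^+ 2 * expR (- nm z ^+ 2))%:E)).
  by congr (_ * _); apply: eq_integral => z _; rewrite nm_Phi1_sqr -EFinM; congr EFin; exact/esym/mulrA.
rewrite ge0_integralZl_EFin//.
- rewrite integral_hermite_sqr -!EFinM; congr EFin.
  have fk : (k`! * n`!)%:R != 0%R :> R.
    by rewrite pnatr_eq0 -lt0n muln_gt0 !fact_gt0.
  have pi0 : (@pi R != 0)%R by rewrite gt_eqF// pi_gt0.
  by rewrite mulrCA mulKf// mulVf.
- by move=> z _; rewrite lee_fin mulr_ge0// sqr_ge0.
- apply/measurable_EFinP; apply: measurable_funM; last exact: measurable_gauss1.
  by apply: measurable_funX; apply: measurable_nm; exact: measurable_hermite.
Qed.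

(* Three-term recurrence: [(|z|^2 - n) H_{k,n}] is a combination of
   [H_{k+1,n+1}], [H_{k,n}] and [H_{k-1,n-1}]. *)
Lemma gint_Phi1_variance k n :
  gint (fun z => (nm z ^+ 2 - n%:R) ^+ 2 * nm (Phi1 k n z) ^+ 2)%R <=
  (3 * (k.+1%:R + k.+1%:R ^+ 2 + k%:R) * n.+1%:R)%:E.
Proof.
pose H a b z : R := (nm (hermite a b z) ^+ 2 * expR (- nm z ^+ 2))%R.
pose c : R := ((k`! * n`!)%:R^-1)%R.
have c0 : (0 <= c)%R by rewrite invr_ge0.
have mH a b : measurable_fun setT (fun z => (H a b z)%:E).
  apply/measurable_EFinP; apply: measurable_funM; last exact: measurable_gauss1.
  by apply: measurable_funX; apply: measurable_nm; exact: measurable_hermite.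
have H0 a b z : (0 <= H a b z)%R by rewrite mulr_ge0// sqr_ge0.
pose B z : \bar R := (3 * c)%:E * (H k.+1 n.+1 z)%:E +
  (3 * c * k.+1%:R ^+ 2)%:E * (H k n z)%:E +
  (3 * c * (n * k)%:R ^+ 2)%:E * (H k.-1 n.-1 z)%:E.
have -> : (3 * (k.+1%:R + k.+1%:R ^+ 2 + k%:R) * n.+1%:R)%:E =
    (pi^-1)%:E * ((pi * 3 * (k.+1%:R + k.+1%:R ^+ 2 + k%:R) * n.+1%:R)%:E) :> \bar R.
  by rewrite -EFinM -!mulrA mulKf// gt_eqF// pi_gt0.
rewrite /gint; apply: lee_wpmul2l; first by rewrite lee_fin invr_ge0 pi_ge0.
have mc1 (r : R) a b : (0 <= r)%R -> (\int[lebesgueC R]_z (r%:E * (H a b z)%:E) =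
     (r * (pi * (a`! * b`!)%:R))%:E).
  move=> r0; rewrite ge0_integralZl_EFin//; last by move=> z _; rewrite lee_fin.
  by rewrite integral_hermite_sqr -EFinM.
have mcH (r : R) a b : measurable_fun setT (fun z => r%:E * (H a b z)%:E).
  by apply: emeasurable_funM => //; exact: measurable_cst.
apply: (@le_trans _ _ (\int[lebesgueC R]_z B z)).
  apply: ge0_le_integral => //.
  - by move=> z _; rewrite lee_fin mulr_ge0// mulr_ge0 ?sqr_ge0.
  - apply/measurable_EFinP; apply: measurable_funM; last exact: measurable_gauss1.
    apply: measurable_funM.
      apply: measurable_funX; apply: measurable_funB => //.
      by apply: measurable_funX; exact: measurable_nmid.
    by apply: measurable_funX; apply: measurable_nm; exact: measurable_Phi1.
  - by apply: emeasurable_funD => //; apply: emeasurable_funD.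
  move=> z _; rewrite /B -!EFinM -!EFinD lee_fin nm_Phi1_sqr -/c.
  have hE : ((nm z ^+ 2 - n%:R) ^+ 2 * nm (hermite k n z) ^+ 2 =
      nm (hermite k.+1 n.+1 z + k.+1%:R * hermite k n z +
          (n * k)%:R * hermite k.-1 n.-1 z) ^+ 2)%R.
    rewrite -[X in (X * _)%R]real_normK ?num_real// -exprMn -nm_real -nmM.
    congr (nm _ ^+ 2)%R.
    have -> : ((nm z ^+ 2 - n%:R)%:C = z * cj z - n%:R :> C)%R.
      by rewrite rmorphB /= nm_sqrC rmorph_nat.
    rewrite mulrBl rho_hermite.
    have -> : ((n + k).+1%:R = n%:R + k.+1%:R :> C)%R by rewrite -natrD addnS.
    ring.
  rewrite mulrCA hE.
  have tri : (nm (hermite k.+1 n.+1 z + k.+1%:R * hermite k n z +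
          (n * k)%:R * hermite k.-1 n.-1 z) ^+ 2 <=
     3 * (nm (hermite k.+1 n.+1 z) ^+ 2 + k.+1%:R ^+ 2 * nm (hermite k n z) ^+ 2 +
      (n * k)%:R ^+ 2 * nm (hermite k.-1 n.-1 z) ^+ 2))%R.
    rewrite -(nm_nat R k.+1) -(nm_nat R (n * k)) -!exprMn -!nmM.
    exact: nmD3_sqr.
  have E0 : (0 <= c * expR (- nm z ^+ 2))%R by rewrite mulr_ge0.
  have := ler_wpM2l E0 tri; rewrite /H.
  move: (nm (hermite k.+1 _ z)) (nm (hermite k n z)) (nm (hermite k.-1 _ _)) => x y w.
  move: (nm _ ^+ 2)%R (expR _) => v E; lra.
have posc (r : R) a b z : (0 <= r)%R -> 0 <= r%:E * (H a b z)%:E.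
  by move=> r0; rewrite -EFinM lee_fin mulr_ge0.
have c1 : (0 <= 3 * c)%R by rewrite mulr_ge0.
have c2 : (0 <= 3 * c * k.+1%:R ^+ 2)%R by rewrite mulr_ge0 ?sqr_ge0.
have c3 : (0 <= 3 * c * (n * k)%:R ^+ 2)%R by rewrite mulr_ge0 ?sqr_ge0.
rewrite /B (@ge0_integralD _ _ _ (lebesgueC R) setT measurableT); first last.
- exact: mcH.
- by move=> z _; exact: posc.
- exact: emeasurable_funD.
- by move=> z _; rewrite adde_ge0// posc.
rewrite (@ge0_integralD _ _ _ (lebesgueC R) setT measurableT); first last.
- exact: mcH.
- by move=> z _; exact: posc.
- exact: mcH.
- by move=> z _; exact: posc.
rewrite !mc1//.
rewrite -!EFinD lee_fin.
have cX : (c * (k`! * n`!)%:R = 1)%R.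
  by rewrite mulVf// pnatr_eq0 -lt0n muln_gt0 !fact_gt0.
have f1 : ((k.+1`! * n.+1`!)%:R = k.+1%:R * n.+1%:R * (k`! * n`!)%:R :> R)%R.
  by rewrite !factS -!natrM; congr _%:R; ring.
(* The predecessors cause no trouble: when [a] or [b] is zero, both sides vanish. *)
have f2 (a b : nat) :
    ((b * a)%:R ^+ 2 * (a.-1`! * b.-1`!)%:R = (b * a)%:R * (a`! * b`!)%:R :> R)%R.
  rewrite -natrX -!natrM; congr _%:R.
  by case: a b => [|a] [|b] //=; rewrite ?muln0 ?mul0n// !factS; ring.
have -> : (3 * c * (pi * (k.+1`! * n.+1`!)%:R) +
    3 * c * k.+1%:R ^+ 2 * (pi * (k`! * n`!)%:R) +
    3 * c * (n * k)%:R ^+ 2 * (pi * (k.-1`! * n.-1`!)%:R) =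
    pi * 3 * (k.+1%:R * n.+1%:R + k.+1%:R ^+ 2 + n%:R * k%:R))%R.
  have -> : (3 * c * (n * k)%:R ^+ 2 * (pi * (k.-1`! * n.-1`!)%:R) =
      3 * c * pi * ((n * k)%:R ^+ 2 * (k.-1`! * n.-1`!)%:R))%R by ring.
  rewrite f2 f1 (natrM _ n k); move: (k`! * n`!)%:R cX => X cX.
  transitivity (pi * 3 * (k.+1%:R * n.+1%:R + k.+1%:R ^+ 2 + n%:R * k%:R) * (c * X))%R.
    ring.
  by rewrite cX mulr1.
rewrite -!mulrA ler_wpM2l ?pi_ge0// ler_wpM2l//.
have n1 : (1 <= n.+1%:R :> R)%R by rewrite ler1n.
have nn : (n%:R <= n.+1%:R :> R)%R by rewrite ler_nat.
have k0 : (0 <= k%:R :> R)%R by [].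
have k1 : (0 <= k.+1%:R ^+ 2 :> R)%R by rewrite sqr_ge0.
nra.
Qed.

End ComplexHermite.

(** * Gaussian expectations and torus averages *)

Section GaussianExpectation.
Variable R : realType.
Local Notation C := R[i].
Local Open Scope complex_scope.
Local Open Scope ereal_scope.
Local Notation nm := (@Normc.normc R).

Definition gw d (z : d.-tuple C) : R :=
  expR (- \sum_(q < d) nm (tnth z q) ^+ 2)%R.

Definition gexp d (f : d.-tuple C -> \bar R) : \bar R :=
  ((@pi R ^+ d)^-1)%:E * \int[lebesgueCn R d]_z (f z * (gw z)%:E).

Definition gexp1 (f : C -> \bar R) : \bar R :=
  ((@pi R)^-1)%:E * \int[lebesgueC R]_z (f z * (expR (- nm z ^+ 2))%:E).

Lemma gw_ge0 d (z : d.-tuple C) : (0 <= gw z)%R.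
Proof. exact: expR_ge0. Qed.

Lemma gw_cons d (z : C) (t : d.-tuple C) :
  (gw (tuple_of_pair (z, t)) = expR (- nm z ^+ 2) * gw t)%R.
Proof.
rewrite /gw big_ord_recl opprD expRD; congr (_ * expR (- _))%R.
by apply: eq_bigr => q _; rewrite tnthS.
Qed.

Lemma measurable_gw d : measurable_fun setT (@gw d).
Proof.
apply: measurableT_comp; first exact: measurable_expR.
apply: measurableT_comp => //; apply: measurable_sum => q.
apply: measurable_funX; apply: measurable_nm; exact: measurable_tnth.
Qed.

Lemma gauss_normE d (F : d.-tuple C -> C) :
  gauss_norm F = sqrte (gexp (fun z => (nm (F z) ^+ 2)%:E)).
Proof. by []. Qed.

Section Basic.
Variable d : nat.
Implicit Types f g : d.-tuple C -> \bar R.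

Let piV0 : (0 <= (@pi R ^+ d)^-1)%R.
Proof. by rewrite invr_ge0 exprn_ge0// pi_ge0. Qed.

Let mfgw f : measurable_fun setT f -> measurable_fun setT (fun z => f z * (gw z)%:E).
Proof.
by move=> mf; apply: emeasurable_funM => //; apply/measurable_EFinP; exact: measurable_gw.
Qed.

Lemma gexp_ge0 f : (forall z, 0 <= f z) -> 0 <= gexp f.
Proof.
move=> f0; rewrite mule_ge0 ?lee_fin//; apply: integral_ge0 => z _.
by rewrite mule_ge0// lee_fin gw_ge0.
Qed.

Lemma gexp_le f g : measurable_fun setT f -> measurable_fun setT g ->
  (forall z, 0 <= f z) -> (forall z, f z <= g z) -> gexp f <= gexp g.
Proof.
move=> mf mg f0 fg; apply: lee_wpmul2l; first by rewrite lee_fin.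
apply: ge0_le_integral => //; [|exact: mfgw|exact: mfgw|].
  by move=> z _; rewrite mule_ge0// lee_fin gw_ge0.
by move=> z _; apply: lee_wpmul2r => //; rewrite lee_fin gw_ge0.
Qed.

Lemma gexpD f g : measurable_fun setT f -> measurable_fun setT g ->
  (forall z, 0 <= f z) -> (forall z, 0 <= g z) ->
  gexp (fun z => f z + g z) = gexp f + gexp g.
Proof.
move=> mf mg f0 g0; rewrite /gexp -ge0_muleDr; last 2 first.
- by apply: integral_ge0 => z _; rewrite mule_ge0// lee_fin gw_ge0.
- by apply: integral_ge0 => z _; rewrite mule_ge0// lee_fin gw_ge0.
congr (_ * _); rewrite -ge0_integralD//; first last.
- exact: mfgw.
- by move=> z _; rewrite mule_ge0// lee_fin gw_ge0.
- exact: mfgw.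
- by move=> z _; rewrite mule_ge0// lee_fin gw_ge0.
by apply: eq_integral => z _; rewrite ge0_muleDl.
Qed.

Lemma gexpZl (k : R) f : measurable_fun setT f -> (forall z, 0 <= f z) ->
  (0 <= k)%R -> gexp (fun z => k%:E * f z) = k%:E * gexp f.
Proof.
move=> mf f0 k0; rewrite /gexp muleCA; congr (_ * _).
rewrite -ge0_integralZl_EFin//; first last.
- exact: mfgw.
- by move=> z _; rewrite mule_ge0// lee_fin gw_ge0.
by apply: eq_integral => z _; rewrite muleA.
Qed.

Lemma gexp_sum I (s : seq I) (f : I -> d.-tuple C -> \bar R) :
  (forall i, measurable_fun setT (f i)) -> (forall i z, 0 <= f i z) ->
  gexp (fun z => \sum_(i <- s) f i z) = \sum_(i <- s) gexp (f i).
Proof.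
move=> mf f0; elim: s => [|i s IH].
  under [X in gexp X]eq_fun do rewrite big_nil.
  rewrite big_nil /gexp [X in _ * X]integral0_eq ?mule0// => z _; exact: mul0e.
under [X in gexp X]eq_fun do rewrite big_cons.
rewrite big_cons gexpD ?IH//; first exact: emeasurable_sum.
by move=> z; exact: sume_ge0.
Qed.

Lemma eq_gexp f g : f =1 g -> gexp f = gexp g.
Proof. by move=> /funext ->. Qed.

End Basic.

Lemma gexp_tuple0 (f : 0.-tuple C -> \bar R) : measurable_fun setT f ->
  gexp f = f [tuple].
Proof.
move=> mf; rewrite /gexp expr0 invr1 mul1e.
rewrite -[LHS]/(\int[\d_ [tuple]]_z (f z * (gw z)%:E)) integral_dirac//.
  by rewrite diracT mul1e /gw big_ord0 oppr0 expR0 mule1.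
by apply: emeasurable_funM => //; apply/measurable_EFinP; exact: measurable_gw.
Qed.

Section Step.
Variable d : nat.
Implicit Types f : d.+1.-tuple C -> \bar R.

Lemma measurable_pair_tuple f : measurable_fun setT f ->
  measurable_fun setT (fun x : C * d.-tuple C => f (tuple_of_pair x)).
Proof. by move=> mf; apply: (measurableT_comp mf); exact: measurable_tuple_of_pair. Qed.

Lemma measurable_section f z : measurable_fun setT f ->
  measurable_fun setT (fun t : d.-tuple C => f (tuple_of_pair (z, t))).
Proof.
move=> mf; apply: (measurableT_comp (measurable_pair_tuple mf)).
exact: pair1_measurable.
Qed.

Lemma integral_tupleS f : measurable_fun setT f -> (forall z, 0 <= f z) ->
  \int[lebesgueCn R d.+1]_z f z =
  \int[lebesgueC R]_z \int[lebesgueCn R d]_t f (tuple_of_pair (z, t)).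
Proof.
move=> mf f0.
rewrite -[LHS]/(\int[pushforward (lebesgueC R \x lebesgueCn R d) (@tuple_of_pair _ C d)]_z f z).
rewrite ge0_integral_pushforward//; last exact: measurable_tuple_of_pair.
rewrite fubini_tonelli1//=; exact: measurable_pair_tuple.
Qed.

Lemma measurable_gexp_section f : measurable_fun setT f -> (forall z, 0 <= f z) ->
  measurable_fun setT (fun z => gexp (fun t : d.-tuple C => f (tuple_of_pair (z, t)))).
Proof.
move=> mf f0; rewrite /gexp; apply: emeasurable_funM => //.
apply: (@measurable_fun_fubini_tonelli_F _ _ _ _ _ (lebesgueCn R d)
  (fun x : C * d.-tuple C => f (tuple_of_pair x) * (gw x.2)%:E)).
  apply: emeasurable_funM; first exact: measurable_pair_tuple.
  apply/measurable_EFinP; apply: measurableT_comp; first exact: measurable_gw.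
  exact: measurable_snd.
by move=> x; rewrite mule_ge0// lee_fin gw_ge0.
Qed.

Lemma gexp_tupleS f : measurable_fun setT f -> (forall z, 0 <= f z) ->
  gexp f = gexp1 (fun z => gexp (fun t : d.-tuple C => f (tuple_of_pair (z, t)))).
Proof.
move=> mf f0; rewrite /gexp1 /gexp.
have mfw : measurable_fun setT (fun z => f z * (gw z)%:E).
  by apply: emeasurable_funM => //; apply/measurable_EFinP; exact: measurable_gw.
rewrite integral_tupleS//; last by move=> z; rewrite mule_ge0// lee_fin gw_ge0.
rewrite exprS invfM EFinM -muleA; congr (_ * _).
have piV0 : (0 <= (@pi R ^+ d)^-1)%R by rewrite invr_ge0 exprn_ge0// pi_ge0.
have mI : measurable_fun setT (fun z : C => \int[lebesgueCn R d]_t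
    (f (tuple_of_pair (z, t)) * (gw (tuple_of_pair (z, t)))%:E)).
  apply: (@measurable_fun_fubini_tonelli_F _ _ _ _ _ (lebesgueCn R d)
    (fun x : C * d.-tuple C => f (tuple_of_pair x) * (gw (tuple_of_pair x))%:E)).
    exact: (measurable_pair_tuple mfw).
  by move=> x; rewrite mule_ge0// lee_fin gw_ge0.
rewrite -ge0_integralZl_EFin//; last first.
  by move=> z _; apply: integral_ge0 => t _; rewrite mule_ge0// lee_fin gw_ge0.
apply: eq_integral => z _; rewrite -muleA; congr (_ * _).
have mft : measurable_fun setT
    (fun t : d.-tuple C => f (tuple_of_pair (z, t)) * (gw t)%:E).
  apply: emeasurable_funM; first exact: measurable_section.
  by apply/measurable_EFinP; exact: measurable_gw.
rewrite -(@ge0_integralZr _ _ _ (lebesgueCn R d) setT measurableT _ mft); first last.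
- by rewrite lee_fin expR_ge0.
- by move=> t _; rewrite mule_ge0// lee_fin gw_ge0.
by apply: eq_integral => t _; rewrite gw_cons EFinM [X in _ * X]muleC muleA.
Qed.

End Step.

Lemma gexp1_rot (w : C) (f : C -> \bar R) : nm w = 1%R ->
  measurable_fun setT f -> (forall z, 0 <= f z) ->
  gexp1 (fun z => f (w * z)%R) = gexp1 f.
Proof.
move=> w1 mf f0; rewrite /gexp1; congr (_ * _).
rewrite -[RHS](integral_rotC w1); first last.
- by move=> z; rewrite mule_ge0// lee_fin expR_ge0.
- by apply: emeasurable_funM => //; apply/measurable_EFinP; exact: measurable_gauss1.
by apply: eq_integral => z _; rewrite nmM w1 mul1r.
Qed.

Definition rotT d (w z : d.-tuple C) : d.-tuple C :=
  [tuple (tnth w q * tnth z q)%R | q < d].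

Lemma rotT_cons d (w0 z0 : C) (w z : d.-tuple C) :
  rotT (tuple_of_pair (w0, w)) (tuple_of_pair (z0, z)) =
  tuple_of_pair ((w0 * z0)%R, rotT w z).
Proof.
apply: eq_from_tnth => q; rewrite tnth_mktuple.
by case: (unliftP ord0 q) => [q'|] ->; rewrite ?tnthS ?tnth_mktuple.
Qed.

Lemma measurable_rotT d (w : d.-tuple C) : measurable_fun setT (rotT w).
Proof.
apply/measurable_fun_tnthP => q.
rewrite (_ : _ \o _ = fun z : d.-tuple C => (tnth w q * tnth z q)%R).
  by apply: measurable_mulc => //; exact: measurable_tnth.
by apply/funext => z /=; rewrite tnth_mktuple.
Qed.

Lemma gexp_rot d (w : d.-tuple C) (f : d.-tuple C -> \bar R) :
  (forall q, nm (tnth w q) = 1%R) ->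
  measurable_fun setT f -> (forall z, 0 <= f z) ->
  gexp (fun z => f (rotT w z)) = gexp f.
Proof.
elim: d w f => [|d IH] w f w1 mf f0.
  by rewrite !gexp_tuple0//; [congr f; exact: tuple0|
    rewrite (tuple0 w); apply: (measurableT_comp mf); exact: measurable_rotT].
have mfr : measurable_fun setT (fun z => f (rotT w z)).
  by apply: (measurableT_comp mf); exact: measurable_rotT.
rewrite (gexp_tupleS mfr (fun z => f0 _)) (gexp_tupleS mf f0).
rewrite -[RHS](@gexp1_rot (thead w)); first last.
- by move=> z; apply: gexp_ge0.
- exact: measurable_gexp_section.
- exact: w1.
congr gexp1; apply/funext => z.
rewrite -[RHS](IH [tuple of behead w])//; first last.
- exact: (measurable_section (thead w * z)%R mf).
- move=> q; rewrite -(w1 (lift ord0 q)) [in RHS](tuple_eta w).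
  by rewrite tnthS.
apply: eq_gexp => t; congr f.
rewrite -rotT_cons; congr (rotT _ _).
by rewrite {1}(tuple_eta w); exact/val_inj.
Qed.

Lemma gexp1_le f g : measurable_fun setT f -> measurable_fun setT g ->
  (forall z, 0 <= f z) -> (forall z, f z <= g z) -> gexp1 f <= gexp1 g.
Proof.
move=> mf mg f0 fg; apply: lee_wpmul2l; first by rewrite lee_fin invr_ge0 pi_ge0.
have me : measurable_fun setT (fun z : C => (expR (- nm z ^+ 2))%:E).
  by apply/measurable_EFinP; exact: measurable_gauss1.
apply: ge0_le_integral => //.
- by move=> z _; rewrite mule_ge0// lee_fin expR_ge0.
- exact: emeasurable_funM.
- exact: emeasurable_funM.
by move=> z _; apply: lee_wpmul2r => //; rewrite lee_fin expR_ge0.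
Qed.

Lemma gexp1_ge0 f : (forall z, 0 <= f z) -> 0 <= gexp1 f.
Proof.
move=> f0; rewrite mule_ge0 ?lee_fin ?invr_ge0 ?pi_ge0//.
by apply: integral_ge0 => z _; rewrite mule_ge0// lee_fin expR_ge0.
Qed.

Lemma gexp1Zr (k : \bar R) f : measurable_fun setT f -> (forall z, 0 <= f z) ->
  0 <= k -> gexp1 (fun z => f z * k) = gexp1 f * k.
Proof.
move=> mf f0 k0; rewrite /gexp1 -muleA; congr (_ * _).
rewrite -ge0_integralZr//; first last.
- by move=> z _; rewrite mule_ge0// lee_fin expR_ge0.
- by apply: emeasurable_funM => //; apply/measurable_EFinP; exact: measurable_gauss1.
by apply: eq_integral => z _; rewrite -!muleA [k * _]muleC.
Qed.

Lemma gexp1_gint (f : C -> R) : gexp1 (fun z => (f z)%:E) = gint f.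
Proof. by []. Qed.

Lemma gexp_prod d (g : 'I_d -> C -> R) :
  (forall q, measurable_fun setT (g q)) -> (forall q z, (0 <= g q z)%R) ->
  gexp (fun z => (\prod_(q < d) g q (tnth z q))%R%:E) =
  \big[*%E/1]_(q < d) gexp1 (fun z => (g q z)%:E).
Proof.
elim: d g => [|d IH] g mg g0.
  rewrite gexp_tuple0; last by under eq_fun do rewrite big_ord0; exact: measurable_cst.
  by rewrite !big_ord0.
have mp : measurable_fun setT (fun z : d.+1.-tuple C =>
    (\prod_(q < d.+1) g q (tnth z q))%R%:E).
  apply/measurable_EFinP; apply: measurable_prod => q _.
  by apply: (measurableT_comp (mg q)); exact: measurable_tnth.
have mp' : measurable_fun setT (fun z : d.-tuple C =>
    (\prod_(q < d) g (lift ord0 q) (tnth z q))%R%:E).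
  apply/measurable_EFinP; apply: measurable_prod => q _.
  by apply: (measurableT_comp (mg _)); exact: measurable_tnth.
rewrite gexp_tupleS//; last by move=> z; rewrite lee_fin prodr_ge0.
rewrite big_ord_recl -(IH (fun q => g (lift ord0 q)))// -gexp1Zr//; first last.
- by apply: gexp_ge0 => z; rewrite lee_fin prodr_ge0.
- by move=> z; rewrite lee_fin.
- exact/measurable_EFinP.
congr gexp1; apply/funext => z; rewrite -gexpZl//; last first.
  by move=> t; rewrite lee_fin prodr_ge0.
apply: eq_gexp => t; rewrite big_ord_recl EFinM; congr (_ * _%:E).
by apply: eq_bigr => q _; rewrite tnthS.
Qed.

End GaussianExpectation.

Section Expectation.
Variable R : realType.
Local Notation C := R[i].
Local Open Scope complex_scope.
Local Notation nm := (@Normc.normc R).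
Local Notation cj := (@conjc R).

(** On these functions [Ex] is additive and monotone without any integrability condition. *)
Definition nnm d (g : d.-tuple C -> R) :=
  measurable_fun setT g /\ forall z, 0 <= g z.

Definition Ex d (g : d.-tuple C -> R) : \bar R := gexp (fun z => (g z)%:E).

Section Basic.
Variable d : nat.
Implicit Types f g : d.-tuple C -> R.

Lemma nnmD f g : nnm f -> nnm g -> nnm (fun z => f z + g z).
Proof. by move=> [mf f0] [mg g0]; split=> [|z]; [exact: measurable_funD|rewrite addr_ge0]. Qed.

Lemma nnmM f g : nnm f -> nnm g -> nnm (fun z => f z * g z).
Proof. by move=> [mf f0] [mg g0]; split=> [|z]; [exact: measurable_funM|rewrite mulr_ge0]. Qed.

Lemma nnm_cst k : 0 <= k -> nnm (fun _ : d.-tuple C => k).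
Proof. by move=> k0; split => //; exact: measurable_cst. Qed.

Lemma nnmZ k f : 0 <= k -> nnm f -> nnm (fun z => k * f z).
Proof. by move=> k0 nf; apply: nnmM => //; exact: nnm_cst. Qed.

Lemma nnm_sum I (s : seq I) (P : pred I) (h : I -> d.-tuple C -> R) :
  (forall i, nnm (h i)) -> nnm (fun z => \sum_(i <- s | P i) h i z).
Proof.
move=> nh; split => [|z]; last by apply: sumr_ge0 => i _; exact: (nh i).2.
under eq_fun do rewrite -big_filter.
by apply: measurable_sum => i; exact: (nh i).1.
Qed.

Lemma nnm_nm (F : d.-tuple C -> C) : measurable_fun setT F -> nnm (fun z => nm (F z)).
Proof. by move=> mF; split => [|z]; [exact: measurable_nm|exact: nm_ge0]. Qed.

Lemma nnm_sqr (f : d.-tuple C -> R) : measurable_fun setT f -> nnm (fun z => f z ^+ 2).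
Proof. by move=> mF; split => [|z]; [exact: measurable_funX|exact: sqr_ge0]. Qed.

Lemma nnm_rot w f : nnm f -> nnm (fun z => f (rotT w z)).
Proof. by move=> [mf f0]; split => //; apply: (measurableT_comp mf); exact: measurable_rotT. Qed.

Let me f : nnm f -> measurable_fun setT (fun z => (f z)%:E).
Proof. by move=> [mf _]; exact/measurable_EFinP. Qed.

Lemma Ex_ge0 f : (forall z, 0 <= f z) -> (0 <= Ex f)%E.
Proof. by move=> f0; apply: gexp_ge0 => z; rewrite lee_fin. Qed.

Lemma Ex_le f g : nnm f -> nnm g -> (forall z, f z <= g z) -> (Ex f <= Ex g)%E.
Proof.
move=> nf ng fg; apply: gexp_le; [exact: me|exact: me| |] => z; rewrite lee_fin//.
exact: nf.2.
Qed.

Lemma ExD f g : nnm f -> nnm g -> Ex (fun z => f z + g z) = (Ex f + Ex g)%E.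
Proof.
move=> nf ng; rewrite /Ex -gexpD//; [exact: me|exact: me| |].
- by move=> z; rewrite lee_fin; exact: nf.2.
- by move=> z; rewrite lee_fin; exact: ng.2.
Qed.

Lemma ExZ k f : 0 <= k -> nnm f -> Ex (fun z => k * f z) = (k%:E * Ex f)%E.
Proof.
move=> k0 nf; rewrite /Ex -gexpZl//; first exact: me.
by move=> z; rewrite lee_fin; exact: nf.2.
Qed.

Lemma Ex_sum I (s : seq I) (P : pred I) (h : I -> d.-tuple C -> R) :
  (forall i, nnm (h i)) ->
  Ex (fun z => \sum_(i <- s | P i) h i z) = (\sum_(i <- s | P i) Ex (h i))%E.
Proof.
move=> nh; rewrite -[RHS]big_filter /Ex -gexp_sum.
- by congr gexp; apply/funext => z; rewrite -big_filter sumEFin.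
- by move=> i; exact: me.
- by move=> i z; rewrite lee_fin; exact: (nh i).2.
Qed.

Lemma eq_Ex f g : f =1 g -> Ex f = Ex g.
Proof. by move=> /funext ->. Qed.

Lemma Ex_rot w f : (forall q, nm (tnth w q) = 1) -> nnm f ->
  Ex (fun z => f (rotT w z)) = Ex f.
Proof.
move=> w1 nf; rewrite /Ex (@gexp_rot _ _ w (fun z => (f z)%:E))//; first exact: me.
by move=> z; rewrite lee_fin; exact: nf.2.
Qed.

(** The way in which torus averages enter: pointwise identities for the finite average become
    statements on expectations. *)
Lemma Ex_avg (W : seq (d.-tuple C)) f :
  (forall w, w \in W -> forall q, nm (tnth w q) = 1) -> nnm f ->
  Ex (fun z => \sum_(w <- W) f (rotT w z)) = ((size W)%:R%:E * Ex f)%E.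
Proof.
move=> W1 nf; rewrite Ex_sum => [|w]; last exact: nnm_rot.
rewrite (eq_big_seq (fun=> Ex f)) => [|w wW]; last by rewrite Ex_rot//; exact: W1.
elim: W {W1} => [|w W IH]; first by rewrite big_nil mul0e.
by rewrite big_cons IH /= -natr1 EFinD addeC ge0_muleDl ?mul1e// lee_fin.
Qed.

End Basic.

Lemma Ex_prod d (g : 'I_d -> C -> R) :
  (forall q, measurable_fun setT (g q)) -> (forall q z, (0 <= g q z)%R) ->
  Ex (fun z => \prod_(q < d) g q (tnth z q)) = (\big[*%E/1]_(q < d) gint (g q))%E.
Proof. by move=> mg g0; rewrite /Ex gexp_prod. Qed.

(** * Characters of the torus and orthogonality of the basis *)

Section Rotation.

Lemma hermite_rot k n (w z : C) : nm w = 1 ->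
  hermite k n (w * z) = w ^+ n * cj w ^+ k * hermite k n z.
Proof.
move=> w1; have ww := mulzJ w1.
elim: k n => [|k IH] n; first by rewrite /= exprMn expr0 mulr1.
rewrite !hermiteS !IH cjM exprS.
case: n => [|n] /=; first by rewrite !mul0r; ring.
have -> : w ^+ n * cj w ^+ k = w ^+ n.+1 * cj w ^+ k.+1.
  by rewrite [w ^+ n.+1]exprSr [cj w ^+ k.+1]exprS mulrA -[_ * w * _]mulrA ww mulr1.
rewrite -!exprS; move: (w ^+ n.+1) => W; rewrite exprS; ring.
Qed.

Lemma Phi1_rot k n (w z : C) : nm w = 1 ->
  Phi1 k n (w * z) = w ^+ n * cj w ^+ k * Phi1 k n z.
Proof. by move=> w1; rewrite !Phi1E hermite_rot//; ring. Qed.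

Variable d : nat.
Variable kappa : d.-tuple nat.
Implicit Types (al be : d.-tuple nat) (w z : d.-tuple C).

(* Conjugate powers play the role of negative exponents on the torus. *)
Definition chi w (x y : d.-tuple nat) : C :=
  \prod_(q < d) (tnth w q ^+ tnth x q * cj (tnth w q) ^+ tnth y q).

Lemma Phi_rot al w z : (forall q, nm (tnth w q) = 1) ->
  Phi kappa al (rotT w z) = chi w al kappa * Phi kappa al z.
Proof.
move=> w1; rewrite /Phi /chi -big_split; apply: eq_bigr => q _ /=.
by rewrite tnth_mktuple Phi1_rot.
Qed.

Lemma measurable_Phi al : measurable_fun setT (@Phi R d kappa al).
Proof.
apply: measurable_prodc => q; apply: (measurableT_comp (@measurable_Phi1 R _ _)).
exact: measurable_tnth.
Qed.

Lemma Ex_Phi_coord al (q : 'I_d) (h : C -> R) : measurable_fun setT h ->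
  (forall x, 0 <= h x) ->
  Ex (fun z => h (tnth z q) * nm (Phi kappa al z) ^+ 2) =
  gint (fun x => h x * nm (Phi1 (tnth kappa q) (tnth al q) x) ^+ 2).
Proof.
move=> mh h0.
pose g (r : 'I_d) (x : C) : R := (if r == q then h x else 1) *
  nm (Phi1 (tnth kappa r) (tnth al r) x) ^+ 2.
transitivity (Ex (fun z => \prod_(r < d) g r (tnth z r))).
  apply: eq_Ex => z; rewrite /g big_split/=; congr (_ * _).
    by rewrite -big_mkcond/= big_pred1_eq.
  by rewrite /Phi nm_prod prodrXl.
rewrite Ex_prod.
- rewrite (bigD1 q)//= big1 ?mule1 => [|r rq].
    by congr gint; apply/funext => z; rewrite /g eqxx.
  rewrite -(gint_Phi1_sqr R (tnth kappa r) (tnth al r)); congr gint.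
  by apply/funext => z; rewrite /g (negPf rq) mul1r.
- move=> r; apply: measurable_funM; first by case: eqP.
  by apply: measurable_funX; apply: measurable_nm; exact: measurable_Phi1.
- by move=> r z; rewrite mulr_ge0 ?sqr_ge0//; case: ifP.
Qed.

Lemma Ex_Phi al : Ex (fun z => nm (Phi kappa al z) ^+ 2) = 1%E.
Proof.
transitivity (Ex (fun z => \prod_(r < d) nm (Phi1 (tnth kappa r) (tnth al r) (tnth z r)) ^+ 2)).
  by apply: eq_Ex => z; rewrite /Phi nm_prod prodrXl.
rewrite (@Ex_prod _ (fun r x => nm (Phi1 (tnth kappa r) (tnth al r) x) ^+ 2)).
- by rewrite big1// => r _; exact: gint_Phi1_sqr.
- by move=> r; apply: measurable_funX; apply: measurable_nm; exact: measurable_Phi1.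
- by move=> r z; exact: sqr_ge0.
Qed.

Section Torus.
Variables (L : nat) (zeta : C).
Hypothesis hz : L.-primitive_root zeta.

Definition torus : seq (d.-tuple C) :=
  [seq [tuple zeta ^+ (j q) | q < d] | j : {ffun 'I_d -> 'I_L}].

Lemma torus_unit w : w \in torus -> forall q, nm (tnth w q) = 1.
Proof.
move=> /mapP[j _ ->] q; rewrite tnth_mktuple; apply: (nm_mu hz).
apply: mu_exp => //; rewrite (mem_mu hz); apply/eqP; exact: prim_expr_order.
Qed.

Lemma size_torus : size torus = (L ^ d)%N.
Proof. by rewrite size_map -cardE card_ffun !card_ord. Qed.

Lemma torus_orth x y : (forall q, (tnth x q < L)%N) -> (forall q, (tnth y q < L)%N) ->
  \sum_(w <- torus) chi w x y = if x == y then (L ^ d)%:R else 0.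
Proof.
move=> xL yL; rewrite big_map big_enum/=.
transitivity (\prod_(q < d) \sum_(i < L)
    ((zeta ^+ i) ^+ tnth x q * cj (zeta ^+ i) ^+ tnth y q)).
  rewrite bigA_distr_bigA/=; apply: eq_bigr => j _.
  by apply: eq_bigr => q _; rewrite tnth_mktuple.
transitivity (\prod_(q < d) (if tnth x q == tnth y q then L%:R else 0 : C)).
  apply: eq_bigr => q _; rewrite -(sum_mu_orth hz (xL q) (yL q)).
  by rewrite big_map -[LHS](big_mkord xpredT (fun i =>
    (zeta ^+ i) ^+ tnth x q * cj (zeta ^+ i) ^+ tnth y q)) /index_iota subn0.
case: eqVneq => [->|xy].
  by under eq_bigr do rewrite eqxx; rewrite prodr_const card_ord natrX.
have [q xyq] : exists q, tnth x q != tnth y q.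
  apply/existsP; apply: contraR xy => /existsPn h.
  by apply/eqP/eq_from_tnth => q; apply/eqP; move: (h q); rewrite negbK.
by rewrite (bigD1 q)//= (negPf xyq) mul0r.
Qed.

End Torus.

Definition lincomb (S : seq (d.-tuple nat)) (a : d.-tuple nat -> C) z : C :=
  \sum_(al <- S) a al * Phi kappa al z.

Lemma measurable_lincomb S a : measurable_fun setT (lincomb S a).
Proof.
apply: measurable_sumc => al; apply: measurable_mulc => //; exact: measurable_Phi.
Qed.

Definition addT (x y : d.-tuple nat) : d.-tuple nat :=
  [tuple (tnth x q + tnth y q)%N | q < d].

Lemma chiM w x y x' y' : chi w x y * chi w x' y' = chi w (addT x x') (addT y y').
Proof.
rewrite /chi -big_split; apply: eq_bigr => q _ /=.
by rewrite !tnth_mktuple !exprD; ring.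
Qed.

Lemma chiJ w x y : cj (chi w x y) = chi w y x.
Proof.
rewrite /chi rmorph_prod; apply: eq_bigr => q _ /=.
by rewrite cjM !cjX conjK mulrC.
Qed.

Lemma chi_unit w x : (forall q, nm (tnth w q) = 1) -> chi w x x = 1.
Proof.
move=> w1; rewrite /chi big1// => q _.
by rewrite -exprMn mulzJ// expr1n.
Qed.

Lemma nm_chi w x y : (forall q, nm (tnth w q) = 1) -> nm (chi w x y) = 1.
Proof.
move=> w1; rewrite /chi nm_prod big1// => q _.
by rewrite nmM !nmX nmJ w1 !expr1n mulr1.
Qed.

Lemma addTK x y k : (addT x k == addT y k) = (x == y).
Proof.
apply/eqP/eqP => [h|->//]; apply: eq_from_tnth => q.
by have := congr1 (fun t => tnth t q) h; rewrite !tnth_mktuple => /addIn.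
Qed.

Lemma sizeS_bound (S : seq (d.-tuple nat)) :
  exists N, forall al, al \in S -> forall q, (tnth al q < N)%N.
Proof.
exists (\max_(al <- S) \max_(q < d) tnth al q).+1 => al alS q.
rewrite ltnS; apply: leq_trans (leq_bigmax q) _.
rewrite (big_rem al)//=; exact: leq_maxl.
Qed.

(** Under a rotation [Phi_al conj Phi_be] picks up the character of exponent [al - be], the two
    contributions of [kappa] cancelling; the average keeps the pairs with [al + x = be + y]. The
    bounds by [L] exclude coincidences modulo [L]. *)
Lemma torus_bilin (L : nat) (zeta : C) S (B : d.-tuple nat -> d.-tuple nat -> C)
    (x y : d.-tuple nat) z : L.-primitive_root zeta ->
  (forall al, al \in S -> forall q, (tnth al q + tnth kappa q + tnth x q < L)%N) ->
  (forall al, al \in S -> forall q, (tnth al q + tnth kappa q + tnth y q < L)%N) ->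
  \sum_(w <- torus L zeta) chi w x y *
    (\sum_(al <- S) \sum_(be <- S) B al be *
        (Phi kappa al (rotT w z) * cj (Phi kappa be (rotT w z)))) =
  (L ^ d)%:R * \sum_(al <- S) \sum_(be <- S | addT al x == addT be y)
    B al be * (Phi kappa al z * cj (Phi kappa be z)).
Proof.
move=> hz SLx SLy.
transitivity (\sum_(al <- S) \sum_(be <- S) B al be *
    (Phi kappa al z * cj (Phi kappa be z)) * \sum_(w <- torus L zeta)
      chi w (addT (addT al kappa) x) (addT (addT be kappa) y)).
  rewrite (eq_big_seq (fun w => \sum_(al <- S) \sum_(be <- S) B al be *
    (Phi kappa al z * cj (Phi kappa be z)) *
      chi w (addT (addT al kappa) x) (addT (addT be kappa) y))); last first.
    move=> w wT; have w1 := torus_unit hz wT.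
    rewrite mulr_sumr; apply: eq_bigr => al _.
    rewrite mulr_sumr; apply: eq_bigr => be _.
    rewrite !Phi_rot// cjM chiJ -chiM (_ : addT be kappa = addT kappa be).
      by rewrite -chiM; ring.
    by apply: eq_from_tnth => q; rewrite !tnth_mktuple addnC.
  rewrite exchange_big; apply: eq_bigr => al _.
  by rewrite exchange_big; apply: eq_bigr => be _; rewrite mulr_sumr.
rewrite mulr_sumr !big_seq; apply: eq_bigr => al alS.
rewrite mulr_sumr [RHS]big_mkcond !big_seq; apply: eq_bigr => be beS.
rewrite (torus_orth hz); last 2 first.
- by move=> q; rewrite !tnth_mktuple; exact: SLx.
- by move=> q; rewrite !tnth_mktuple; exact: SLy.
have -> : (addT (addT al kappa) x == addT (addT be kappa) y) =
    (addT al x == addT be y).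
  rewrite -(addTK (addT al x) _ kappa); congr (_ == _);
  by apply: eq_from_tnth => q; rewrite !tnth_mktuple addnAC.
by case: ifP => _; rewrite ?mulr0// mulrC.
Qed.

Lemma torus_parseval (L : nat) (zeta : C) S a z : uniq S ->
  L.-primitive_root zeta ->
  (forall al, al \in S -> forall q, (tnth al q + tnth kappa q < L)%N) ->
  \sum_(w <- torus L zeta) nm (lincomb S a (rotT w z)) ^+ 2 =
  (L ^ d)%:R * \sum_(al <- S) nm (a al) ^+ 2 * nm (Phi kappa al z) ^+ 2.
Proof.
move=> uS hz SL; apply: (@complexI R).
pose o : d.-tuple nat := [tuple 0%N | _ < d].
have SL0 al : al \in S -> forall q, (tnth al q + tnth kappa q + tnth o q < L)%N.
  by move=> alS q; rewrite tnth_mktuple addn0; exact: SL.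
have := @torus_bilin L zeta S (fun al be => a al * cj (a be)) o o z hz SL0 SL0.
rewrite rmorph_sum/= => h.
transitivity (\sum_(w <- torus L zeta) chi w o o *
    (\sum_(al <- S) \sum_(be <- S) a al * cj (a be) *
        (Phi kappa al (rotT w z) * cj (Phi kappa be (rotT w z))))).
  apply: eq_big_seq => w wT; rewrite chi_unit ?mul1r; last exact: torus_unit hz _ wT.
  rewrite nm_sqrC /lincomb rmorph_sum/= big_distrlr/=.
  by apply: eq_bigr => al _; apply: eq_bigr => be _; rewrite cjM; ring.
rewrite h rmorphM/= rmorph_nat rmorph_sum; congr (_ * _).
rewrite !big_seq; apply: eq_bigr => al alS.
under eq_bigl do rewrite addTK.
rewrite (eq_bigl (pred1 al)); last by move=> be; rewrite eq_sym.
rewrite (big_rem al)//= eqxx big1_seq ?addr0; last first.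
  move=> be /andP[/eqP -> ]; by rewrite mem_rem_uniqF.
by rewrite rmorphM/= !nm_sqrC.
Qed.

Lemma parseval_Ex (om : d.-tuple C -> R) S a : uniq S -> nnm om ->
  (forall w z, (forall q, nm (tnth w q) = 1) -> om (rotT w z) = om z) ->
  Ex (fun z => om z * nm (lincomb S a z) ^+ 2) =
  (\sum_(al <- S) (nm (a al) ^+ 2)%:E *
     Ex (fun z => (om z * nm (Phi kappa al z) ^+ 2)%R))%E.
Proof.
move=> uS nom homr.
have [N hN] := sizeS_bound S; have [K hK] := sizeS_bound [:: kappa].
pose L := (N + K).+1.
have [zeta hz] := exists_prim_root R (isT : (0 < L)%N).
have SL al : al \in S -> forall q, (tnth al q + tnth kappa q < L)%N.
  move=> alS q; have := hN _ alS q; have := hK _ (mem_head _ _) q; rewrite /L; lia.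
have nF b : nnm (fun z => om z * nm (lincomb S b z) ^+ 2).
  apply: nnmM => //; apply: nnm_sqr; apply: measurable_nm; exact: measurable_lincomb.
have nP al : nnm (fun z => om z * nm (Phi kappa al z) ^+ 2).
  apply: nnmM => //; apply: nnm_sqr; apply: measurable_nm; exact: measurable_Phi.
have Ld : (0 : R) < (L ^ d)%:R by rewrite ltr0n expn_gt0.
have h1 := Ex_avg (torus_unit hz) (nF a).
have h2 : Ex (fun z => \sum_(w <- torus L zeta)
      om (rotT w z) * nm (lincomb S a (rotT w z)) ^+ 2) =
    (((L ^ d)%:R)%:E * (\sum_(al <- S) (nm (a al) ^+ 2)%:E *
     Ex (fun z => (om z * nm (Phi kappa al z) ^+ 2)%R)))%E.
  transitivity (Ex (fun z => (L ^ d)%:R * \sum_(al <- S)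
      nm (a al) ^+ 2 * (om z * nm (Phi kappa al z) ^+ 2))).
    apply: eq_Ex => z.
    rewrite (eq_big_seq (fun w => om z * nm (lincomb S a (rotT w z)) ^+ 2)); last first.
      by move=> w wT; rewrite homr//; exact: torus_unit wT.
    rewrite -mulr_sumr torus_parseval// mulrCA; congr (_ * _).
    by rewrite mulr_sumr; apply: eq_bigr => al _; ring.
  rewrite ExZ//; last by apply: nnm_sum => al; apply: nnmZ => //; exact: sqr_ge0.
  rewrite Ex_sum; last by move=> al; apply: nnmZ => //; exact: sqr_ge0.
  by congr (_ * _)%E; apply: eq_bigr => al _; rewrite ExZ// sqr_ge0.
move: h2; rewrite h1 size_torus; move: (Ex _) (\sum_(al <- S) _)%E => X Y.
move=> /(congr1 (fun x => ((L ^ d)%:R^-1)%:E * x)%E).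
by rewrite !muleA -EFinM mulVf ?gt_eqF// !mul1e.
Qed.

Lemma Ex_lincomb S a : uniq S ->
  Ex (fun z => nm (lincomb S a z) ^+ 2) = (\sum_(al <- S) nm (a al) ^+ 2)%:E.
Proof.
move=> uS; transitivity (Ex (fun z => 1 * nm (lincomb S a z) ^+ 2)).
  by apply: eq_Ex => z; rewrite mul1r.
rewrite (@parseval_Ex (fun=> 1))//.
rewrite -sumEFin; apply: eq_bigr => al _.
rewrite (eq_Ex (g := fun z => nm (Phi kappa al z) ^+ 2)); last by move=> z; rewrite mul1r.
by rewrite Ex_Phi mule1.
Qed.

End Rotation.

End Expectation.

(** * Localisation of the energy in a finite box *)

Section EnergyLocalisation.
Variable R : realType.
Local Notation C := R[i].
Local Open Scope complex_scope.
Local Notation nm := (@Normc.normc R).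
Local Notation cj := (@conjc R).

Lemma gint_le (f g : C -> R) : measurable_fun setT f -> measurable_fun setT g ->
  (forall x, 0 <= f x) -> (forall x, f x <= g x) -> (gint f <= gint g)%E.
Proof.
move=> mf mg f0 fg; rewrite -!gexp1_gint; apply: gexp1_le.
- exact/measurable_EFinP.
- exact/measurable_EFinP.
- by move=> x; rewrite lee_fin.
- by move=> x; rewrite lee_fin.
Qed.

Lemma gintZ k (f : C -> R) : 0 <= k -> measurable_fun setT f -> (forall x, 0 <= f x) ->
  gint (fun x => k * f x) = (k%:E * gint f)%E.
Proof.
move=> k0 mf f0; rewrite -!gexp1_gint muleC -gexp1Zr//.
- by congr gexp1; apply/funext => x; rewrite EFinM muleC.
- exact/measurable_EFinP.
Qed.

Definition far (r : R) (x : C) : bool := r <= nm x ^+ 2.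

Lemma measurable_far r : measurable_fun setT (fun x => (far r x)%:R : R).
Proof.
have -> : (fun x => (far r x)%:R : R) = (fun x => if far r x then 1 else 0).
  by apply/funext => x; case: far.
apply: measurable_fun_ifT => //; apply: measurable_fun_ler => //.
by apply: measurable_funX; exact: measurable_nm.
Qed.

Lemma measurable_near r : measurable_fun setT (fun x => (~~ far r x)%:R : R).
Proof.
have -> : (fun x => (~~ far r x)%:R : R) = (fun x => 1 - (far r x)%:R).
  by apply/funext => x; case: far; rewrite ?subr0 ?subrr.
by apply: measurable_funB => //; exact: measurable_far.
Qed.

Lemma measurable_Phi1_sqr k n : measurable_fun setT (fun x => nm (@Phi1 R k n x) ^+ 2).
Proof. by apply: measurable_funX; apply: measurable_nm; exact: measurable_Phi1. Qed.

(** Chebyshev's inequality for [|x|^2], whose variance under [|Phi_{k,n}|^2] is of order [n]. *)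
Lemma near_mass k r : 0 <= r -> exists I, forall n, (I <= n)%N ->
  (gint (fun x => ((~~ far r x)%:R * nm (Phi1 k n x) ^+ 2)%R) <= (4^-1 : R)%:E)%E.
Proof.
move=> r0; pose V : R := 3 * (k.+1%:R + k.+1%:R ^+ 2 + k%:R).
have V0 : 0 <= V by rewrite /V mulr_ge0// !addr_ge0// sqr_ge0.
(* [2 r <= n] gives [(|x|^2 - n)^2 >= n^2 / 4] on the near part; [32 V <= n] makes
   [4 V (n + 1) / n^2] at most [1 / 4]. *)
exists (Num.truncn (2 * r + 32 * V)).+1 => n nI.
have nB : 2 * r + 32 * V <= n%:R.
  by apply/ltW/(lt_le_trans (truncnS_gt _)); rewrite ler_nat.
have n1 : (1 : R) <= n%:R by rewrite ler1n; case: n nI {nB}.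
have n0 : (0 : R) < n%:R by apply: lt_le_trans n1.
have mv : measurable_fun setT (fun x => (nm x ^+ 2 - n%:R) ^+ 2 * nm (Phi1 k n x) ^+ 2).
  apply: measurable_funM; last exact: measurable_Phi1_sqr.
  apply: measurable_funX; apply: measurable_funB => //.
  by apply: measurable_funX; exact: measurable_nm.
have v0 x : 0 <= (nm x ^+ 2 - n%:R) ^+ 2 * nm (Phi1 k n x) ^+ 2.
  by rewrite mulr_ge0 ?sqr_ge0.
apply: (@le_trans _ _ (gint (fun x => 4 / n%:R ^+ 2 *
    ((nm x ^+ 2 - n%:R) ^+ 2 * nm (Phi1 k n x) ^+ 2)))).
  apply: gint_le.
  - apply: measurable_funM; first exact: measurable_near.
    exact: measurable_Phi1_sqr.
  - exact: measurable_funM.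
  - by move=> x; rewrite mulr_ge0 ?sqr_ge0.
  - move=> x; rewrite [leRHS]mulrA; apply: ler_wpM2r; first exact: sqr_ge0.
    have q0 : 0 <= 4 / n%:R ^+ 2 * (nm x ^+ 2 - n%:R) ^+ 2.
      by rewrite mulr_ge0 ?sqr_ge0// divr_ge0// sqr_ge0.
    rewrite /far; case: (leP r (nm x ^+ 2)) => [h|h] /=; first exact: q0.
    rewrite mulrAC ler_pdivlMr ?exprn_gt0// mul1r.
    by have := sqr_ge0 (nm x); nra.
have c0 : 0 <= 4 / (n%:R : R) ^+ 2 by rewrite divr_ge0// sqr_ge0.
rewrite (gintZ c0 mv v0).
apply: (@le_trans _ _ ((4 / n%:R ^+ 2)%:E * (V * n.+1%:R)%:E)%E).
  by apply: lee_wpmul2l; [rewrite lee_fin divr_ge0// sqr_ge0|exact: gint_Phi1_variance].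
rewrite -EFinM lee_fin -(natr1 n) mulrAC ler_pdivrMr ?exprn_gt0//.
have : 0 <= (n%:R - 32 * V) * n%:R by apply: mulr_ge0; lra.
nra.
Qed.

Variable d : nat.
Variable kappa : d.-tuple nat.

Definition rot1 (q : 'I_d) (Y : C) : d.-tuple C :=
  [tuple if r == q then Y else 1 | r < d].

Lemma rot1_unit q Y : nm Y = 1 -> forall r, nm (tnth (rot1 q Y) r) = 1.
Proof. by move=> Y1 r; rewrite tnth_mktuple; case: eqP => // _; rewrite nm1. Qed.

(** What the combination becomes when coordinate [q] is rotated by [Y], up to the power of [conj Y]
    of exponent [tnth kappa q], which moduli do not see. *)
Definition cpoly (q : 'I_d) S (a : d.-tuple nat -> C) z : {poly C} :=
  \sum_(al <- S) (a al * Phi kappa al z) *: 'X^(tnth al q).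

Lemma coef_cpoly q S a z n :
  (cpoly q S a z)`_n = lincomb kappa [seq al <- S | tnth al q == n] a z.
Proof.
rewrite /cpoly coef_sum /lincomb big_filter [RHS]big_mkcond.
apply: eq_bigr => al _; rewrite coefZ coefXn eq_sym.
by case: eqP; rewrite ?mulr1 ?mulr0.
Qed.

Lemma size_cpoly q S a z N : (forall al, al \in S -> a al != 0 -> (tnth al q < N)%N) ->
  (size (cpoly q S a z) <= N)%N.
Proof.
move=> h; rewrite /cpoly big_seq.
apply: (big_ind (fun p : {poly C} => (size p <= N)%N)); first by rewrite size_poly0.
  by move=> p p' hp hp'; apply: leq_trans (size_polyD _ _) _; rewrite geq_max hp.
move=> al alS; have [->|/(h _ alS) aN] := eqVneq (a al) 0.
  by rewrite mul0r scale0r size_poly0.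
by apply: leq_trans (size_scale_leq _ _) _; rewrite size_polyXn.
Qed.

Lemma lincomb_rot1 q S a z Y : nm Y = 1 ->
  lincomb kappa S a (rotT (rot1 q Y) z) = cj Y ^+ tnth kappa q * (cpoly q S a z).[Y].
Proof.
move=> Y1; rewrite /lincomb /cpoly horner_sum mulr_sumr.
apply: eq_bigr => al _; rewrite Phi_rot; last exact: rot1_unit.
rewrite hornerZ hornerXn /chi (bigD1 q)//= big1 ?mulr1; last first.
  by move=> r /negPf rq; rewrite tnth_mktuple rq conjc1 !expr1n mulr1.
by rewrite tnth_mktuple eqxx; ring.
Qed.

Definition defect S c a z : R := nm (lincomb kappa S c z + lincomb kappa S a z) -
  nm (lincomb kappa S c z).

Lemma measurable_defect S c a : measurable_fun setT (defect S c a).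
Proof.
apply: measurable_funB; apply: measurable_nm; last exact: measurable_lincomb.
by apply: measurable_addc; exact: measurable_lincomb.
Qed.

Lemma nnm_defect S c a : nnm (fun z => defect S c a z ^+ 2).
Proof. by apply: nnm_sqr; exact: measurable_defect. Qed.

Lemma defect_rot1 q S c a z Y : nm Y = 1 ->
  defect S c a (rotT (rot1 q Y) z) =
  nm ((cpoly q S c z).[Y] + (cpoly q S a z).[Y]) - nm (cpoly q S c z).[Y].
Proof.
move=> Y1; rewrite /defect !lincomb_rot1// -mulrDr !nmM.
by rewrite nmX nmJ Y1 expr1n !mul1r.
Qed.

(** Let [rho = |x|^2]. If [n < t], then [n + 1 <= rho / 2], so that [rho - n >= rho / 2]. If
    [n >= 4 t + 5], then [2 rho + 1 < n], so [n - rho] dominates both [rho] and [(n + 1) / 2]. The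
    variance can therefore pay for all frequencies outside the band, with a gain [1 / r]. *)
Lemma outside_band (r : R) (x : C) n : far r x ->
  ~~ in_band (Num.truncn (nm x ^+ 2 / 2)) n ->
  r * n.+1%:R <= 2 * (nm x ^+ 2 - n%:R) ^+ 2.
Proof.
rewrite /far /in_band; move: (sqr_ge0 (nm x)); set rho := nm x ^+ 2 => rho0 rr.
have t2 : 0 <= rho / 2 by rewrite divr_ge0.
have := truncn_le (rho / 2); rewrite t2; have := truncnS_gt (rho / 2).
move: (Num.truncn _) => t; rewrite -(natr1 n) -(natr1 t) => h1 h2.
have n0 : (0 : R) <= n%:R by [].
rewrite negb_and -!ltnNge => /orP[nt|nt].
  have n1 : n%:R + 1 <= t%:R :> R by rewrite natr1 ler_nat.
  apply: (@le_trans _ _ (rho * (rho / 2))).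
    by apply: le_trans (ler_wpM2r _ rr) (ler_wpM2l _ _); lra.
  have : (rho / 2) ^+ 2 <= (rho - n%:R) ^+ 2 by rewrite lerXn2r ?nnegrE; lra.
  by rewrite !expr2; lra.
have : 4 * t%:R + 5 <= n%:R :> R.
  by rewrite -natrM -natrD ler_nat; lia.
move=> tn; apply: (@le_trans _ _ (rho * (n%:R + 1))).
  by apply: ler_wpM2r => //; lra.
have -> : 2 * (rho - n%:R) ^+ 2 = (n%:R - rho) * (2 * (n%:R - rho)) by ring.
by apply: ler_pM; lra.
Qed.

Lemma Ex_coord_parseval (q : 'I_d) S a (h : C -> R) : uniq S ->
  measurable_fun setT h -> (forall x, 0 <= h x) ->
  (forall w x, nm w = 1 -> h (w * x) = h x) ->
  Ex (fun z => h (tnth z q) * nm (lincomb kappa S a z) ^+ 2) =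
  (\sum_(al <- S) (nm (a al) ^+ 2)%:E *
     gint (fun x => (h x * nm (Phi1 (tnth kappa q) (tnth al q) x) ^+ 2)%R))%E.
Proof.
move=> uS mh h0 hr; rewrite (@parseval_Ex _ _ _ (fun z => h (tnth z q)))//.
- by apply: eq_bigr => al _; rewrite Ex_Phi_coord.
- by split => //; apply: (measurableT_comp mh); exact: measurable_tnth.
- by move=> w z w1; rewrite tnth_mktuple hr.
Qed.

Lemma far_rot r w x : nm w = 1 -> far r (w * x) = far r x.
Proof. by move=> w1; rewrite /far nmM w1 mul1r. Qed.

(* At each point, rotating the coordinate [q] yields two polynomials on the
   circle, to which [circle_estimate] applies with [t] the integer part of
   [|z_q|^2 / 2]. *)
Lemma tail_coord (q : 'I_d) m : exists2 K : R, 0 < K &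
  forall (r : R) S c a, 4 * m.+2%:R <= r -> uniq S ->
  (forall al, al \in S -> c al != 0 -> (tnth al q <= m)%N) ->
  (Ex (fun z => ((far r (tnth z q))%:R * nm (lincomb kappa S a z) ^+ 2)%R) <=
   K%:E * Ex (fun z => (defect S c a z ^+ 2)%R)
    + (K / r * \sum_(al <- S) nm (a al) ^+ 2)%:E)%E.
Proof.
have [K K0 hK] := circle_estimate R m.
pose k := tnth kappa q.
pose V : R := 3 * (k.+1%:R + k.+1%:R ^+ 2 + k%:R).
have V0 : 0 <= V by rewrite /V mulr_ge0// !addr_ge0// sqr_ge0.
exists (K + 2 * K * V); first by rewrite ltr_wpDr// !mulr_ge0// ltW.
move=> r S c a rm uS Sc.
have r0 : 0 < r by apply: lt_le_trans rm; rewrite mulr_gt0.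
have [N hN] := sizeS_bound S.
pose L := (circle_L m N).+1.
have [zeta hz] := exists_prim_root R (isT : (0 < L)%N).
have L0 : (0 : R) < L%:R by rewrite ltr0n.
pose SS n := [seq al <- S | tnth al q == n].
pose en n z := lincomb kappa (SS n) a z.
pose rh n (x : C) : R := (nm x ^+ 2 - n%:R) ^+ 2.
have mrh n : measurable_fun setT (rh n).
  apply: measurable_funX; apply: measurable_funB => //.
  by apply: measurable_funX; exact: measurable_nm.
have mf := measurable_far r.
have nen n : nnm (fun z => nm (en n z) ^+ 2).
  by apply: nnm_sqr; apply: measurable_nm; exact: measurable_lincomb.
have nF : nnm (fun z : d.-tuple C => (far r (tnth z q))%:R : R).
  by split => //; apply: (measurableT_comp mf); exact: measurable_tnth.
have nrh n : nnm (fun z : d.-tuple C => rh n (tnth z q)).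
  split=> [|z]; last exact: sqr_ge0.
  by apply: (measurableT_comp (mrh n)); exact: measurable_tnth.
have nD := nnm_defect S c a.
have split_sum (G : d.-tuple nat -> \bar R) :
    (\sum_(n < N) \sum_(al <- SS n) G al = \sum_(al <- S) G al)%E.
  under eq_bigr do rewrite big_filter big_mkcond.
  rewrite exchange_big/= big_seq [RHS]big_seq; apply: eq_bigr => al alS.
  rewrite (bigD1 (Ordinal (hN _ alS q)))//= eqxx big1 ?adde0// => n nq.
  by case: eqP => // h; case/eqP: nq; exact: val_inj.
have uSS n : uniq (SS n) by exact: filter_uniq.
(* The frequencies outside the band are weighted by [2 rh n / (r * n.+1)], which is at least 1 there
   by [outside_band]. *)
have pw z : (far r (tnth z q))%:R * \sum_(n < N) nm (en n z) ^+ 2 <=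
    K * (L%:R^-1 * \sum_(w <- [seq rot1 q Y | Y <- rootsU zeta L])
           defect S c a (rotT w z) ^+ 2) +
    2 * K / r * \sum_(n < N) (n.+1%:R^-1 * (rh n (tnth z q) * nm (en n z) ^+ 2)).
  rewrite big_map.
  have s10 : 0 <= \sum_(Y <- rootsU zeta L) defect S c a (rotT (rot1 q Y) z) ^+ 2.
    by apply: sumr_ge0 => *; exact: sqr_ge0.
  have s20 : 0 <= \sum_(n < N) (n.+1%:R^-1 * (rh n (tnth z q) * nm (en n z) ^+ 2)).
    by apply: sumr_ge0 => n _; do 2!apply: mulr_ge0 => //; exact: sqr_ge0.
  case: (boolP (far r (tnth z q))) => fz; last first.
    rewrite mul0r addr_ge0//; apply: mulr_ge0 => //; first exact: ltW.
      by rewrite mulr_ge0// invr_ge0 ltW.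
    by rewrite divr_ge0// ?ltW// mulr_gt0.
  rewrite mul1r.
  pose t := Num.truncn (nm (tnth z q) ^+ 2 / 2).
  (* [t + 1 > r / 2 >= 2 (m + 2)], so the band starts high enough for the kernel. *)
  have tm : (2 * m.+1 <= t)%N.
    rewrite -(ler_nat R); apply: le_trans (_ : _ <= r / 2 - 1) _.
      by rewrite natrM; move: rm; rewrite -(natr1 m.+1) -(natr1 m); lra.
    have := truncnS_gt (nm (tnth z q) ^+ 2 / 2); rewrite -/t -(natr1 t).
    by move: fz; rewrite /far; lra.

  have hs1 : (size (cpoly q S a z) <= N)%N.
    by apply: size_cpoly => al alS _; exact: hN.
  have hs2 : (size (cpoly q S c z) <= m.+1)%N.
    by apply: size_cpoly => al alS h; rewrite ltnS Sc.
  have := hK N L t zeta _ _ (leqnSn _) hz tm hs1 hs2.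
  have ce n : nm (cpoly q S a z)`_n ^+ 2 = nm (en n z) ^+ 2 by rewrite coef_cpoly.
  rewrite (eq_bigr (fun n : 'I_N => nm (en n z) ^+ 2)) => [|n _]; last exact: ce.
  rewrite [X in _ <= K * (_ + X) -> _](eq_bigr (fun n : 'I_N => nm (en n z) ^+ 2))
    => [|n _]; last exact: ce.
  move=> /le_trans; apply; rewrite mulrDr; apply: lerD.
    apply: ler_wpM2l; first exact: ltW.
    apply: ler_wpM2l; first by rewrite invr_ge0 ltW.
    rewrite le_eqVlt; apply/orP; left; apply/eqP.
    by apply: eq_big_seq => Y Ymu; rewrite defect_rot1//; exact: (nm_mu hz Ymu).
  rewrite -!mulrA mulrCA; apply: ler_wpM2l; first exact: ltW.
  rewrite mulr_sumr [leLHS]big_mkcond mulr_sumr /=.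
  apply: ler_sum => n _; case: ifP => [nb|_]; last first.
    apply: mulr_ge0 => //; apply: mulr_ge0; first by rewrite invr_ge0 ltW.
    by do 2!apply: mulr_ge0 => //; exact: sqr_ge0.
  have n0 : (0 : R) < n.+1%:R by [].
  have hb : 1 <= 2 * rh n (tnth z q) / (r * n.+1%:R).
    by rewrite ler_pdivlMr ?mulr_gt0// mul1r; exact: outside_band.
  have := ler_wpM2r (sqr_ge0 (nm (en n z))) hb; rewrite mul1r => /le_trans; apply.
  rewrite le_eqVlt; apply/orP; left; apply/eqP; rewrite invfM.
  by move: (nm (en n z) ^+ 2) (rh _ _) => x y; ring.
have nA : nnm (fun z => \sum_(w <- [seq rot1 q Y | Y <- rootsU zeta L])
           defect S c a (rotT w z) ^+ 2).
  by apply: nnm_sum => w; apply: (nnm_rot w nD).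
have nB : nnm (fun z => \sum_(n < N) (n.+1%:R^-1 * (rh n (tnth z q) * nm (en n z) ^+ 2))).
  by apply: nnm_sum => n; apply: nnmZ => //; exact: nnmM.
have -> : Ex (fun z => (far r (tnth z q))%:R * nm (lincomb kappa S a z) ^+ 2) =
    Ex (fun z => (far r (tnth z q))%:R * \sum_(n < N) nm (en n z) ^+ 2).
  rewrite [RHS](eq_Ex (g := fun z =>
    \sum_(n < N) (far r (tnth z q))%:R * nm (en n z) ^+ 2)); last first.
    by move=> z; rewrite mulr_sumr.
  rewrite Ex_sum; last by move=> n; exact: nnmM.
  have fr w x : nm w = 1 -> (far r (w * x))%:R = (far r x)%:R :> R.
    by move=> w1; rewrite far_rot.
  rewrite (Ex_coord_parseval _ _ uS mf)// -split_sum; apply: eq_bigr => n _.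
  by rewrite (Ex_coord_parseval _ _ (uSS n) mf).
have nfar : nnm (fun z => (far r (tnth z q))%:R * \sum_(n < N) nm (en n z) ^+ 2).
  by apply: nnmM => //; exact: nnm_sum.
have li0 : 0 <= L%:R^-1 :> R by rewrite invr_ge0 ltW.
have kr0 : 0 <= 2 * K / r by apply: divr_ge0; [apply: mulr_ge0 => //; exact: ltW|exact: ltW].
have nA1 := nnmZ (ltW K0) (nnmZ li0 nA).
have nB1 := nnmZ kr0 nB.
apply: (le_trans (Ex_le nfar (nnmD nA1 nB1) pw)).
have hA : Ex (fun z => L%:R^-1 * \sum_(w <- [seq rot1 q Y | Y <- rootsU zeta L])
    defect S c a (rotT w z) ^+ 2) = Ex (fun z => defect S c a z ^+ 2).
  rewrite (ExZ li0 nA) (Ex_avg _ nD) => [|w /mapP[Y Ymu ->]]; last first.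
    by apply: rot1_unit; exact: (nm_mu hz Ymu).
  by rewrite size_map size_mu muleA -EFinM mulVf ?gt_eqF// mul1e.
(* The factor [1 / (n + 1)] cancels the linear growth of the variance. *)
have hB : (Ex (fun z => (\sum_(n < N) (n.+1%:R^-1 * (rh n (tnth z q) * nm (en n z) ^+ 2)))%R)
    <= (V * \sum_(al <- S) nm (a al) ^+ 2)%:E)%E.
  rewrite Ex_sum; last by move=> n; apply: nnmZ => //; exact: nnmM.
  rewrite mulr_sumr -sumEFin -split_sum; apply: lee_sum => n _.
  rewrite ExZ//; last exact: nnmM.
  have rh0 x : 0 <= rh n x by exact: sqr_ge0.
  have rhr w x : nm w = 1 -> rh n (w * x) = rh n x.
    by move=> w1; rewrite /rh nmM w1 mul1r.
  rewrite (Ex_coord_parseval _ _ (uSS n) (mrh n) rh0 rhr).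
  apply: (@le_trans _ _ (n.+1%:R^-1%:E *
      \sum_(al <- SS n) (nm (a al) ^+ 2 * (V * n.+1%:R))%:E)%E).
    apply: lee_wpmul2l; first by rewrite lee_fin.
    rewrite big_seq [leRHS]big_seq; apply: lee_sum => al.
    rewrite mem_filter => /andP[/eqP -> _]; rewrite [leRHS]EFinM.
    by apply: lee_wpmul2l; [rewrite lee_fin sqr_ge0|exact: gint_Phi1_variance].
  rewrite !sumEFin -EFinM lee_fin mulr_sumr le_eqVlt; apply/orP; left; apply/eqP.
  apply: eq_bigr => al _; rewrite mulrCA [_ * (V * _)]mulrCA mulVf ?mulr1 1?mulrC//.
rewrite (ExD nA1 nB1) (ExZ (ltW K0) (nnmZ li0 nA)) hA (ExZ kr0 nB).
apply: leeD.
  apply: lee_wpmul2r; first by apply: Ex_ge0 => z; exact: sqr_ge0.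
  by rewrite lee_fin lerDl !mulr_ge0// ltW.
apply: (@le_trans _ _ ((2 * K / r)%:E * (V * \sum_(al <- S) nm (a al) ^+ 2)%:E)%E).
  by apply: lee_wpmul2l => //; rewrite lee_fin.
rewrite -EFinM lee_fin mulrA; apply: ler_wpM2r.
  by apply: sumr_ge0 => al _; exact: sqr_ge0.
rewrite mulrAC; apply: ler_wpM2r; first by rewrite invr_ge0 ltW.
by rewrite lerDr ltW.
Qed.

Definition inbox I (al : d.-tuple nat) : bool := [forall q, (tnth al q < I)%N].

Lemma defect_le S c a z : defect S c a z ^+ 2 <= nm (lincomb kappa S a z) ^+ 2.
Proof.
rewrite -real_normK ?num_real// lerXn2r ?nnegrE ?nm_ge0//.
rewrite /defect; apply: le_trans (nm_lip _ _) _.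
by rewrite addrAC subrr add0r.
Qed.

(** First the radius [r], then the side [I] is taken large. The far part returns at most a quarter
    of the energy by [tail_coord]; an index outside the box has by [near_mass] at most a quarter of
    its mass in the near part. The resulting half is absorbed on the left. *)
Lemma energy_le_defect_box m : exists I, (m < I)%N /\ exists2 K : R, 0 < K &
  forall S c a, uniq S ->
  (forall al, al \in S -> c al != 0 -> forall q, (tnth al q <= m)%N) ->
  ((\sum_(al <- S) nm (a al) ^+ 2)%:E <=
   K%:E * (Ex (fun z => (defect S c a z ^+ 2)%R)
    + (\sum_(al <- S | inbox I al) nm (a al) ^+ 2)%:E))%E.
Proof.
have /choice[Kf hKf] : forall q : 'I_d, exists K : R, 0 < K /\
  forall (r : R) S c a, 4 * m.+2%:R <= r -> uniq S ->
  (forall al, al \in S -> c al != 0 -> (tnth al q <= m)%N) ->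
  (Ex (fun z => ((far r (tnth z q))%:R * nm (lincomb kappa S a z) ^+ 2)%R) <=
   K%:E * Ex (fun z => (defect S c a z ^+ 2)%R)
    + (K / r * \sum_(al <- S) nm (a al) ^+ 2)%:E)%E.
  by move=> q; have [K K0 hK] := tail_coord q m; exists K.
pose K := 1 + \sum_q Kf q.
have sK0 : 0 <= \sum_q Kf q by apply: sumr_ge0 => q _; rewrite ltW// (hKf q).1.
have K0 : 0 < K by rewrite ltr_wpDr.
(* The first term is the condition of [tail_coord]; the second makes the sum of the [Kf q / r] at
   most [1 / 4]. *)
pose r := 4 * m.+2%:R + 4 * K.
have r0 : 0 < r by rewrite addr_gt0// mulr_gt0.
have /choice[If hIf] : forall q : 'I_d, exists I, forall n, (I <= n)%N ->
  (gint (fun x => ((~~ far r x)%:R * nm (Phi1 (tnth kappa q) n x) ^+ 2)%R) <= (4^-1 : R)%:E)%E.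
  by move=> q; apply: near_mass; exact: ltW.
pose I := (m.+1 + \sum_q If q)%N.
exists I; split; first exact: leq_addr.
exists (2 * K + 2); first by rewrite addr_gt0// mulr_gt0.
move=> S c a uS Sc; set E2 := \sum_(al <- S) _; set B2 := \sum_(al <- S | _) _.
have nE : nnm (fun z => nm (lincomb kappa S a z) ^+ 2).
  by apply: nnm_sqr; apply: measurable_nm; exact: measurable_lincomb.
have nF q : nnm (fun z : d.-tuple C => (far r (tnth z q))%:R : R).
  split => //; apply: (measurableT_comp (measurable_far r)); exact: measurable_tnth.
have nN q : nnm (fun z : d.-tuple C => (~~ far r (tnth z q))%:R : R).
  split => //; apply: (measurableT_comp (measurable_near r)); exact: measurable_tnth.
pose om (z : d.-tuple C) : R := \prod_q (~~ far r (tnth z q))%:R.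
have om0 z : 0 <= om z by apply: prodr_ge0.
have nO : nnm om.
  by split => //; apply: measurable_prod => q _; exact: (nN q).1.
have nP al : nnm (fun z => nm (Phi kappa al z) ^+ 2).
  by apply: nnm_sqr; apply: measurable_nm; exact: measurable_Phi.
have [U hU] : exists U, Ex (fun z => defect S c a z ^+ 2) = U%:E.
  exists (fine (Ex (fun z => defect S c a z ^+ 2))); rewrite fineK//.
  rewrite ge0_fin_numE; last by apply: Ex_ge0 => z; exact: sqr_ge0.
  apply: le_lt_trans (Ex_le (nnm_defect _ _ _) nE _) _; first exact: defect_le.
  by rewrite Ex_lincomb// ltry.
have U0 : 0 <= U by rewrite -lee_fin -hU; apply: Ex_ge0 => z; exact: sqr_ge0.
have E20 : 0 <= E2 by apply: sumr_ge0 => *; exact: sqr_ge0.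
(* Either some coordinate is far, or all are near and [om z = 1]. *)
have pw z : nm (lincomb kappa S a z) ^+ 2 <=
    \sum_q (far r (tnth z q))%:R * nm (lincomb kappa S a z) ^+ 2 +
    om z * nm (lincomb kappa S a z) ^+ 2.
  have [/existsP[q fq]|/existsPn nf] := boolP [exists q, far r (tnth z q)].
    rewrite (bigD1 q)//= fq mul1r -addrA lerDl addr_ge0//.
      by apply: sumr_ge0 => *; rewrite mulr_ge0 ?sqr_ge0.
    by rewrite mulr_ge0 ?sqr_ge0.
  rewrite /om [X in _ + X * _]big1 ?mul1r => [|q _]; last by rewrite nf.
  by rewrite lerDr; apply: sumr_ge0 => *; rewrite mulr_ge0 ?sqr_ge0.
have h1 : (Ex (fun z => (\sum_q (far r (tnth z q))%:R * nm (lincomb kappa S a z) ^+ 2)%R)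
    <= (K * U + 4^-1 * E2)%:E)%E.
  rewrite Ex_sum; last by move=> q; exact: nnmM.
  apply: (@le_trans _ _ (\sum_q (Kf q * U + Kf q / r * E2)%:E)%E).
    apply: lee_sum => q _; apply: le_trans ((hKf q).2 r S c a _ uS _) _.
    - by rewrite lerDl mulr_ge0// ltW.
    - by move=> al alS h; exact: Sc.
    - by rewrite hU -EFinM -EFinD.
  rewrite sumEFin lee_fin big_split/= -!mulr_suml; apply: lerD.
    by apply: ler_wpM2r => //; rewrite lerDr.
  apply: ler_wpM2r => //; rewrite ler_pdivrMr//.
  have := (ler0n R m.+2); rewrite /r /K; lra.
have h2 : (Ex (fun z => (om z * nm (lincomb kappa S a z) ^+ 2)%R) <= (B2 + 4^-1 * E2)%:E)%E.
  rewrite parseval_Ex//; last first.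
    by move=> w z w1; apply: eq_bigr => q _; rewrite tnth_mktuple far_rot.
  have -> : B2 + 4^-1 * E2 = \sum_(al <- S)
      ((if inbox I al then nm (a al) ^+ 2 else 0) + 4^-1 * nm (a al) ^+ 2).
    by rewrite big_split/= -mulr_sumr -big_mkcond.
  rewrite -sumEFin; apply: lee_sum => al _.
  apply: (@le_trans _ _ ((nm (a al) ^+ 2)%:E * (if inbox I al then 1 else (4^-1 : R)%:E))%E).
    apply: lee_wpmul2l; first by rewrite lee_fin sqr_ge0.
    case: ifP => [_|/negbT/forallPn[q]].
      rewrite -(Ex_Phi R kappa al); apply: Ex_le => //; first exact: nnmM.
      move=> z; rewrite ler_piMl ?sqr_ge0// /om.
      by apply: prodr_ile1 => q _; case: far => /=; rewrite ?lexx ?ler01.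
    rewrite -leqNgt => Iq.
    have Iqf : (If q <= tnth al q)%N.
      by apply: leq_trans Iq; rewrite /I (bigD1 q)//= addnCA leq_addr.
    apply: le_trans (hIf q _ Iqf).
    rewrite -Ex_Phi_coord//; last exact: measurable_near.
    apply: Ex_le; [exact: nnmM|exact: nnmM|] => z.
    apply: ler_wpM2r; first exact: sqr_ge0.
    rewrite /om (bigD1 q)//= ler_piMr//.
    by apply: prodr_ile1 => q' _; case: far => /=; rewrite ?lexx ?ler01.
  case: ifP => _; first by rewrite mule1 lee_fin lerDl mulr_ge0 ?sqr_ge0.
  by rewrite -EFinM lee_fin add0r mulrC.
have : (E2%:E <= (K * U + 4^-1 * E2 + (B2 + 4^-1 * E2))%:E)%E.
  rewrite -(Ex_lincomb kappa a uS); apply: le_trans (Ex_le nE _ pw) _.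
    by apply: nnmD; [apply: nnm_sum => q|]; exact: nnmM.
  rewrite ExD; [|by apply: nnm_sum => q; exact: nnmM|exact: nnmM].
  by rewrite [leRHS]EFinD; exact: leeD.
rewrite hU -EFinD -EFinM !lee_fin.
have B20 : 0 <= B2 by apply: sumr_ge0 => *; exact: sqr_ge0.
have := mulr_ge0 (ltW K0) B20; nra.
Qed.

End EnergyLocalisation.

(** * Growth at infinity and coefficient bounds *)

Section Growth.
Variable R : realType.
Local Notation C := R[i].
Local Open Scope complex_scope.
Local Notation nm := (@Normc.normc R).
Local Notation cj := (@conjc R).
Local Notation leb := (@lebesgue_measure R).

(** The error is at least one order below the leading monomial. Multiplying by [nm x] expresses this
    without the exponent [n + k - 1], which would be truncated at zero. *)
Lemma hermite_lead k n : exists2 A : R, 0 <= A & forall x : C, 1 <= nm x ->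
  nm x * nm (hermite k n x - x ^+ n * cj x ^+ k) <= A * nm x ^+ (n + k).
Proof.
elim: k n => [|k IH] n.
  by exists 0 => // x x1; rewrite /= mulr1 subrr nm0 mulr0 mul0r.
have [A A0 hA] := IH n; have [A' A'0 hA'] := IH n.-1.
exists (A + n%:R * (1 + A')); first by rewrite addr_ge0// mulr_ge0// addr_ge0.
move=> x x1; have x0 : 0 <= nm x by exact: nm_ge0.
rewrite hermiteS (_ : _ - _ = cj x * (hermite k n x - x ^+ n * cj x ^+ k) +
  - (n%:R * hermite k n.-1 x)); last by rewrite (exprS _ k); ring.
apply: le_trans (ler_wpM2l x0 (nmD _ _)) _; rewrite nmN !nmM nmJ nm_nat mulrDr.
rewrite addnS exprS mulrDl; apply: lerD.
  have := ler_wpM2l x0 (hA x x1); rewrite !mulrA => /le_trans; apply.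
  by rewrite [nm x * A]mulrC.
case: n {hA} hA' => [|n] /= hA'.
  by rewrite !mul0r mulr0.
have hn : nm (hermite k n x) <= (1 + A') * nm x ^+ (n + k).
  rewrite -[hermite k n x](subrK (x ^+ n * cj x ^+ k)).
  apply: le_trans (nmD _ _) _; rewrite addrC mulrDl mul1r; apply: lerD.
    by rewrite nmM !nmX nmJ -exprD.
  by apply: le_trans (hA' x x1); rewrite ler_peMl ?nm_ge0.
rewrite mulrCA -!mulrA; apply: ler_wpM2l => //.
rewrite mulrCA; apply: le_trans (ler_wpM2l x0 hn) _.
apply: ler_wpM2l => //; apply: ler_wpM2l; first by rewrite addr_ge0.
by rewrite ler_weXn2l// addSn.
Qed.

Lemma hermite_upper k n : exists2 A : R, 0 < A & forall x : C, 1 <= nm x ->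
  nm (hermite k n x) <= A * nm x ^+ (n + k).
Proof.
have [A A0 hA] := hermite_lead k n; exists (1 + A); first by rewrite ltr_pwDl.
move=> x x1; rewrite -[hermite k n x](subrK (x ^+ n * cj x ^+ k)).
apply: le_trans (nmD _ _) _; rewrite addrC mulrDl mul1r; apply: lerD.
  by rewrite nmM !nmX nmJ -exprD.
by apply: le_trans (hA x x1); rewrite ler_peMl ?nm_ge0.
Qed.

Lemma hermite_lower k n : exists2 s : R, 1 <= s & forall x : C, s <= nm x ->
  nm x ^+ (n + k) <= 2 * nm (hermite k n x).
Proof.
have [A A0 hA] := hermite_lead k n; exists (2 * A + 1); first by rewrite lerDr mulr_ge0.
move=> x xA; have x1 : 1 <= nm x by apply: le_trans xA; rewrite lerDr mulr_ge0.
have h := hA x x1.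
have lo : nm x ^+ (n + k) - nm (hermite k n x) <=
    nm (hermite k n x - x ^+ n * cj x ^+ k).
  have -> : nm x ^+ (n + k) = nm (x ^+ n * cj x ^+ k) by rewrite nmM !nmX nmJ -exprD.
  rewrite -[leRHS]nmN opprB; apply: le_trans (ler_norm _) (nm_lip _ _).
have x0 : 0 < nm x by apply: lt_le_trans x1.
have := le_trans (ler_wpM2l (ltW x0) lo) h.
have P0 : 0 <= nm x ^+ (n + k) by rewrite exprn_ge0// ltW.
move: (nm x ^+ (n + k)) P0 (nm (hermite k n x)) => P P0 H hP.
rewrite -(ler_pM2l x0); have : 0 <= (nm x - 2 * A) * P by rewrite mulr_ge0//; lra.
by nra.
Qed.

Lemma nm_Phi1 k n (x : C) :
  nm (Phi1 k n x) = (Num.sqrt (k`! * n`!)%:R)^-1 * nm (hermite k n x).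
Proof. by rewrite Phi1E nmM nm_real ger0_norm// invr_ge0 sqrtr_ge0. Qed.

Lemma Phi1_cst_gt0 k n : 0 < (Num.sqrt (k`! * n`!)%:R)^-1 :> R.
Proof. by rewrite invr_gt0 sqrtr_gt0 ltr0n muln_gt0 !fact_gt0. Qed.

Lemma far_nm (s r : R) (x : C) : 1 <= s -> s ^+ 2 <= r -> far r x -> s <= nm x.
Proof.
move=> s1 sr /(le_trans sr); rewrite ler_pXn2r ?nnegrE ?nm_ge0//.
exact: le_trans ler01 s1.
Qed.

Lemma Phi1_growth k i n (eps : R) : (i < n)%N -> 0 < eps ->
  exists2 r0 : R, 0 <= r0 & forall r (x : C), r0 <= r -> far r x ->
    nm (Phi1 k i x) <= eps * nm (Phi1 k n x).
Proof.
move=> lin e0; have [A A0 hA] := hermite_upper k i; have [s s1 hs] := hermite_lower k n.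
pose ci : R := (Num.sqrt (k`! * i`!)%:R)^-1; pose cn : R := (Num.sqrt (k`! * n`!)%:R)^-1.
have ci0 : 0 < ci by exact: Phi1_cst_gt0.
have cn0 : 0 < cn by exact: Phi1_cst_gt0.
have q0 : 0 <= 2 * ci * A / (eps * cn).
  by rewrite divr_ge0 ?mulr_ge0 ?ltW.
exists ((s + 2 * ci * A / (eps * cn)) ^+ 2); first exact: sqr_ge0.
move=> r x rr xr.
have s0 : 0 <= s by apply: le_trans s1.
have hx : s + 2 * ci * A / (eps * cn) <= nm x by apply: far_nm rr xr; lra.
have sx : s <= nm x by apply: le_trans hx; rewrite lerDl.
have x1 : 1 <= nm x by exact: le_trans sx.
have qx : 2 * ci * A <= nm x * (eps * cn).
  by rewrite -ler_pdivrMr ?mulr_gt0//; apply: le_trans hx; rewrite lerDr.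
rewrite !nm_Phi1 -/ci -/cn.
apply: le_trans (ler_wpM2l (ltW ci0) (hA x x1)) _.
have xP : nm x * nm x ^+ (i + k) <= nm x ^+ (n + k).
  by rewrite -exprS ler_weXn2l// -addSn leq_add2r.
have := hs x sx; move: (nm x ^+ (n + k)) xP (nm (hermite k n x)) => Pn xP H hH.
have P0 : 0 <= nm x ^+ (i + k) by rewrite exprn_ge0 ?nm_ge0.
move: (nm x ^+ (i + k)) P0 xP => P P0 xP.
have h1 := ler_wpM2r P0 qx.
have h2 := ler_wpM2l (ltW (mulr_gt0 e0 cn0)) (le_trans xP hH).
by nra.
Qed.

Lemma Phi1_far_pos k n : exists2 r0 : R, 0 <= r0 & exists2 c : R, 0 < c &
  forall r (x : C), r0 <= r -> far r x -> c <= nm (Phi1 k n x).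
Proof.
have [s s1 hs] := hermite_lower k n.
exists (s ^+ 2); first exact: sqr_ge0.
exists ((Num.sqrt (k`! * n`!)%:R)^-1 / 2).
  by rewrite divr_gt0// Phi1_cst_gt0.
move=> r x rr xr; have sx := far_nm s1 rr xr.
rewrite nm_Phi1; apply: ler_wpM2l; first exact: ltW (Phi1_cst_gt0 k n).
have := hs x sx; have : 1 <= nm x ^+ (n + k) by rewrite exprn_ege1// (le_trans s1).
by lra.
Qed.

(** A single unit square [B] inside the far region already has positive mass. *)
Lemma far_mass (r c : R) (f : C -> R) : 0 < c -> measurable_fun setT f ->
  (forall x, 0 <= f x) -> (forall x, far r x -> c <= f x) ->
  (0 < gint (fun x => ((far r x)%:R * f x)%R))%E.
Proof.
move=> c0 mf f0 fc; pose s := `|r| + 1.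
have s1 : 1 <= s by rewrite lerDr.
pose B : set C := @Cpair R @^-1` (`[s, s + 1] `*` `[0, 1]).
have mB : measurable B.
  rewrite -[B]setTI; apply: (measurable_Cpair measurableT).
  by apply: measurableX; exact: measurable_itv.
have lB : lebesgueC R B = 1%E.
  rewrite -[LHS]/((leb \x leb)%E (@pairC R @^-1` B)).
  rewrite (_ : _ @^-1` _ = `[s, s + 1] `*` `[0, 1]); last first.
    by apply/seteqP; split => -[x y].
  rewrite product_measure1E//= !lebesgue_measure_itv/= !lte_fin ltrDl ltr01.
  by rewrite -!EFinB -EFinM subr0 mulr1 addrAC subrr add0r.
pose w := expR (- ((s + 1) ^+ 2 + 1)).
have hB x : B x -> far r x /\ w <= expR (- nm x ^+ 2).
  move=> [/=]; rewrite !in_itv/= => /andP[h1 h2] /andP[h3 h4].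
  have e : nm x ^+ 2 = complex.Re x ^+ 2 + complex.Im x ^+ 2.
    case: x {h1 h2 h3 h4} => u v /=.
    by rewrite sqr_sqrtr// addr_ge0 ?sqr_ge0.
  split.
    rewrite /far e; have := ler_norm r; have := sqr_ge0 (complex.Im x).
    by move: h1 s1; rewrite /s; nra.
  rewrite ler_expR lerN2 e; apply: lerD; nra.
rewrite /gint mule_gt0//; first by rewrite lte_fin invr_gt0 pi_gt0.
have cw0 : 0 < c * w by rewrite mulr_gt0// expR_gt0.
have -> : (0%:E < \int[lebesgueC R]_x ((far r x)%:R * f x * expR (- nm x ^+ 2))%:E)%E
    = (0 < \int[lebesgueC R]_x ((far r x)%:R * f x * expR (- nm x ^+ 2))%:E)%E by [].
have h1 : (\int[lebesgueC R]_x ((c * w)%:E * (\1_B x)%:E) = (c * w)%:E)%E.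
  rewrite ge0_integralZl_EFin//; last exact: ltW.
    by rewrite integral_indic// setIT [X in (_ * X)%E]lB mule1.
  by apply/measurable_EFinP; exact: measurable_indic.
suff : ((c * w)%:E <=
    \int[lebesgueC R]_x ((far r x)%:R * f x * expR (- nm x ^+ 2))%:E)%E.
  by apply: lt_le_trans; rewrite lte_fin.
rewrite -h1; apply: ge0_le_integral => //.
- by move=> x _; rewrite -EFinM lee_fin mulr_ge0// ltW.
- apply/measurable_EFinP; apply: measurable_funM => //; exact: measurable_indic.
- apply/measurable_EFinP; apply: measurable_funM; last first.
    apply: measurableT_comp; first exact: measurable_expR.
    by apply: measurableT_comp => //; apply: measurable_funX; exact: measurable_nm.
  by apply: measurable_funM => //; exact: measurable_far.
- move=> x _; rewrite -EFinM lee_fin indicE.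
  have [xB|xB] := boolP (x \in B); last first.
    by rewrite mulr0 !mulr_ge0 ?expR_ge0.
  move: xB; rewrite inE => /hB[fx wx]; rewrite fx mul1r mulr1.
  by apply: ler_pM => //; [exact: ltW|exact: expR_ge0|exact: fc].
Qed.

Lemma gint_ge0 (f : C -> R) : (forall x, 0 <= f x) -> (0 <= gint f)%E.
Proof. by move=> f0; rewrite -gexp1_gint; apply: gexp1_ge0 => x; rewrite lee_fin. Qed.

Lemma gintD (f g : C -> R) : measurable_fun setT f -> measurable_fun setT g ->
  (forall x, 0 <= f x) -> (forall x, 0 <= g x) ->
  gint (fun x => f x + g x) = (gint f + gint g)%E.
Proof.
have mE : measurable_fun setT (fun x : C => expR (- nm x ^+ 2)).
  apply: measurableT_comp; first exact: measurable_expR.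
  by apply: measurableT_comp => //; apply: measurable_funX; exact: measurable_nm.
move=> mf mg f0 g0; rewrite /gint -ge0_muleDr; last 2 first.
- by apply: integral_ge0 => z _; rewrite lee_fin mulr_ge0// expR_ge0.
- by apply: integral_ge0 => z _; rewrite lee_fin mulr_ge0// expR_ge0.
congr (_ * _)%E; rewrite -ge0_integralD//; first last.
- by apply/measurable_EFinP; exact: measurable_funM.
- by move=> z _; rewrite lee_fin mulr_ge0// expR_ge0.
- by apply/measurable_EFinP; exact: measurable_funM.
- by move=> z _; rewrite lee_fin mulr_ge0// expR_ge0.
by apply: eq_integral => z _; rewrite -EFinD mulrDl.
Qed.

Definition gcross k a b l (x : C) : C := Phi1 k (l + a) x * cj (Phi1 k (l + b) x).

Lemma measurable_gcross k a b l : measurable_fun setT (gcross k a b l).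
Proof.
apply: measurable_mulc; first exact: measurable_Phi1.
by apply: measurable_conjc; exact: measurable_Phi1.
Qed.

Lemma gint_gcross k a b l : (gint (fun x => nm (gcross k a b l x)) <= 1)%E.
Proof.
have m2 n : measurable_fun setT (fun x => 2^-1 * nm (@Phi1 R k n x) ^+ 2).
  by apply: measurable_funM => //; exact: measurable_Phi1_sqr.
have p2 n x : 0 <= 2^-1 * nm (@Phi1 R k n x) ^+ 2 by rewrite mulr_ge0 ?sqr_ge0.
apply: (@le_trans _ _ (gint (fun x => 2^-1 * nm (@Phi1 R k (l + a) x) ^+ 2 +
    2^-1 * nm (@Phi1 R k (l + b) x) ^+ 2))).
  apply: gint_le.
  - by apply: measurable_nm; exact: measurable_gcross.
  - exact: measurable_funD.
  - by move=> x; exact: nm_ge0.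
  - move=> x; rewrite /gcross nmM nmJ.
    move: (nm _) (nm _) => u v; have := sqr_ge0 (u - v); rewrite sqrrB; nra.
have h0 n x : 0 <= nm (@Phi1 R k n x) ^+ 2 by exact: sqr_ge0.
rewrite gintD// !gintZ//; try exact: measurable_Phi1_sqr.
by rewrite !gint_Phi1_sqr !mule1 -EFinD lee_fin; lra.
Qed.

Lemma gcross_growth k a b I (eps : R) : 0 < eps ->
  exists2 r : R, 0 <= r & forall l x, (l < I)%N -> far r x ->
    nm (gcross k a b l x) <= eps * nm (gcross k a b I x).
Proof.
move=> e0.
have h (l : 'I_I) : exists r, 0 <= r /\ forall r' x, r <= r' -> far r' x ->
    nm (gcross k a b l x) <= eps * nm (gcross k a b I x).
  have la : (l + a < I + a)%N by rewrite ltn_add2r.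
  have lb : (l + b < I + b)%N by rewrite ltn_add2r.
  have [r1 r10 h1] := Phi1_growth k la e0.
  have [r2 r20 h2] := Phi1_growth k lb ltr01.
  exists (r1 + r2); split; first exact: addr_ge0.
  move=> r' x rr xr; rewrite /gcross nmM nmJ [X in _ <= eps * X]nmM nmJ [leRHS]mulrA.
  apply: ler_pM; rewrite ?nm_ge0//.
    by apply: (h1 r') => //; apply: le_trans rr; rewrite lerDl.
  by rewrite -[leRHS]mul1r; apply: (h2 r') => //; apply: le_trans rr; rewrite lerDr.
have {h} /choice[rf hr] := h.
exists (\sum_l rf l); first by apply: sumr_ge0 => l _; exact: (hr l).1.
move=> l x lI xr; apply: ((hr (Ordinal lI)).2 _ _ _ xr).
by rewrite (bigD1 (Ordinal lI))//= lerDl; apply: sumr_ge0 => i _; exact: (hr i).1.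
Qed.

(* The term of largest index dominates at infinity; the others are then
   recovered by induction. *)
Lemma gcross_independent k a b I : exists2 K : R, 0 < K & forall w : nat -> C,
  ((\sum_(l < I) nm (w l))%:E <=
   K%:E * gint (fun x => nm (\sum_(l < I) w l * gcross k a b l x)%R))%E.
Proof.
elim: I => [|I [K K0 IH]].
  by exists 1 => // w; rewrite big_ord0 mul1e; apply: gint_ge0 => x; exact: nm_ge0.
(* By [e2], the lower terms then return at most [(A1 + W) / 2]. *)
pose eps : R := (2 * K)^-1.
have e0 : 0 < eps by rewrite invr_gt0 mulr_gt0.
have [r r0 hr] := gcross_growth k a b I e0.
have [r1 r10 [c1 c10 h1]] := Phi1_far_pos k (I + a).
have [r2 r20 [c2 c20 h2]] := Phi1_far_pos k (I + b).
pose s := r + r1 + r2.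
have rs : r <= s by rewrite /s -addrA lerDl addr_ge0.
have mG l : measurable_fun setT (fun x => nm (gcross k a b l x)).
  by apply: measurable_nm; exact: measurable_gcross.
have mFG : measurable_fun setT (fun x => (far s x)%:R * nm (gcross k a b I x)).
  by apply: measurable_funM => //; exact: measurable_far.
have mS (w : nat -> C) J : measurable_fun setT (fun x => nm (\sum_(l < J) w l * gcross k a b l x)).
  apply: measurable_nm; apply: measurable_sumc => l.
  by apply: measurable_mulc => //; exact: measurable_gcross.
pose G := gint (fun x => (far s x)%:R * nm (gcross k a b I x)).
have G0 : (0 < G)%E.
  apply: (far_mass (mulr_gt0 c10 c20)) => // [x|x xs]; first exact: nm_ge0.
  rewrite /gcross nmM nmJ; apply: ler_pM; rewrite ?(ltW c10) ?(ltW c20)//.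
    by apply: (h1 s) => //; rewrite /s addrAC lerDr addr_ge0.
  by apply: (h2 s) => //; rewrite /s lerDr addr_ge0.
have [g Gg] : exists g, G = g%:E.
  exists (fine G); rewrite fineK// ge0_fin_numE ?ltW//.
  apply: le_lt_trans (ltry 1); apply: le_trans (gint_gcross k a b I).
  apply: gint_le => //.
  - by move=> x; rewrite mulr_ge0 ?nm_ge0.
  - by move=> x; case: far; rewrite ?mul1r// mul0r nm_ge0.
have g0 : 0 < g by rewrite -lte_fin -Gg.
exists (K + (K + 1) * (2 / g + 1)).
  by rewrite addr_gt0// mulr_gt0// addr_gt0// divr_gt0.
move=> w; set A := gint _.
have A0 : (0 <= A)%E by apply: gint_ge0 => x; exact: nm_ge0.
have KK0 : 0 < K + (K + 1) * (2 / g + 1).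
  by rewrite addr_gt0// mulr_gt0// addr_gt0// divr_gt0.
case eA : A A0 => [A1| |]//; last by rewrite gt0_muley ?leey// lte_fin.
rewrite lee_fin => A10; rewrite -EFinM lee_fin big_ord_recr/=.
set S := \sum_(l < I) _; set W := nm (w I).
have S0 : 0 <= S by apply: sumr_ge0 => *; exact: nm_ge0.
have W0 : 0 <= W by exact: nm_ge0.
(* On the far region each lower product is at most [eps] times the last one. *)
have e1 : W * g <= A1 + eps * S * g.
  rewrite -lee_fin EFinD !EFinM -Gg -eA /G.
  have nG x : 0 <= (far s x)%:R * nm (gcross k a b I x) by rewrite mulr_ge0 ?nm_ge0.
  have ES0 : 0 <= eps * S by rewrite mulr_ge0// ltW.
  rewrite -EFinM -!gintZ// -gintD//; last 3 first.
  - exact: measurable_funM.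
  - by move=> x; exact: nm_ge0.
  - by move=> x; rewrite mulr_ge0.
  apply: gint_le.
  - exact: measurable_funM.
  - by apply: measurable_funD => //; exact: measurable_funM.
  - by move=> x; rewrite mulr_ge0.
  move=> x; case: (boolP (far s x)) => xs; last first.
    by rewrite !mul0r !mulr0 addr0 nm_ge0.
  rewrite !mul1r big_ord_recr/= -nmM.
  set T := \sum_(l < I) _; rewrite -[X in nm X <= _](addrK T) [X in _ <= nm X + _]addrC.
  apply: le_trans (nmB _ _) _; rewrite lerD2l.
  apply: le_trans (nm_sum _ _ _) _; rewrite -mulrA mulrCA mulr_suml.
  apply: ler_sum => l _; rewrite nmM; apply: ler_wpM2l; first exact: nm_ge0.
  by apply: hr => //; exact: le_trans rs xs.
(* Removing the last term to apply the induction hypothesis costs at most [W], by [gint_gcross]. *)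
have e2 : S <= K * (A1 + W).
  have := IH w; rewrite -/S => hS.
  rewrite -lee_fin; apply: le_trans hS _; rewrite EFinM.
  apply: lee_wpmul2l; first by rewrite lee_fin ltW.
  rewrite EFinD -eA -[W%:E]mule1.
  apply: (@le_trans _ _ (A + W%:E * gint (fun x => nm (gcross k a b I x)))%E); last first.
    by apply: leeD => //; apply: lee_wpmul2l; [rewrite lee_fin|exact: gint_gcross].
  rewrite -gintZ//; last by move=> x; exact: nm_ge0.
  rewrite -gintD//; last 3 first.
  - exact: measurable_funM.
  - by move=> x; exact: nm_ge0.
  - by move=> x; rewrite mulr_ge0 ?nm_ge0.
  apply: gint_le => //.
  - by apply: measurable_funD => //; exact: measurable_funM.
  - by move=> x; exact: nm_ge0.
  move=> x; rewrite big_ord_recr/= -nmM; set T := \sum_(l < I) _.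
  by rewrite -[X in nm X <= _](addrK (w I * gcross k a b I x)); exact: nmB.
have e3 : eps * S <= (A1 + W) / 2.
  rewrite /eps invfM -mulrA [leRHS]mulrC; apply: ler_wpM2l => //.
  by rewrite ler_pdivrMl.
have e4 : W <= A1 * (2 / g + 1).
  have : W * g <= A1 + (A1 + W) / 2 * g by apply: le_trans e1 _; rewrite lerD2l ler_wpM2r// ltW.
  move=> h; rewrite -(ler_pM2r g0).
  have -> : A1 * (2 / g + 1) * g = 2 * A1 + A1 * g.
    by rewrite mulrDr mulr1 mulrDl -mulrA divfK ?gt_eqF// [A1 * 2]mulrC.
  by nra.
have := ler_wpM2l (addr_ge0 (ltW K0) ler01) e4.
by nra.
Qed.

End Growth.

(** * Products of basis functions in several variables, and coefficients from an [L^1] norm *)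

Section Cross.
Variable R : realType.
Local Notation C := R[i].
Local Open Scope complex_scope.
Local Notation nm := (@Normc.normc R).
Local Notation cj := (@conjc R).

Lemma sum_delta (T : eqType) (s : seq T) (y : T) (F : T -> C) : uniq s ->
  \sum_(x <- s) (if x == y then F x else 0) = if y \in s then F y else 0.
Proof.
elim: s => [|x s IH] /=; first by rewrite big_nil.
move=> /andP[xs us]; rewrite big_cons IH// in_cons eq_sym.
case: eqVneq => [->|_] /=; last by rewrite add0r.
by rewrite (negPf xs) addr0.
Qed.

Lemma Phi_cons d (k0 : nat) (kappa : d.-tuple nat) (a0 : nat) (al : d.-tuple nat)
    (z : C) (t : d.-tuple C) :
  Phi [tuple of k0 :: kappa] [tuple of a0 :: al] (tuple_of_pair (z, t)) =
  Phi1 k0 a0 z * Phi kappa al t.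
Proof.
by rewrite /Phi big_ord_recl; congr (_ * _); apply: eq_bigr => i _; rewrite !tnthS.
Qed.

Lemma addT_cons d (x y : nat) (s t : d.-tuple nat) :
  addT [tuple of x :: s] [tuple of y :: t] = [tuple of (x + y)%N :: addT s t].
Proof.
apply: eq_from_tnth => i; rewrite tnth_mktuple.
by case: (unliftP ord0 i) => [j|] ->; rewrite ?tnthS ?tnth_mktuple// !tnth0.
Qed.

Definition cross d (kappa a b la : d.-tuple nat) (z : d.-tuple C) : C :=
  Phi kappa (addT la a) z * cj (Phi kappa (addT la b) z).

(** Enumerating by the first coordinate suits the induction on [d] in [cross_independent]. *)
Fixpoint boxlist (I d : nat) : seq (d.-tuple nat) :=
  if d is d'.+1 then [seq cons_tuple l t | l <- iota 0 I, t <- boxlist I d']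
  else [:: [tuple]].

Lemma mem_boxlist I d (al : d.-tuple nat) : (al \in boxlist I d) = inbox I al.
Proof.
elim: d al => [|d IH] al.
  by rewrite tuple0 /= inE eqxx; apply/esym/forallP => -[].
case/tupleP: al => a al /=; apply/allpairsP/forallP.
  move=> [[l t] /= [lI tI /(congr1 val)[-> ]]] /val_inj -> q.
  move: lI; rewrite mem_iota add0n => /= lI.
  case: (unliftP ord0 q) => [j|] ->; last by rewrite tnth0.
  by rewrite tnthS; move: tI; rewrite IH => /forallP.
move=> h; exists (a, al); split => //=.
  by have := h ord0; rewrite tnth0 mem_iota.
by rewrite IH; apply/forallP => j; have := h (lift ord0 j); rewrite tnthS.
Qed.

Lemma uniq_boxlist I d : uniq (boxlist I d).
Proof.
elim: d => [//|d IH] /=; apply: allpairs_uniq => //; first exact: iota_uniq.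
by move=> [x s] [y t] _ _ /= /(congr1 val)[-> /val_inj ->].
Qed.

Lemma measurable_cross d (kappa a b la : d.-tuple nat) :
  measurable_fun setT (cross kappa a b la).
Proof.
apply: measurable_mulc; first exact: measurable_Phi.
by apply: measurable_conjc; exact: measurable_Phi.
Qed.

(** For a frozen first variable [z] the induction hypothesis bounds [V la0 z], the sum over the
    first index, by the expectation of the section at [z]. Integrating in [z], the one-variable case
    then extracts the coefficient from [V la0]. *)
Lemma cross_independent I d (kappa a b : d.-tuple nat) :
  exists2 K : R, 0 < K & forall (w : d.-tuple nat -> C) la0, la0 \in boxlist I d ->
    ((nm (w la0))%:E <= K%:E * Ex (fun z =>
       nm (\sum_(la <- boxlist I d) w la * cross kappa a b la z)%R))%E.
Proof.
elim: d kappa a b => [|d IH] kappa a b.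
  exists 1 => // w la0; rewrite mul1e /Ex gexp_tuple0; last first.
    apply/measurable_EFinP; apply: measurable_nm; apply: measurable_sumc => la.
    by apply: measurable_mulc => //; exact: measurable_cross.
  rewrite (tuple0 la0) /= big_seq1 /cross /Phi !big_ord0 conjc1 !mulr1.
  by rewrite lexx.
case/tupleP: kappa => k kappa; case/tupleP: a => a0 a; case/tupleP: b => b0 b.
have [K1 K10 h1] := gcross_independent R k a0 b0 I.
have [K2 K20 h2] := IH kappa a b.
exists (K1 * K2); first exact: mulr_gt0.
move=> w la0; case/tupleP: la0 => l0 la0; rewrite mem_boxlist => /forallP h.
have l0I : (l0 < I)%N by have := h ord0; rewrite tnth0.
have la0I : la0 \in boxlist I d.
  by rewrite mem_boxlist; apply/forallP => j; have := h (lift ord0 j); rewrite tnthS.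
pose V (la : d.-tuple nat) (z : C) := \sum_(l < I) w (cons_tuple (val l) la) * gcross k a0 b0 l z.
pose f (z : d.+1.-tuple C) := nm (\sum_(la <- boxlist I d.+1)
   w la * cross [tuple of k :: kappa] [tuple of a0 :: a] [tuple of b0 :: b] la z).
have mf : measurable_fun setT f.
  apply: measurable_nm; apply: measurable_sumc => la.
  by apply: measurable_mulc => //; exact: measurable_cross.
have mV la : measurable_fun setT (V la).
  apply: measurable_sumc => l; apply: measurable_mulc => //; exact: measurable_gcross.
have fE z t : f (tuple_of_pair (z, t)) =
    nm (\sum_(la <- boxlist I d) V la z * cross kappa a b la t).
  rewrite /f /= big_allpairs_dep exchange_big/=; congr nm; apply: eq_bigr => la _.
  rewrite /V mulr_suml -(big_mkord xpredT (fun l =>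
    w (cons_tuple l la) * gcross k a0 b0 l z * cross kappa a b la t)) /index_iota subn0.
  apply: eq_bigr => l _.
  rewrite /cross !addT_cons !Phi_cons cjM /gcross; ring.
have mEf : measurable_fun setT (EFin \o f) by exact/measurable_EFinP.
have f0 z : (0 <= (EFin \o f) z)%E by rewrite lee_fin nm_ge0.
rewrite EFinM -muleA; apply: (@le_trans _ _ (K1%:E * gint (fun z => nm (V la0 z)))%E).
  apply: le_trans (h1 (fun l => w [tuple of l :: la0])).
  by rewrite lee_fin (bigD1 (Ordinal l0I))//= lerDl; apply: sumr_ge0 => *; exact: nm_ge0.
apply: lee_wpmul2l; first by rewrite lee_fin ltW.
rewrite /Ex -/f -[X in (_ * X)%E]/(gexp (EFin \o f)) gexp_tupleS//.
have -> : gint (fun z => nm (V la0 z)) =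
    (K2%:E * gexp1 (fun z => ((nm (V la0 z))%:E * K2^-1%:E)))%E.
  rewrite gexp1Zr//.
  - by rewrite -gexp1_gint muleCA -EFinM mulfV ?gt_eqF// mule1.
  - by apply/measurable_EFinP; exact: measurable_nm.
  - by move=> z; rewrite lee_fin nm_ge0.
  - by rewrite lee_fin invr_ge0 ltW.
apply: lee_wpmul2l; first by rewrite lee_fin ltW.
apply: gexp1_le.
- apply/measurable_EFinP; apply: measurable_funM => //; exact: measurable_nm.
- exact: measurable_gexp_section.
- by move=> z; rewrite lee_fin mulr_ge0 ?nm_ge0// invr_ge0 ltW.
move=> z; have := h2 (fun la => V la z) la0 la0I.
rewrite -[X in (_ <= _ * X)%E -> _](_ : gexp (fun t => (EFin \o f) (tuple_of_pair (z, t))) = _).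
  by rewrite [X in _ -> (X <= _)%E]muleC lee_pdivrMl.
by apply: eq_gexp => t /=; rewrite fE.
Qed.

Section BoxCoefficients.
Variables (d I : nat) (kappa : d.-tuple nat).
Implicit Types al be la : d.-tuple nat.

Definition subT (x y : d.-tuple nat) : d.-tuple nat :=
  [tuple (tnth x q - tnth y q)%N | q < d].

Definition minT (x y : d.-tuple nat) : d.-tuple nat :=
  [tuple minn (tnth x q) (tnth y q) | q < d].

Lemma inbox_le (x y : d.-tuple nat) :
  (forall q, (tnth x q <= tnth y q)%N) -> inbox I y -> inbox I x.
Proof. by move=> xy /forallP h; apply/forallP => q; exact: leq_ltn_trans (xy q) (h q). Qed.

Lemma minT_addl al be al0 be0 : addT al be0 = addT be al0 ->
  addT (minT al be) (subT al0 be0) = al.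
Proof.
move=> h; apply: eq_from_tnth => q; rewrite !tnth_mktuple.
by have := congr1 (fun t => tnth t q) h; rewrite !tnth_mktuple; lia.
Qed.

Lemma minT_addr al be al0 be0 : addT al be0 = addT be al0 ->
  addT (minT al be) (subT be0 al0) = be.
Proof.
move=> h; apply: eq_from_tnth => q; rewrite !tnth_mktuple.
by have := congr1 (fun t => tnth t q) h; rewrite !tnth_mktuple; lia.
Qed.

Lemma inbox_minT al be : inbox I al || inbox I be -> inbox I (minT al be).
Proof.
by case/orP; apply: inbox_le => q; rewrite tnth_mktuple ?geq_minl ?geq_minr.
Qed.

(* The pairs in the class of [(al0, be0)] are [(la + a, la + b)], with [a] and
   [b] the positive and negative parts of [al0 - be0]. *)
Lemma class_reindex S (B : d.-tuple nat -> d.-tuple nat -> C) al0 be0 z : uniq S ->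
  (forall al be, al \in S -> be \in S -> B al be != 0 -> inbox I al || inbox I be) ->
  \sum_(al <- S) \sum_(be <- S | addT al be0 == addT be al0)
     B al be * (Phi kappa al z * cj (Phi kappa be z)) =
  \sum_(la <- boxlist I d)
    (if (addT la (subT al0 be0) \in S) && (addT la (subT be0 al0) \in S)
     then B (addT la (subT al0 be0)) (addT la (subT be0 al0)) else 0) *
    cross kappa (subT al0 be0) (subT be0 al0) la z.
Proof.
move=> uS hB; set a := subT al0 be0; set b := subT be0 al0.
pose f al be := B al be * (Phi kappa al z * cj (Phi kappa be z)).
have ab la : addT (addT la a) be0 = addT (addT la b) al0.
  by apply: eq_from_tnth => q; rewrite !tnth_mktuple; lia.
transitivity (\sum_(la <- boxlist I d) \sum_(al <- S)
    (if al == addT la a then \sum_(be <- S) (if be == addT la b then f al be else 0) else 0)).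
  rewrite exchange_big !big_seq; apply: eq_bigr => al alS.
  transitivity (\sum_(be <- S) \sum_(la <- boxlist I d)
     (if al == addT la a then (if be == addT la b then f al be else 0) else 0)); last first.
    rewrite exchange_big; apply: eq_bigr => la _.
    by case: eqP => // _; rewrite big1.
  rewrite big_mkcond !big_seq; apply: eq_bigr => be beS.
  case: eqP => [e|ne]; last first.
    rewrite big1// => la _; case: eqP => // e1; case: eqP => // e2.
    by case: ne; rewrite e1 e2 ab.
  rewrite -/(f al be).
  (* Since [a] and [b] have disjoint supports, the common part of a pair of the class is its
     componentwise minimum. *)
  have el la : (al == addT la a) && (be == addT la b) = (la == minT al be).
    apply/andP/eqP => [[/eqP e1 _]|->]; last by rewrite minT_addl// minT_addr// !eqxx.
    by apply/eqP; rewrite -(addTK _ _ a) -e1 minT_addl.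
  rewrite (eq_bigr (fun la => if la == minT al be then f al be else 0)); last first.
    by move=> la _; rewrite -el; case: eqP; case: eqP.
  rewrite sum_delta ?uniq_boxlist// mem_boxlist; case: ifP => // nb.
  have [B0|B0] := eqVneq (B al be) 0; first by rewrite /f B0 mul0r.
  by rewrite (inbox_minT (hB _ _ alS beS B0)) in nb.
apply: eq_bigr => la _; rewrite sum_delta//.
case: ifP => _ /=; last by rewrite mul0r.
by rewrite sum_delta//; case: ifP => _; rewrite ?mul0r.
Qed.

(** Averaging against a character extracts one class without increasing the [L^1] norm, and
    [cross_independent] then gives its coefficients. As one index of each pair with nonzero
    coefficient is in the box, so is the common part [la]; this keeps [K] independent of [S]. *)
Lemma box_coefficient_bound : exists2 K : R, 0 < K &
  forall S (B : d.-tuple nat -> d.-tuple nat -> C), uniq S ->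
  (forall al be, al \in S -> be \in S -> B al be != 0 -> inbox I al || inbox I be) ->
  forall al0 be0, al0 \in S -> be0 \in S -> inbox I al0 -> inbox I be0 ->
  ((nm (B al0 be0))%:E <= K%:E * Ex (fun z =>
     nm (\sum_(al <- S) \sum_(be <- S) B al be *
           (Phi kappa al z * cj (Phi kappa be z)))%R))%E.
Proof.
have /choice[Kf hKf] : forall ab : d.-tuple nat * d.-tuple nat,
    exists K : R, 0 < K /\ forall (w : d.-tuple nat -> C) la0, la0 \in boxlist I d ->
    ((nm (w la0))%:E <= K%:E * Ex (fun z =>
       nm (\sum_(la <- boxlist I d) w la * cross kappa ab.1 ab.2 la z)%R))%E.
  by move=> [a b]; have [K K0 h] := cross_independent I kappa a b; exists K.
have s0 ab : 0 <= Kf ab by rewrite ltW// (hKf ab).1.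
(* Only finitely many classes come from pairs in the box, so the sum of their constants serves for
   all. *)
exists (1 + \sum_(a <- boxlist I d) \sum_(b <- boxlist I d) Kf (a, b)).
  by rewrite ltr_pwDl// sumr_ge0// => a _; rewrite sumr_ge0.
move=> S B uS hB al0 be0 al0S be0S al0I be0I.
pose H z := \sum_(al <- S) \sum_(be <- S) B al be *
  (Phi kappa al z * cj (Phi kappa be z)).
pose a := subT al0 be0; pose b := subT be0 al0.
have aI : inbox I a by apply: inbox_le al0I => q; rewrite tnth_mktuple leq_subr.
have bI : inbox I b by apply: inbox_le be0I => q; rewrite tnth_mktuple leq_subr.
have e0 : addT al0 be0 = addT be0 al0.
  by apply: eq_from_tnth => q; rewrite !tnth_mktuple addnC.
pose w la := if (addT la a \in S) && (addT la b \in S) then B (addT la a) (addT la b) else 0.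
have := (hKf (a, b)).2 w (minT al0 be0).
rewrite mem_boxlist inbox_minT ?al0I// => /(_ isT).
rewrite {1}/w /a /b minT_addl// minT_addr// al0S be0S /= -/a -/b.
move=> /le_trans; apply.
pose Q z := \sum_(la <- boxlist I d) w la * cross kappa a b la z.
have mH : measurable_fun setT H.
  apply: measurable_sumc => al; apply: measurable_sumc => be.
  apply: measurable_mulc => //; apply: measurable_mulc; first exact: measurable_Phi.
  by apply: measurable_conjc; exact: measurable_Phi.
have mQ : measurable_fun setT Q.
  by apply: measurable_sumc => la; apply: measurable_mulc => //; exact: measurable_cross.
have nH := nnm_nm mH; have nQ := nnm_nm mQ.
have KK : Kf (a, b) <= 1 + \sum_(a <- boxlist I d) \sum_(b <- boxlist I d) Kf (a, b).
  rewrite (big_rem a) ?mem_boxlist//= (big_rem b) ?mem_boxlist//=.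
  have h1 : 0 <= \sum_(y <- rem b (boxlist I d)) Kf (a, y) by rewrite sumr_ge0.
  have h2 : 0 <= \sum_(y <- rem a (boxlist I d)) \sum_(v <- boxlist I d) Kf (y, v).
    by apply: sumr_ge0 => y _; rewrite sumr_ge0.
  by move: h1 h2; move: (\sum_(_ <- _) _) (\sum_(_ <- _) _) => u v; lra.
suff QH : (Ex (fun z => nm (Q z)) <= Ex (fun z => nm (H z)))%E.
  apply: (@le_trans _ _ ((Kf (a, b))%:E * Ex (fun z => nm (H z)))%E).
    by apply: lee_wpmul2l; rewrite ?lee_fin.
  by apply: lee_wpmul2r; [apply: Ex_ge0 => z; exact: nm_ge0|rewrite lee_fin].
have [N hN] := sizeS_bound S; have [N1 hN1] := sizeS_bound [:: kappa; al0; be0].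
pose L := (N + N1 + N1).+1.
have [zeta hz] := exists_prim_root R (isT : (0 < L)%N).
have SL x : x \in [:: kappa; al0; be0] -> forall al, al \in S ->
    forall q, (tnth al q + tnth kappa q + tnth x q < L)%N.
  move=> xS al alS q; have := hN _ alS q; have := hN1 _ xS q.
  have := hN1 kappa (mem_head _ _) q => h1 h2 h3; rewrite /L ltnS.
  by apply: leq_add; [apply: leq_add|]; exact: ltnW.
have Ld : (0 : R) < (L ^ d)%:R by rewrite ltr0n expn_gt0.
have pw z : (L ^ d)%:R * nm (Q z) <= \sum_(w <- torus d L zeta) nm (H (rotT w z)).
  have be0m : be0 \in [:: kappa; al0; be0] by rewrite !inE eqxx !orbT.
  have al0m : al0 \in [:: kappa; al0; be0] by rewrite !inE eqxx !orbT.
  have := torus_bilin B z hz (SL _ be0m) (SL _ al0m).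
  rewrite (class_reindex _ _ z uS hB) -/a -/b -/(Q z) => e.
  rewrite -(nm_nat R (L ^ d)) -nmM -e; apply: le_trans (nm_sum _ _ _) _.
  rewrite big_seq [leRHS]big_seq; apply: ler_sum => v vT.
  by rewrite nmM nm_chi ?mul1r//; exact: torus_unit vT.
have nS : nnm (fun z => \sum_(w <- torus d L zeta) nm (H (rotT w z))).
  by apply: nnm_sum => v; apply: (nnm_rot v nH).
have := Ex_le (nnmZ (ltW Ld) nQ) nS pw.
rewrite (ExZ (ltW Ld) nQ) (Ex_avg (torus_unit hz) nH) size_torus.
by rewrite lee_pmul2l// lte_fin.
Qed.

End BoxCoefficients.

End Cross.

(** * Stability near the target *)

Section Local.
Variable R : realType.
Local Notation C := R[i].
Local Open Scope complex_scope.
Local Notation nm := (@Normc.normc R).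
Local Notation cj := (@conjc R).

Lemma sum_ext (V : nmodType) (T : eqType) (S0 S : seq T) (g : T -> V) :
  uniq S0 -> uniq S -> {subset S0 <= S} -> (forall x, x \notin S0 -> g x = 0) ->
  \sum_(x <- S) g x = \sum_(x <- S0) g x.
Proof.
move=> uS0 uS sS g0; rewrite (bigID (mem S0))/= [X in _ + X]big1 ?addr0.
  rewrite -big_filter; apply: perm_big; apply: uniq_perm => //.
    exact: filter_uniq.
  by move=> x; rewrite mem_filter; apply/andP/idP => [[]//|xS]; split => //; exact: sS.
by move=> x; exact: g0.
Qed.

Lemma Ex_fin d (f g : d.-tuple C -> R) (B : R) : nnm f -> nnm g ->
  (forall z, f z <= g z) -> Ex g = B%:E -> exists2 A : R, 0 <= A & Ex f = A%:E.
Proof.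
move=> nf ng fg gB; exists (fine (Ex f)).
  by apply: fine_ge0; apply: Ex_ge0; exact: nf.2.
rewrite fineK// ge0_fin_numE; last by apply: Ex_ge0; exact: nf.2.
by apply: le_lt_trans (Ex_le nf ng fg) _; rewrite gB ltry.
Qed.

(** Cauchy-Schwarz, from [2 f g <= t f^2 + g^2 / t] and a choice of [t]. *)
Lemma Ex_CS d (f g : d.-tuple C -> R) (A B : R) : nnm f -> nnm g ->
  Ex (fun z => f z ^+ 2) = A%:E -> Ex (fun z => g z ^+ 2) = B%:E ->
  exists X : R, [/\ 0 <= X, Ex (fun z => f z * g z) = X%:E & X ^+ 2 <= A * B].
Proof.
move=> nf ng fA gB.
have nf2 : nnm (fun z => f z ^+ 2) by exact: nnm_sqr nf.1.
have ng2 : nnm (fun z => g z ^+ 2) by exact: nnm_sqr ng.1.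
have nfg := nnmM nf ng.
have A0 : 0 <= A by rewrite -lee_fin -fA; apply: Ex_ge0 => z; exact: sqr_ge0.
have B0 : 0 <= B by rewrite -lee_fin -gB; apply: Ex_ge0 => z; exact: sqr_ge0.
have nt (t : R) : 0 < t -> nnm (fun z => t * f z ^+ 2 + t^-1 * g z ^+ 2).
  by move=> t0; apply: nnmD; apply: nnmZ => //; rewrite ?invr_ge0 ltW.
have et (t : R) : 0 < t ->
    Ex (fun z => t * f z ^+ 2 + t^-1 * g z ^+ 2) = (t * A + t^-1 * B)%:E.
  move=> t0; have t1 : 0 <= t^-1 by rewrite invr_ge0 ltW.
  by rewrite (ExD (nnmZ (ltW t0) nf2) (nnmZ t1 ng2)) (ExZ (ltW t0) nf2) (ExZ t1 ng2) fA gB.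
have pt (t : R) z : 0 < t -> 2 * (f z * g z) <= t * f z ^+ 2 + t^-1 * g z ^+ 2.
  move=> t0; have := mulr_ge0 (ltW t0) (sqr_ge0 (f z - t^-1 * g z)).
  have -> : t * (f z - t^-1 * g z) ^+ 2 = t * f z ^+ 2
      - 2 * (t * t^-1) * (f z * g z) + (t * t^-1) * t^-1 * g z ^+ 2 by ring.
  by rewrite mulfV ?gt_eqF//; lra.
have [X X0 hX] : exists2 X : R, 0 <= X & Ex (fun z => f z * g z) = X%:E.
  apply: (Ex_fin nfg (nt 1 ltr01) _ (et 1 ltr01)) => z.
  by have := pt 1 z ltr01; have := mulr_ge0 (nf.2 z) (ng.2 z); lra.
have ht (t : R) : 0 < t -> 2 * X <= t * A + t^-1 * B.
  move=> t0; rewrite -lee_fin -et// EFinM -hX -ExZ//.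
  by apply: Ex_le; [exact: nnmZ|exact: nt|move=> z; exact: pt].
exists X; split => //.
move: X0; rewrite le_eqVlt => /orP[/eqP <-|X0]; first by rewrite expr0n/= mulr_ge0.
move: A0; rewrite le_eqVlt => /orP[/eqP A0|A0].
  (* If [A = 0], this [t] gives [2 X <= X], contrary to [0 < X]. *)
  have t0 : 0 < (B + 1) / X by rewrite divr_gt0// ltr_wpDl.
  have := ht _ t0; rewrite -A0 mulr0 add0r invfM invrK -mulrA.
  have : (B + 1)^-1 * (X * B) <= X.
    by rewrite ler_pdivrMl ?ltr_wpDl//; nra.
  by lra.
have t0 : 0 < X / A by rewrite divr_gt0.
have := ht _ t0; rewrite divfK ?gt_eqF// invfM invrK => h.
have : X <= X^-1 * A * B by lra.
by rewrite -mulrA ler_pdivlMl// expr2.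
Qed.

Variables (d : nat) (kappa : d.-tuple nat).

Lemma box_sum I S (f : d.-tuple nat -> R) (M : R) : uniq S -> 0 <= M ->
  (forall al, al \in S -> inbox I al -> f al <= M) ->
  \sum_(al <- S | inbox I al) f al <= (size (boxlist I d))%:R * M.
Proof.
move=> uS M0 h; rewrite -big_filter.
apply: (@le_trans _ _ (\sum_(al <- [seq al <- S | inbox I al]) M)).
  rewrite big_seq [leRHS]big_seq; apply: ler_sum => al; rewrite mem_filter.
  by move=> /andP[aI aS]; exact: h.
rewrite big_const_seq count_predT iter_addr_0 -[leLHS]mulr_natl; apply: ler_wpM2r => //.
rewrite ler_nat; apply: uniq_leq_size; first exact: filter_uniq.
by move=> al; rewrite mem_filter mem_boxlist => /andP[].
Qed.

Lemma lincomb_bilin S (a b : d.-tuple nat -> C) z :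
  lincomb kappa S a z * cj (lincomb kappa S b z) =
  \sum_(al <- S) \sum_(be <- S) a al * cj (b be) * (Phi kappa al z * cj (Phi kappa be z)).
Proof.
rewrite /lincomb rmorph_sum/= big_distrlr/=.
by apply: eq_bigr => al _; apply: eq_bigr => be _; rewrite cjM; ring.
Qed.

(** The linearisation [e -> e conj P + P conj e] kills [i P], the direction of the phase. The
    condition on [a al0] removes it: the diagonal coefficient at [al0] becomes [2 t |c al0|^2],
    which controls [t], and then the row of [al0] controls every [a be] in the box. *)
Lemma local_bound m (S0 : seq (d.-tuple nat)) (c : d.-tuple nat -> C) al0 :
  uniq S0 -> (forall al, al \notin S0 -> c al = 0) ->
  (forall al, al \in S0 -> forall q, (tnth al q <= m)%N) ->
  al0 \in S0 -> c al0 != 0 ->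
  exists2 K : R, 0 < K & forall S a (t : R), uniq S -> {subset S0 <= S} ->
    a al0 = t%:C * c al0 ->
    forall U : R, Ex (fun z => defect kappa S c a z ^+ 2) = U%:E ->
    \sum_(al <- S) nm (a al) ^+ 2 <= K * (U + (\sum_(al <- S) nm (a al) ^+ 2) ^+ 2).
Proof.
move=> uS0 c0 S0m al0S0 ca0.
have [I [mI [KB KB0 hB]]] := energy_le_defect_box R kappa m.
have [K1 K10 hX] := box_coefficient_bound R I kappa.
pose g := nm (c al0).
have g0 : 0 < g by rewrite lt_def nm_ge0 andbT nm_eq0.
pose p := \sum_(al <- S0) nm (c al) ^+ 2.
have p0 : 0 <= p by apply: sumr_ge0 => *; exact: sqr_ge0.
pose K2 := K1 / g + K1 * (1 + p) / (2 * g ^+ 2).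
have K20 : 0 < K2.
  rewrite addr_gt0// ?divr_gt0 ?mulr_gt0 ?exprn_gt0//.
  by rewrite ltr_wpDr.
pose n : R := (size (boxlist I d))%:R.
pose K3 := KB * (1 + n * K2 ^+ 2 * (12 * p + 6)).
have n0 : 0 <= n by [].
have K30 : 0 < K3.
  apply: mulr_gt0 => //; apply: ltr_wpDr => //; apply: mulr_ge0.
    by rewrite mulr_ge0 ?sqr_ge0.
  by rewrite addr_ge0// mulr_ge0.
exists K3 => // S a t uS sS ta U hU.
set E2 := \sum_(al <- S) _.
have E20 : 0 <= E2 by apply: sumr_ge0 => *; exact: sqr_ge0.
have U0 : 0 <= U by rewrite -lee_fin -hU; apply: Ex_ge0 => z; exact: sqr_ge0.
have cS : \sum_(al <- S) nm (c al) ^+ 2 = p.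
  by apply: sum_ext => // al /c0 ->; rewrite nm0 expr0n.
have hc al : nm (c al) <= 1 + p.
  have [aS|/c0 ->] := boolP (al \in S0); last by rewrite nm0 addr_ge0.
  have : nm (c al) ^+ 2 <= p.
    by rewrite /p (big_rem al)//= lerDl; apply: sumr_ge0 => *; exact: sqr_ge0.
  by have := sqr_ge0 (nm (c al) - 1); rewrite sqrrB; have := nm_ge0 (c al); nra.
have Scm al : al \in S -> c al != 0 -> forall q, (tnth al q <= m)%N.
  move=> _ ca; apply: S0m; apply: contraNT ca => /c0 ->; exact: eqxx.
have cI al : c al != 0 -> inbox I al.
  move=> ca; apply/forallP => q; apply: leq_ltn_trans mI; apply: S0m.
  by apply: contraNT ca => /c0 ->; rewrite eqxx.
pose D z := defect kappa S c a z.
pose P z := lincomb kappa S c z; pose e z := lincomb kappa S a z.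
have mD : measurable_fun setT D by exact: measurable_defect.
have nD : nnm (fun z => `|D z|).
  by split => [|z]; [exact: measurableT_comp|exact: normr_ge0].
have nP : nnm (fun z => nm (P z)) by apply: nnm_nm; exact: measurable_lincomb.
have ne2 : nnm (fun z => nm (e z) ^+ 2).
  by apply: nnm_sqr; apply: measurable_nm; exact: measurable_lincomb.
have nD2 : nnm (fun z => D z ^+ 2) by exact: nnm_sqr.
have hP : Ex (fun z => nm (P z) ^+ 2) = p%:E by rewrite Ex_lincomb// cS.
have he : Ex (fun z => nm (e z) ^+ 2) = E2%:E by rewrite Ex_lincomb.
have hD : Ex (fun z => `|D z| ^+ 2) = U%:E.
  by rewrite -hU; apply: eq_Ex => z; rewrite real_normK ?num_real.
have [X [X0 hXX X2]] := Ex_CS nD nP hD hP.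
pose Q := U + 2 * X + E2.
have Q0 : 0 <= Q by rewrite !addr_ge0// mulr_ge0.
pose B al be := a al * cj (c be) + c al * cj (a be).
have BI al be : al \in S -> be \in S -> B al be != 0 -> inbox I al || inbox I be.
  move=> _ _; have [ca|/cI ->//] := eqVneq (c al) 0.
  have [cb|/cI ->] := eqVneq (c be) 0; last by rewrite orbT.
  by rewrite /B ca cb conjc0 mulr0 mul0r addr0 eqxx.
have BE z : \sum_(al <- S) \sum_(be <- S) B al be * (Phi kappa al z * cj (Phi kappa be z)) =
    (D z ^+ 2 + 2 * D z * nm (P z) - nm (e z) ^+ 2)%:C.
  transitivity (e z * cj (P z) + P z * cj (e z)).
    rewrite /e /P !lincomb_bilin -big_split; apply: eq_bigr => al _ /=.
    by rewrite -big_split; apply: eq_bigr => be _ /=; rewrite /B mulrDl.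
  have -> : D z ^+ 2 + 2 * D z * nm (P z) - nm (e z) ^+ 2 =
      nm (P z + e z) ^+ 2 - nm (P z) ^+ 2 - nm (e z) ^+ 2.
    by rewrite /D /defect -/(P z) -/(e z); ring.
  by rewrite !rmorphB/= !nm_sqrC rmorphD/=; ring.
have hQ : (Ex (fun z => nm (\sum_(al <- S) \sum_(be <- S) B al be *
    (Phi kappa al z * cj (Phi kappa be z)))%R) <= Q%:E)%E.
  have n1 : nnm (fun z => D z ^+ 2 + 2 * (`|D z| * nm (P z))).
    by apply: nnmD => //; apply: nnmZ => //; exact: nnmM.
  have -> : Q%:E = Ex (fun z => D z ^+ 2 + 2 * (`|D z| * nm (P z)) + nm (e z) ^+ 2).
    rewrite (ExD n1 ne2) ExD//; last by apply: nnmZ => //; exact: nnmM.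
    by rewrite hU he ExZ//; [rewrite hXX|exact: nnmM].
  apply: Ex_le; last first.
  - move=> z; rewrite BE nm_real; apply: le_trans (ler_normB _ _) _.
    rewrite [X in _ + X <= _]ger0_norm ?sqr_ge0// lerD2r.
    apply: le_trans (ler_normD _ _) _; rewrite ger0_norm ?sqr_ge0// lerD2l.
    by rewrite -mulrA !normrM ger0_norm// [X in _ * (_ * X)]ger0_norm// nm_ge0.
  - exact: nnmD.
  - under eq_fun do rewrite BE nm_real.
    split => [|z]; last exact: normr_ge0.
    apply: measurableT_comp => //; apply: measurable_funB; last exact: ne2.1.
    apply: measurable_funD; first exact: nD2.1.
    by apply: measurable_funM; [exact: measurable_funM|exact: nP.1].
have al0S : al0 \in S by exact: sS.
have al0I : inbox I al0 by exact: cI.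
have hb be : be \in S -> inbox I be -> nm (B al0 be) <= K1 * Q.
  move=> beS beI; rewrite -lee_fin EFinM.
  apply: le_trans (hX S B uS BI al0 be al0S beS al0I beI) _.
  by apply: lee_wpmul2l => //; rewrite lee_fin ltW.
have ht : `|t| <= K1 * Q / (2 * g ^+ 2).
  have := hb _ al0S al0I; rewrite /B ta cjM conjc_real.
  have -> : t%:C * c al0 * cj (c al0) + c al0 * (t%:C * cj (c al0)) =
    (2 * t)%:C * (c al0 * cj (c al0)) by rewrite rmorphM/= rmorph_nat; ring.
  rewrite nmM nm_real nmM nmJ -/g normrM normr_nat => h.
  by rewrite ler_pdivlMr ?mulr_gt0 ?exprn_gt0//; lra.
(* [B al0 be] minus its part with [a al0], already bounded through [t], is [c al0 * conj (a be)]. *)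
have ha be : be \in S -> inbox I be -> nm (a be) <= K2 * Q.
  move=> beS beI; have h := hb _ beS beI.
  have : g * nm (a be) <= K1 * Q + `|t| * g * (1 + p).
    have -> : g * nm (a be) = nm (B al0 be - a al0 * cj (c be)).
      by rewrite /B [a al0 * _ + _]addrC addrK nmM nmJ.
    apply: le_trans (nmB _ _) _; apply: lerD => //.
    rewrite ta !nmM nm_real nmJ; apply: ler_wpM2l => //.
    by rewrite mulr_ge0// ltW.
  have := ler_wpM2r (mulr_ge0 (ltW g0) (addr_ge0 ler01 p0)) ht.
  rewrite mulrA => h1 h2; rewrite -(ler_pM2l g0).
  apply: le_trans h2 _; apply: le_trans (lerD (lexx _) h1) _.
  rewrite le_eqVlt; apply/orP; left; apply/eqP; rewrite /K2.
  by field; rewrite gt_eqF.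
have hbox : \sum_(al <- S | inbox I al) nm (a al) ^+ 2 <= n * (K2 * Q) ^+ 2.
  apply: box_sum => //; first exact: sqr_ge0.
  move=> al aS aI; rewrite ler_pXn2r ?nnegrE ?nm_ge0//; first exact: ha.
  by rewrite mulr_ge0// ltW.
have UE : U <= E2.
  rewrite -lee_fin -hU -he; apply: Ex_le => // z; exact: defect_le.
(* [X] is only of order [sqrt U], but [Q] enters squared, which restores a bound linear in [U]; the
   term [U ^+ 2] is put into [E2 ^+ 2]. *)
have Q2 : Q ^+ 2 <= 12 * p * U + 6 * E2 ^+ 2.
  have h1 : Q ^+ 2 <= 3 * (U ^+ 2 + 4 * X ^+ 2 + E2 ^+ 2).
    have := sqr_ge0 (U - 2 * X); have := sqr_ge0 (U - E2); have := sqr_ge0 (2 * X - E2).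
    rewrite /Q; nra.
  have h2 : U ^+ 2 <= E2 ^+ 2 by rewrite ler_pXn2r.
  by move: X2 h1 h2; lra.
have := hB S c a uS Scm; rewrite hU -EFinD -EFinM lee_fin -/E2 => /le_trans; apply.
apply: (@le_trans _ _ (KB * (U + n * K2 ^+ 2 * (12 * p * U + 6 * E2 ^+ 2)))).
  apply: ler_wpM2l; first exact: ltW.
  rewrite lerD2l; apply: le_trans hbox _; rewrite exprMn mulrA.
  by apply: ler_wpM2l => //; rewrite mulr_ge0// sqr_ge0.
rewrite /K3 -[leRHS]mulrA; apply: ler_wpM2l; first exact: ltW.
have k0 : 0 <= n * K2 ^+ 2 by rewrite mulr_ge0// sqr_ge0.
move: (n * K2 ^+ 2) k0 (E2 ^+ 2) (sqr_ge0 E2) => k k0 V V0.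
have := mulr_ge0 k0 (mulr_ge0 p0 V0); have := mulr_ge0 k0 U0; nra.
Qed.

End Local.

(** * Compactness *)

Section Global.
Variable R : realType.
Local Notation C := R[i].
Local Open Scope complex_scope.
Local Notation nm := (@Normc.normc R).
Local Notation cj := (@conjc R).

Definition farmass k n (r : R) : R :=
  fine (gint (fun x => (far r x)%:R * nm (Phi1 k n x) ^+ 2)).

Lemma measurable_far_Phi1 k n r :
  measurable_fun setT (fun x => (far r x)%:R * nm (@Phi1 R k n x) ^+ 2).
Proof. by apply: measurable_funM; [exact: measurable_far|exact: measurable_Phi1_sqr]. Qed.

Lemma far_Phi1_ge0 k n r x : 0 <= (far r x)%:R * nm (@Phi1 R k n x) ^+ 2.
Proof. by rewrite mulr_ge0 ?sqr_ge0. Qed.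

Lemma gint_far_le1 k n r :
  (gint (fun x => ((far r x)%:R * nm (@Phi1 R k n x) ^+ 2)%R) <= 1)%E.
Proof.
rewrite -(gint_Phi1_sqr R k n); apply: gint_le.
- exact: measurable_far_Phi1.
- exact: measurable_Phi1_sqr.
- by move=> x; exact: far_Phi1_ge0.
- by move=> x; case: far; rewrite ?mul1r// mul0r sqr_ge0.
Qed.

Lemma farmassE k n r :
  gint (fun x => (far r x)%:R * nm (@Phi1 R k n x) ^+ 2) = (farmass k n r)%:E.
Proof.
rewrite fineK// ge0_fin_numE; last by apply: gint_ge0 => x; exact: far_Phi1_ge0.
exact: le_lt_trans (gint_far_le1 k n r) (ltry 1).
Qed.

Lemma farmass_le1 k n r : farmass k n r <= 1.
Proof. by rewrite -lee_fin -farmassE; exact: gint_far_le1. Qed.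

Lemma farmass_ge0 k n r : 0 <= farmass k n r.
Proof. by rewrite -lee_fin -farmassE; apply: gint_ge0 => x; exact: far_Phi1_ge0. Qed.

Lemma farmass_growth k m n (eps : R) : (m < n)%N -> 0 < eps ->
  exists2 r0 : R, 0 <= r0 & forall r, r0 <= r -> forall i, (i <= m)%N ->
    farmass k i r <= eps * farmass k n r.
Proof.
move=> mn e0; pose e := Num.min eps 1.
have e'0 : 0 < e by rewrite lt_min e0 ltr01.
have ee : e ^+ 2 <= eps.
  have h1 : e <= 1 by rewrite ge_min lexx orbT.
  have h2 : e <= eps by rewrite ge_min lexx.
  by apply: le_trans h2; rewrite expr2 ler_piMl// ltW.
have h (i : 'I_m.+1) : exists r0 : R, 0 <= r0 /\ forall r x, r0 <= r -> far r x ->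
    nm (Phi1 k i x) <= e * nm (Phi1 k n x).
  have [r0 r00 hr] := Phi1_growth k (leq_trans (ltn_ord i) mn) e'0.
  by exists r0.
have {h} /choice[rf hr] := h.
exists (\sum_i rf i); first by apply: sumr_ge0 => i _; exact: (hr i).1.
move=> r rr i im; rewrite -lee_fin EFinM -!farmassE -gintZ; last 3 first.
- exact: ltW.
- exact: measurable_far_Phi1.
- by move=> x; exact: far_Phi1_ge0.
apply: gint_le.
- exact: measurable_far_Phi1.
- by apply: measurable_funM => //; exact: measurable_far_Phi1.
- by move=> x; exact: far_Phi1_ge0.
move=> x; case: (boolP (far r x)) => xr; last by rewrite !mul0r mulr0.
rewrite !mul1r; have : nm (Phi1 k i x) <= e * nm (Phi1 k n x).
  apply: ((hr (Ordinal (n := m.+1) im)).2 r x _ xr); apply: le_trans rr.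
  by rewrite (bigD1 (Ordinal (n := m.+1) im))//= lerDl; apply: sumr_ge0 => j _; exact: (hr j).1.
move=> hx; apply: (@le_trans _ _ ((e * nm (Phi1 k n x)) ^+ 2)).
  by rewrite ler_pXn2r ?nnegrE ?nm_ge0// mulr_ge0 ?nm_ge0// ltW.
by rewrite exprMn; apply: ler_wpM2r => //; exact: sqr_ge0.
Qed.

Lemma farmass_gt0 k n : exists2 r0 : R, 0 <= r0 & forall r, r0 <= r -> 0 < farmass k n r.
Proof.
have [r0 r00 [c c0 hc]] := Phi1_far_pos R k n.
exists r0 => // r rr; rewrite -lte_fin -farmassE.
apply: (@far_mass _ _ (c ^+ 2)).
- by rewrite exprn_gt0.
- exact: measurable_Phi1_sqr.
- by move=> x; exact: sqr_ge0.
- move=> x xr; rewrite ler_pXn2r ?nnegrE ?nm_ge0 ?(ltW c0)//; exact: hc rr xr.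
Qed.

Lemma farmass_large k (r : R) : 0 <= r ->
  exists I, forall n, (I <= n)%N -> 3 / 4 <= farmass k n r.
Proof.
move=> r0; have [I hI] := near_mass k r0; exists I => n nI.
have := hI n nI => h.
have mN : measurable_fun setT (fun x => (~~ far r x)%:R * nm (@Phi1 R k n x) ^+ 2).
  by apply: measurable_funM; [exact: measurable_near|exact: measurable_Phi1_sqr].
have : (1 <= (farmass k n r)%:E + (4^-1 : R)%:E)%E.
  rewrite -(gint_Phi1_sqr R k n) -farmassE.
  apply: le_trans (leeD (lexx _) h); rewrite -gintD//.
  - rewrite le_eqVlt; apply/orP; left; apply/eqP; congr gint; apply/funext => x.
    by case: far; rewrite ?mul1r ?mul0r ?addr0 ?add0r.
  - exact: measurable_far_Phi1.
  - by move=> x; exact: far_Phi1_ge0.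
  - by move=> x; rewrite mulr_ge0 ?sqr_ge0.
by rewrite -EFinD lee_fin; lra.
Qed.

Variables (d : nat) (kappa : d.-tuple nat).

Definition gap S (f c : d.-tuple nat -> C) z : R :=
  nm (lincomb kappa S f z) - nm (lincomb kappa S c z).

Lemma measurable_gap S f c : measurable_fun setT (gap S f c).
Proof. by apply: measurable_funB; apply: measurable_nm; exact: measurable_lincomb. Qed.

Lemma lincombD S (f g : d.-tuple nat -> C) z :
  lincomb kappa S (fun al => f al + g al) z = lincomb kappa S f z + lincomb kappa S g z.
Proof. by rewrite /lincomb -big_split; apply: eq_bigr => al _; rewrite mulrDl. Qed.

Lemma defect_gap S (f c : d.-tuple nat -> C) z :
  defect kappa S c (fun al => f al - c al) z = gap S f c z.
Proof.
rewrite /defect /gap -lincombD; congr (nm _ - _).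
by apply: eq_bigr => al _; rewrite addrC subrK.
Qed.

Lemma nnm_gap S f c : nnm (fun z => gap S f c z ^+ 2).
Proof. by apply: nnm_sqr; exact: measurable_gap. Qed.

Lemma far_energy q S (f : d.-tuple nat -> C) r : uniq S ->
  Ex (fun z => (far r (tnth z q))%:R * nm (lincomb kappa S f z) ^+ 2) =
  (\sum_(al <- S) nm (f al) ^+ 2 * farmass (tnth kappa q) (tnth al q) r)%:E.
Proof.
move=> uS; rewrite (Ex_coord_parseval _ _ _ uS (measurable_far r))//.
  by rewrite -sumEFin; apply: eq_bigr => al _; rewrite farmassE.
by move=> w x w1; rewrite far_rot.
Qed.

(** Tightness passes from [P] to [F] through [|F|^2 <= 2 |P|^2 + 2 (|F| - |P|)^2] on the far
    region. *)
Lemma far_compare q S (f c : d.-tuple nat -> C) (U r : R) : uniq S ->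
  (Ex (fun z => (gap S f c z ^+ 2)%R) <= U%:E)%E ->
  \sum_(al <- S) nm (f al) ^+ 2 * farmass (tnth kappa q) (tnth al q) r <=
  2 * (\sum_(al <- S) nm (c al) ^+ 2 * farmass (tnth kappa q) (tnth al q) r) + 2 * U.
Proof.
move=> uS hU.
have nF : nnm (fun z : d.-tuple C => (far r (tnth z q))%:R : R).
  by split => //; apply: (measurableT_comp (measurable_far r)); exact: measurable_tnth.
have nl g : nnm (fun z => nm (lincomb kappa S g z) ^+ 2).
  by apply: nnm_sqr; apply: measurable_nm; exact: measurable_lincomb.
rewrite -lee_fin EFinD !EFinM -!far_energy//.
apply: (@le_trans _ _ (2%:E * Ex (fun z =>
    ((far r (tnth z q))%:R * nm (lincomb kappa S c z) ^+ 2)%R)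
   + 2%:E * Ex (fun z => (gap S f c z ^+ 2)%R))%E); last first.
  by apply: leeD => //; apply: lee_wpmul2l.
have nfc := nnmM nF (nl c); have ng := nnm_gap S f c.
have p2 : 0 <= 2 :> R by [].
rewrite -(ExZ p2 nfc) -(ExZ p2 ng) -(ExD (nnmZ p2 nfc) (nnmZ p2 ng)).
apply: Ex_le.
- exact: nnmM.
- by apply: nnmD; exact: nnmZ.
move=> z; rewrite /gap; case: far; last by rewrite !mul0r mulr0 add0r mulr_ge0 ?sqr_ge0.
rewrite !mul1r; move: (nm _) (nm _) => u v.
by have := sqr_ge0 (2 * u - v); nra.
Qed.

Variables (m : nat) (S0 : seq (d.-tuple nat)) (c : d.-tuple nat -> C).
Hypothesis uS0 : uniq S0.
Hypothesis c0 : forall al, al \notin S0 -> c al = 0.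
Hypothesis S0m : forall al, al \in S0 -> forall q, (tnth al q <= m)%N.

Let p := \sum_(al <- S0) nm (c al) ^+ 2.
Let p0 : 0 <= p. Proof. by apply: sumr_ge0 => *; exact: sqr_ge0. Qed.

(** Useful when [eta] is much smaller than [gam]: at radius [r] the levels of [P] are nearly
    invisible and those selected by [A] are not. *)
Lemma level_compare q (A : pred nat) (eta gam U r : R) S f : uniq S -> {subset S0 <= S} ->
  (Ex (fun z => (gap S f c z ^+ 2)%R) <= U%:E)%E ->
  (forall i, (i <= m)%N -> farmass (tnth kappa q) i r <= eta) ->
  (forall n, A n -> gam <= farmass (tnth kappa q) n r) ->
  gam * (\sum_(al <- S | A (tnth al q)) nm (f al) ^+ 2) <= 2 * (p * eta) + 2 * U.
Proof.
move=> uS sS hU heta hgam; apply: le_trans (le_trans (far_compare q r uS hU) _).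
  rewrite mulr_sumr [leLHS]big_mkcond; apply: ler_sum => al _; rewrite mulrC.
  case: ifP => [/hgam h|_]; last by rewrite mulr_ge0 ?sqr_ge0// farmass_ge0.
  by apply: ler_wpM2l => //; exact: sqr_ge0.
rewrite lerD2r; apply: ler_wpM2l => //.
rewrite (sum_ext uS0 uS sS); last by move=> al /c0 ->; rewrite nm0 expr0n mul0r.
rewrite /p mulr_suml !big_seq; apply: ler_sum => al /S0m h.
by apply: ler_wpM2l; [exact: sqr_ge0|exact: heta].
Qed.

(** At a large radius the far mass at level [n] dominates that at the levels up to [m]. It may
    itself be tiny, so [del] depends on [n], and large levels are left to [tail_small]. *)
Lemma level_small q n (eps : R) : (m < n)%N -> 0 < eps ->
  exists2 del : R, 0 < del & forall S f, uniq S -> {subset S0 <= S} ->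
    (Ex (fun z => (gap S f c z ^+ 2)%R) <= del%:E)%E ->
    \sum_(al <- S | tnth al q == n) nm (f al) ^+ 2 <= eps.
Proof.
move=> mn e0; pose e1 := eps / (4 * (p + 1)).
have p1 : 0 < 4 * (p + 1) by rewrite mulr_gt0// ltr_wpDl.
have e10 : 0 < e1 by rewrite divr_gt0.
have [r1 r10 h1] := farmass_growth (tnth kappa q) mn e10.
have [r2 r20 h2] := farmass_gt0 (tnth kappa q) n.
pose r := r1 + r2; pose g := farmass (tnth kappa q) n r.
have g0 : 0 < g by apply: h2; rewrite lerDr.
exists (g * eps / 4); first by rewrite divr_gt0// mulr_gt0.
move=> S f uS sS hU.
have := @level_compare q (pred1 n) (e1 * g) g _ r S f uS sS hU.
move=> /(_ _ _) h; rewrite -(ler_pM2l g0); apply: le_trans (h _ _) _.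
- by move=> i im; apply: h1 => //; rewrite lerDl.
- by move=> n' /eqP ->.
have : p * e1 <= eps / 4.
  rewrite /e1 mulrA ler_pdivrMr//.
  by have := mulr_ge0 p0 (ltW e0); lra.
by move=> /(ler_wpM2r (ltW g0)); lra.
Qed.

(** At a fixed radius all sufficiently high levels have far mass at least [3 / 4], so one [del]
    serves for them all. *)
Lemma tail_small q (eps : R) : 0 < eps ->
  exists I, exists2 del : R, 0 < del & forall S f, uniq S -> {subset S0 <= S} ->
    (Ex (fun z => (gap S f c z ^+ 2)%R) <= del%:E)%E ->
    \sum_(al <- S | (I <= tnth al q)%N) nm (f al) ^+ 2 <= eps.
Proof.
move=> e0; pose e1 := eps / (8 * (p + 1)).
have p1 : 0 < 8 * (p + 1) by rewrite mulr_gt0// ltr_wpDl.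
have e10 : 0 < e1 by rewrite divr_gt0.
have [r r0 h1] := farmass_growth (tnth kappa q) (ltnSn m) e10.
have [I hI] := farmass_large (tnth kappa q) r0.
exists I, (eps / 8); first by rewrite divr_gt0.
move=> S f uS sS hU.
have := @level_compare q (fun n => (I <= n)%N) e1 (3 / 4) _ r S f uS sS hU.
move=> /(_ _ _) h; have {h} := h _ _; have : p * e1 <= eps / 8.
  rewrite /e1 mulrA ler_pdivrMr//.
  by have := mulr_ge0 p0 (ltW e0); lra.
move=> h3 h4.
have : 3 / 4 * (\sum_(al <- S | (I <= tnth al q)%N) nm (f al) ^+ 2) <=
    2 * (p * e1) + 2 * (eps / 8).
  apply: h4 => // i im; apply: le_trans (h1 r (lexx _) i im) _.
  by rewrite ler_piMr ?farmass_le1// ltW.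
lra.
Qed.

Lemma coord_small q (eps : R) : 0 < eps ->
  exists2 del : R, 0 < del & forall S f, uniq S -> {subset S0 <= S} ->
    (Ex (fun z => (gap S f c z ^+ 2)%R) <= del%:E)%E ->
    \sum_(al <- S | (m < tnth al q)%N) nm (f al) ^+ 2 <= eps.
Proof.
move=> e0; have e20 : 0 < eps / 2 by rewrite divr_gt0.
have [I [d1 d10 h1]] := tail_small q e20.
suff [d2 d20 h2] : exists2 del : R, 0 < del & forall S f, uniq S -> {subset S0 <= S} ->
    (Ex (fun z => (gap S f c z ^+ 2)%R) <= del%:E)%E ->
    \sum_(al <- S | (m < tnth al q < I)%N) nm (f al) ^+ 2 <= eps / 2.
  exists (Num.min d1 d2); first by rewrite lt_min d10.
  move=> S f uS sS hU.
  have := h1 S f uS sS (le_trans hU _); rewrite lee_fin ge_min lexx => /(_ isT).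
  have := h2 S f uS sS (le_trans hU _); rewrite lee_fin ge_min lexx orbT => /(_ isT).
  move=> k2 k1; rewrite [leRHS]splitr; apply: le_trans (lerD k2 k1).
  rewrite big_mkcond [X in _ <= X + _]big_mkcond [X in _ <= _ + X]big_mkcond -big_split/=.
  apply: ler_sum => al _; have s0 := sqr_ge0 (nm (f al)).
  case: ifP => m1 /=; last by rewrite add0r; case: ifP.
  by case: ltnP => _; rewrite ?addr0 ?add0r.
(* Finitely many levels remain between [m] and [I]; they are added one at a time, halving the
   tolerance. *)
elim: I {d1 d10 h1} (eps / 2) e20 => [|I IH] e e1.
  by exists 1 => // S f _ _ _; rewrite big1 ?ltW// => al; rewrite ltn0 andbF.
have e20 : 0 < e / 2 by rewrite divr_gt0.
have [d1 d10 h1] := IH _ e20.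
have [mI|Im] := ltnP m I; last first.
  exists 1 => // S f _ _ _; rewrite big1 ?ltW// => al /andP[h2 h3].
  by rewrite ltnS in h3; have := leq_trans h2 (leq_trans h3 Im); rewrite ltnn.
have [d2 d20 h2] := level_small q mI e20.
exists (Num.min d1 d2); first by rewrite lt_min d10.
move=> S f uS sS hU.
have := h1 S f uS sS (le_trans hU _); rewrite lee_fin ge_min lexx => /(_ isT).
have := h2 S f uS sS (le_trans hU _); rewrite lee_fin ge_min lexx orbT => /(_ isT).
move=> k2 k1; rewrite [leRHS]splitr; apply: le_trans (lerD k1 k2).
rewrite big_mkcond [X in _ <= X + _]big_mkcond [X in _ <= _ + X]big_mkcond -big_split/=.
apply: ler_sum => al _; have s0 := sqr_ge0 (nm (f al)).
case: ifP => [/andP[m1 m2]|_]; last by rewrite addr_ge0//; case: ifP.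
rewrite m1 /=; move: m2; rewrite ltnS leq_eqVlt => /orP[->|->].
  by rewrite lerDr; case: ifP.
by rewrite lerDl; case: ifP.
Qed.

Lemma outside_small (eps : R) : 0 < eps ->
  exists2 del : R, 0 < del & forall S f, uniq S -> {subset S0 <= S} ->
    (Ex (fun z => (gap S f c z ^+ 2)%R) <= del%:E)%E ->
    \sum_(al <- S | ~~ inbox m.+1 al) nm (f al) ^+ 2 <= eps.
Proof.
(* The successor avoids a division by zero for [d = 0]. *)
move=> e0; pose e1 := eps / d.+1%:R.
have e10 : 0 < e1 by rewrite divr_gt0.
have /choice[df hd] : forall q : 'I_d, exists del : R, 0 < del /\
  forall S f, uniq S -> {subset S0 <= S} ->
    (Ex (fun z => (gap S f c z ^+ 2)%R) <= del%:E)%E ->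
    \sum_(al <- S | (m < tnth al q)%N) nm (f al) ^+ 2 <= e1.
  by move=> q; have [x x0 h] := coord_small q e10; exists x.
exists (\big[Num.min/1]_q df q).
  by apply: (big_ind (fun x => 0 < x)) => // [x y x0 y0|q _]; [rewrite lt_min x0|exact: (hd q).1].
move=> S f uS sS hU.
apply: (@le_trans _ _ (\sum_(q < d) \sum_(al <- S | (m < tnth al q)%N) nm (f al) ^+ 2)).
  under [leRHS]eq_bigr do rewrite big_mkcond.
  rewrite exchange_big [leLHS]big_mkcond; apply: ler_sum => al _.
  have s0 q : 0 <= (if (m < tnth al q)%N then nm (f al) ^+ 2 else 0).
    by case: ifP => // _; exact: sqr_ge0.
  case: ifP => [/forallPn[q]|_]; last by apply: sumr_ge0 => q _; exact: s0.
  by rewrite -leqNgt => mq; rewrite (bigD1 q)//= mq lerDl; apply: sumr_ge0 => i _; exact: s0.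
apply: (@le_trans _ _ (\sum_(q < d) e1)).
  apply: ler_sum => q _; apply: (hd q).2 => //; apply: le_trans hU _.
  by rewrite lee_fin (bigD1 q)//= ge_min lexx.
rewrite sumr_const card_ord -mulr_natr /e1 mulrAC ler_pdivrMr//.
by rewrite ler_wpM2l ?ler_nat// ltW.
Qed.

End Global.

(** * Smallness of the error when the moduli are close *)

Section Compactness.
Variable R : realType.
Local Notation C := R[i].
Local Open Scope complex_scope.
Local Notation nm := (@Normc.normc R).
Local Notation cj := (@conjc R).
Variables (d : nat) (kappa : d.-tuple nat).

Lemma nnm_abs (D : d.-tuple C -> R) : measurable_fun setT D -> nnm (fun z => `|D z|).
Proof. by move=> mD; split => [|z]; [exact: measurableT_comp|exact: normr_ge0]. Qed.

Lemma lincomb_energy_le S (f c : d.-tuple nat -> C) (U : R) : uniq S ->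
  Ex (fun z => gap kappa S f c z ^+ 2) = U%:E ->
  \sum_(al <- S) nm (f al) ^+ 2 <= 2 * \sum_(al <- S) nm (c al) ^+ 2 + 2 * U.
Proof.
move=> uS hU.
have nl g : nnm (fun z => nm (lincomb kappa S g z) ^+ 2).
  by apply: nnm_sqr; apply: measurable_nm; exact: measurable_lincomb.
have p2 : 0 <= 2 :> R by [].
have n1 := nnmZ p2 (nl c); have n2 := nnmZ p2 (nnm_gap kappa S f c).
rewrite -lee_fin -(Ex_lincomb kappa f uS).
have -> : (2 * \sum_(al <- S) nm (c al) ^+ 2 + 2 * U)%:E =
    Ex (fun z => 2 * nm (lincomb kappa S c z) ^+ 2 + 2 * gap kappa S f c z ^+ 2).
  by rewrite (ExD n1 n2) (ExZ p2 (nl c)) (ExZ p2 (nnm_gap kappa S f c)) hU Ex_lincomb.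
apply: Ex_le => //; first exact: nnmD.
move=> z; rewrite /gap; move: (nm _) (nm _) => u v.
by have := sqr_ge0 (2 * u - v); nra.
Qed.

Variables (m : nat) (S0 : seq (d.-tuple nat)) (c : d.-tuple nat -> C).
Variable al0 : d.-tuple nat.
Hypothesis uS0 : uniq S0.
Hypothesis c0 : forall al, al \notin S0 -> c al = 0.
Hypothesis S0m : forall al, al \in S0 -> forall q, (tnth al q <= m)%N.
Hypothesis al0S0 : al0 \in S0.
Hypothesis ca0 : c al0 != 0.

Let p := \sum_(al <- S0) nm (c al) ^+ 2.
Let p0 : 0 <= p. Proof. by apply: sumr_ge0 => *; exact: sqr_ge0. Qed.

Lemma coef_box al : c al != 0 -> inbox m.+1 al.
Proof.
move=> ca; apply/forallP => q; rewrite ltnS; apply: S0m.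
by apply: contraNT ca => /c0 ->; rewrite eqxx.
Qed.

Lemma energy_ext S : uniq S -> {subset S0 <= S} -> \sum_(al <- S) nm (c al) ^+ 2 = p.
Proof. by move=> uS sS; apply: sum_ext => // al /c0 ->; rewrite nm0 expr0n. Qed.

(* [X] and [Y] are the expectations of [|D| |P|] and [|F2| |F|]. *)
Lemma inside_cross S f (U w : R) : uniq S -> {subset S0 <= S} -> U <= 1 ->
  Ex (fun z => gap kappa S f c z ^+ 2) = U%:E ->
  \sum_(al <- S | ~~ inbox m.+1 al) nm (f al) ^+ 2 = w ->
  exists X Y : R, [/\ 0 <= X, 0 <= Y, X ^+ 2 <= U * p, Y ^+ 2 <= w * (2 * p + 2) &
   (Ex (fun z => nm (\sum_(al <- [seq x <- S | inbox m.+1 x])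
      \sum_(be <- [seq x <- S | inbox m.+1 x]) (f al * cj (f be) - c al * cj (c be)) *
        (Phi kappa al z * cj (Phi kappa be z)))%R) <= (U + 2 * X + w + 2 * Y)%:E)%E].
Proof.
move=> uS sS U1 hU hw.
set S1 := [seq x <- S | inbox m.+1 x]; pose S2 := [seq x <- S | ~~ inbox m.+1 x].
have uS2 : uniq S2 by exact: filter_uniq.
pose D z := gap kappa S f c z; pose P z := lincomb kappa S c z.
pose F z := lincomb kappa S f z; pose F1 z := lincomb kappa S1 f z.
pose F2 z := lincomb kappa S2 f z.
have FE z : F z = F1 z + F2 z.
  by rewrite /F /F1 /F2 /lincomb !big_filter (bigID (inbox m.+1)).
have PE z : lincomb kappa S1 c z = P z.
  rewrite /P /lincomb [RHS](bigID (inbox m.+1))/= [X in _ + X]big1 ?addr0 ?big_filter//.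
  by move=> al nb; have [->|/coef_box] := eqVneq (c al) 0; rewrite ?mul0r// (negPf nb).
have mD : measurable_fun setT D by exact: measurable_gap.
have nD := nnm_abs mD.
have nl T g : nnm (fun z => nm (lincomb kappa T g z)).
  by apply: nnm_nm; exact: measurable_lincomb.
have nP : nnm (fun z => nm (P z)) := nl _ _.
have nF : nnm (fun z => nm (F z)) := nl _ _.
have nF2 : nnm (fun z => nm (F2 z)) := nl _ _.
have nF22 : nnm (fun z => nm (F2 z) ^+ 2) by exact: nnm_sqr nF2.1.
have nD2 : nnm (fun z => D z ^+ 2) by exact: nnm_sqr.
have hP : Ex (fun z => nm (P z) ^+ 2) = p%:E by rewrite Ex_lincomb// energy_ext.
have hF : Ex (fun z => nm (F z) ^+ 2) = (\sum_(al <- S) nm (f al) ^+ 2)%:E by rewrite Ex_lincomb.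
have hF2 : Ex (fun z => nm (F2 z) ^+ 2) = w%:E by rewrite Ex_lincomb// big_filter hw.
have hD : Ex (fun z => `|D z| ^+ 2) = U%:E.
  by rewrite -hU; apply: eq_Ex => z; rewrite real_normK ?num_real.
have w0 : 0 <= w by rewrite -lee_fin -hF2; apply: Ex_ge0 => z; exact: sqr_ge0.
have [X [X0 hX X2]] := Ex_CS nD nP hD hP.
have [Y [Y0 hY Y2]] := Ex_CS nF2 nF hF2 hF.
exists X, Y; split => //.
  apply: le_trans Y2 _; apply: ler_wpM2l => //.
  apply: le_trans (lincomb_energy_le uS hU) _; rewrite energy_ext//; lra.
have n1 : nnm (fun z => D z ^+ 2 + 2 * (`|D z| * nm (P z))).
  by apply: nnmD => //; apply: nnmZ => //; exact: nnmM.
have n2 : nnm (fun z => D z ^+ 2 + 2 * (`|D z| * nm (P z)) + nm (F2 z) ^+ 2) by exact: nnmD.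
have n3 : nnm (fun z => 2 * (nm (F2 z) * nm (F z))) by apply: nnmZ => //; exact: nnmM.
have -> : (U + 2 * X + w + 2 * Y)%:E =
    Ex (fun z => D z ^+ 2 + 2 * (`|D z| * nm (P z)) + nm (F2 z) ^+ 2 + 2 * (nm (F2 z) * nm (F z))).
  rewrite (ExD n2 n3) (ExD n1 nF22) (ExD nD2); last by apply: nnmZ => //; exact: nnmM.
  by rewrite hU hF2 ExZ//; [rewrite hX ExZ//; [rewrite hY|exact: nnmM]|exact: nnmM].
have BE z : \sum_(al <- S1) \sum_(be <- S1) (f al * cj (f be) - c al * cj (c be)) *
      (Phi kappa al z * cj (Phi kappa be z)) = (nm (F1 z) ^+ 2 - nm (P z) ^+ 2)%:C.
  rewrite rmorphB/= !nm_sqrC -PE /F1 !lincomb_bilin -sumrB; apply: eq_bigr => al _ /=.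
  by rewrite -sumrB; apply: eq_bigr => be _ /=; rewrite mulrBl.
apply: Ex_le; last first.
- move=> z; rewrite BE nm_real.
  have h1 : nm (F z) = nm (P z) + D z by rewrite /D /gap -/(F z) -/(P z) addrC subrK.
  have h2 : nm (F1 z) <= nm (F z) + nm (F2 z).
    by rewrite (_ : F1 z = F z - F2 z) ?nmB// FE addrK.
  have h3 : nm (F z) <= nm (F1 z) + nm (F2 z) by rewrite FE nmD.
  have := nm_ge0 (F2 z); have := nm_ge0 (F1 z); have := nm_ge0 (F z); have := nm_ge0 (P z).
  move: h1 h2 h3; move: (nm (F z)) (nm (F1 z)) (nm (F2 z)) (nm (P z)) (D z).
  move=> a b x y t -> h2 h3 y0 a0 b0 x0.
  (* Here [y + t = |F|], [b = |F1|] and [x = |F2|]: a difference of squares with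
     [||F1| - |F|| <= |F2|]. *)
  have k1 : `|b ^+ 2 - (y + t) ^+ 2| <= x * (x + 2 * (y + t)).
    rewrite subr_sqr normrM; apply: ler_pM => //.
      by rewrite ler_norml; apply/andP; split; lra.
    by rewrite ger0_norm; lra.
  have k2 : `|(y + t) ^+ 2 - y ^+ 2| <= t ^+ 2 + 2 * (`|t| * y).
    rewrite (_ : _ - _ = t ^+ 2 + 2 * (t * y)); last by ring.
    apply: le_trans (ler_normD _ _) _; rewrite ger0_norm ?sqr_ge0// lerD2l.
    by rewrite !normrM normr_nat (ger0_norm y0).
  have := ler_normD (b ^+ 2 - (y + t) ^+ 2) ((y + t) ^+ 2 - y ^+ 2).
  rewrite addrA subrK => /le_trans; apply; apply: le_trans (lerD k1 k2) _.
  by rewrite le_eqVlt; apply/orP; left; apply/eqP; ring.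
- exact: nnmD.
- under eq_fun do rewrite BE nm_real.
  apply: nnm_abs; apply: measurable_funB; last exact: measurable_funX nP.1.
  by apply: measurable_funX; exact: (nl _ _).1.
Qed.

(** The products [f al0 conj (f be)] in the box are close to [c al0 conj (c be)]. The diagonal one
    gives [s ^+ 2] close to 1, hence [s] itself as [0 <= s]; dividing the row of [al0] by [s c al0]
    then gives every [f be]. Outside the box [c] vanishes and [f] is small. *)
Lemma global_small (eps : R) : 0 < eps ->
  exists2 del : R, 0 < del & forall S f (s : R), uniq S -> {subset S0 <= S} -> 0 <= s ->
    f al0 = s%:C * c al0 ->
    (Ex (fun z => (gap kappa S f c z ^+ 2)%R) <= del%:E)%E ->
    \sum_(al <- S) nm (f al - c al) ^+ 2 <= eps.
Proof.
move=> e0; have [K1 K10 hX] := box_coefficient_bound R m.+1 kappa.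
pose g := nm (c al0).
have g0 : 0 < g by rewrite lt_def nm_ge0 andbT nm_eq0.
(* In [ha], [f be - c be] is split into [s f be - c be], at most [K1 eta / g], and [(s - 1) f be],
   where [|f be| <= 3 + 2 p]. *)
pose K4 := g^-1 + (3 + 2 * p) / g ^+ 2.
have K40 : 0 < K4 by rewrite addr_gt0 ?invr_gt0// divr_gt0 ?exprn_gt0// ltr_wpDr// mulr_ge0.
pose n : R := (size (boxlist m.+1 d))%:R.
pose K5 := n * (K1 * K4) ^+ 2.
have K50 : 0 <= K5 by rewrite mulr_ge0 ?sqr_ge0.
pose eta := Num.min 1 (eps / (2 * (K5 + 1))).
have K51 : 0 < 2 * (K5 + 1) by rewrite mulr_gt0// ltr_wpDl.
have eta0 : 0 < eta by rewrite lt_min ltr01 divr_gt0.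
have eta_eps : K5 * eta ^+ 2 <= eps / 2.
  have h1 : eta <= 1 by rewrite ge_min lexx.
  have h2 : eta * (2 * (K5 + 1)) <= eps by rewrite -ler_pdivlMr// ge_min lexx orbT.
  have h3 : K5 * eta ^+ 2 <= K5 * eta.
    by apply: ler_wpM2l => //; rewrite expr2 ler_piMl// ltW.
  by move: h2 h3 (ltW eta0); lra.
pose w0 := Num.min (eps / 2) (Num.min (eta / 8) ((eta / 8) ^+ 2 / (2 * p + 2))).
have p2 : 0 < 2 * p + 2 by rewrite ltr_wpDl// mulr_ge0.
have e8 : 0 < eta / 8 by rewrite divr_gt0.
have w00 : 0 < w0 by rewrite !lt_min !divr_gt0// exprn_gt0.
have [d1 d10 h1] := outside_small kappa uS0 c0 S0m w00.
(* Together with [w0] this makes [U], [X], [w] and [Y] at most [eta / 8] each, so that the bound of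
   [inside_cross] is at most [eta]. *)
pose del := Num.min d1 (Num.min 1 (Num.min (eta / 8) ((eta / 8) ^+ 2 / (p + 1)))).
have p1 : 0 < p + 1 by rewrite ltr_wpDl.
exists del; first by rewrite !lt_min d10 ltr01 !divr_gt0// exprn_gt0.
move=> S f s uS sS s0 fs hU.
have [U U0 hU'] : exists2 U : R, 0 <= U & Ex (fun z => gap kappa S f c z ^+ 2) = U%:E.
  exists (fine (Ex (fun z => gap kappa S f c z ^+ 2))).
    by apply: fine_ge0; apply: Ex_ge0 => z; exact: sqr_ge0.
  rewrite fineK// ge0_fin_numE; last by apply: Ex_ge0 => z; exact: sqr_ge0.
  exact: le_lt_trans hU (ltry _).
have hw := h1 S f uS sS (le_trans hU _).
move: hU; rewrite hU' lee_fin !le_min => /and4P[Ud U1 U2 U3].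
have {hw} : \sum_(al <- S | ~~ inbox m.+1 al) nm (f al) ^+ 2 <= w0.
  by apply: hw; rewrite lee_fin ge_min lexx.
case: (inside_cross uS sS U1 hU' erefl) => X [Y [X0 Y0 X2 Y2 hQ]].
move: Y2 hQ; set w := \sum_(al <- S | _) _ => Y2 hQ.
rewrite !le_min => /and3P[w1 w2 w3].
have wge0 : 0 <= w by apply: sumr_ge0 => *; exact: sqr_ge0.
have Xe : X <= eta / 8.
  rewrite -(ler_pXn2r (n := 2))// ?nnegrE ?(ltW e8)//.
  by apply: le_trans X2 _; move: U3; rewrite ler_pdivlMr//; lra.
have Ye : Y <= eta / 8.
  rewrite -(ler_pXn2r (n := 2))// ?nnegrE ?(ltW e8)//.
  by apply: le_trans Y2 _; move: w3; rewrite ler_pdivlMr.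
have Qe : U + 2 * X + w + 2 * Y <= eta by move: (ltW eta0) Xe Ye U2 w2; lra.
set S1 := [seq x <- S | inbox m.+1 x] in hQ.
have uS1 : uniq S1 by exact: filter_uniq.
pose B al be := f al * cj (f be) - c al * cj (c be).
have al0I : inbox m.+1 al0 by exact: coef_box.
have al0S1 : al0 \in S1 by rewrite mem_filter al0I sS.
have hb be : be \in S -> inbox m.+1 be -> nm (B al0 be) <= K1 * eta.
  move=> beS beI; have beS1 : be \in S1 by rewrite mem_filter beI.
  rewrite -lee_fin EFinM; apply: le_trans (hX S1 B uS1 _ al0 be al0S1 beS1 al0I beI) _.
    by move=> al be' ; rewrite mem_filter => /andP[->].
  apply: lee_wpmul2l; first by rewrite lee_fin ltW.
  by apply: le_trans hQ _; rewrite lee_fin.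
have Ke0 : 0 <= K1 * eta by rewrite mulr_ge0// ltW.
(* The diagonal coefficient is [(s - 1) (s + 1) g^2], and [s + 1 >= 1]. *)
have hs : `|s - 1| <= K1 * eta / g ^+ 2.
  have := hb _ (sS _ al0S0) al0I; rewrite /B fs cjM conjc_real.
  have -> : s%:C * c al0 * (s%:C * cj (c al0)) - c al0 * cj (c al0) =
      ((s - 1) * (s + 1))%:C * (c al0 * cj (c al0)).
    by rewrite rmorphM rmorphB rmorphD rmorph1 /=; ring.
  rewrite nmM nm_real nmM nmJ -/g normrM => h.
  rewrite ler_pdivlMr ?exprn_gt0// expr2; apply: le_trans h.
  apply: ler_wpM2r; first by rewrite mulr_ge0// ltW.
  by rewrite ler_peMr// ger0_norm; lra.
have N2 : \sum_(al <- S) nm (f al) ^+ 2 <= 2 * p + 2.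
  apply: le_trans (lincomb_energy_le uS hU') _; rewrite energy_ext//; lra.
have hf be : be \in S -> nm (f be) <= 3 + 2 * p.
  move=> beS; have : nm (f be) ^+ 2 <= 2 * p + 2.
    by apply: le_trans N2; rewrite (big_rem be)//= lerDl; apply: sumr_ge0 => *; exact: sqr_ge0.
  by have := sqr_ge0 (nm (f be) - 1); rewrite sqrrB; have := nm_ge0 (f be); nra.
have ha be : be \in S -> inbox m.+1 be -> nm (f be - c be) <= K1 * eta * K4.
  move=> beS beI.
  have h2 : nm (s%:C * f be - c be) <= K1 * eta / g.
    rewrite ler_pdivlMr//; apply: le_trans (hb _ beS beI).
    have -> : B al0 be = c al0 * cj (s%:C * f be - c be).
      by rewrite /B fs rmorphB/= cjM conjc_real; ring.
    by rewrite nmM nmJ mulrC.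
  have -> : f be - c be = (s%:C * f be - c be) - (s - 1)%:C * f be.
    by rewrite rmorphB rmorph1 /=; ring.
  apply: le_trans (nmB _ _) _; rewrite /K4 mulrDr; apply: lerD => //.
  rewrite nmM nm_real mulrA mulrAC; apply: ler_pM => //; [exact: nm_ge0|exact: hf].
rewrite (bigID (inbox m.+1))/= [leRHS]splitr; apply: lerD; last first.
  apply: le_trans w1; rewrite /w; apply: ler_sum => al nb.
  have [->|/coef_box] := eqVneq (c al) 0; first by rewrite subr0.
  by rewrite (negPf nb).
apply: (@le_trans _ _ (n * (K1 * eta * K4) ^+ 2)).
  apply: box_sum => //; first exact: sqr_ge0.
  move=> al aS aI; rewrite ler_pXn2r ?nnegrE ?nm_ge0//; first exact: ha.
  by rewrite mulr_ge0// ltW.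
apply: le_trans eta_eps; rewrite /K5 le_eqVlt; apply/orP; left; apply/eqP; ring.
Qed.

End Compactness.

(** * Stability on the span and its closure *)

Section Stability.
Variable R : realType.
Local Notation C := R[i].
Local Open Scope complex_scope.
Local Notation nm := (@Normc.normc R).
Local Notation cj := (@conjc R).

Lemma gauss_norm_le_real d (F : d.-tuple C -> C) (a : R) : 0 <= a ->
  (gauss_norm F <= a%:E)%E = (Ex (fun z => (nm (F z) ^+ 2)%R) <= (a ^+ 2)%:E)%E.
Proof.
move=> a0; have -> : a%:E = sqrte (a ^+ 2)%:E by rewrite /= sqrtr_sqr ger0_norm.
by rewrite gauss_normE lee_sqrt// lee_fin sqr_ge0.
Qed.

(** Assuming a bound on moduli instead of [H = F + G] lets it apply also to [|P| - |P0|]. *)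
Lemma gauss_norm_minkowski d (F G H : d.-tuple C -> C) (a b : R) :
  measurable_fun setT F -> measurable_fun setT G -> measurable_fun setT H ->
  0 <= a -> 0 <= b -> (forall z, nm (H z) <= nm (F z) + nm (G z)) ->
  (gauss_norm F <= a%:E)%E -> (gauss_norm G <= b%:E)%E -> (gauss_norm H <= (a + b)%:E)%E.
Proof.
move=> mF mG mH a0 b0 HFG; rewrite !gauss_norm_le_real ?addr_ge0// => hF hG.
have nF := nnm_nm mF; have nG := nnm_nm mG; have nH := nnm_nm mH.
have nF2 := nnm_sqr nF.1; have nG2 := nnm_sqr nG.1; have nH2 := nnm_sqr nH.1.
have fin (K : d.-tuple C -> C) (k : R) :
    (Ex (fun z => (nm (K z) ^+ 2)%R) <= (k ^+ 2)%:E)%E ->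
    exists2 A : R, 0 <= A <= k ^+ 2 & Ex (fun z => nm (K z) ^+ 2) = A%:E.
  move=> hK; have e0 : (0 <= Ex (fun z => (nm (K z) ^+ 2)%R))%E.
    by apply: Ex_ge0 => z; exact: sqr_ge0.
  have eK : Ex (fun z => nm (K z) ^+ 2) = (fine (Ex (fun z => nm (K z) ^+ 2)))%:E.
    by rewrite fineK// ge0_fin_numE// (le_lt_trans hK) ?ltry.
  exists (fine (Ex (fun z => nm (K z) ^+ 2))) => //.
  by rewrite fine_ge0//= -lee_fin -eK.
have [A /andP[A0 Aa] hA] := fin F a hF; have [B /andP[B0 Bb] hB] := fin G b hG.
have [X [X0 hX X2]] := Ex_CS nF nG hA hB.
have p2 : 0 <= 2 :> R by [].
have nFG := nnmM nF nG; have n3 := nnmZ p2 nFG.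
have n4 := nnmD nF2 n3.
apply: le_trans (Ex_le nH2 (nnmD n4 nG2) _) _.
  move=> z; apply: (@le_trans _ _ ((nm (F z) + nm (G z)) ^+ 2)).
    by rewrite ler_pXn2r ?nnegrE ?addr_ge0 ?nm_ge0.
  by rewrite le_eqVlt; apply/orP; left; apply/eqP; ring.
rewrite (ExD n4 nG2) (ExD nF2 n3) (ExZ p2 nFG) hA hB hX -EFinM -!EFinD lee_fin.
have Xab : X <= a * b.
  rewrite -(ler_pXn2r (n := 2))// ?nnegrE ?mulr_ge0// exprMn.
  by apply: le_trans X2 _; exact: ler_pM.
by rewrite sqrrD; lra.
Qed.

Variables (d : nat) (kappa : d.-tuple nat).

(** Repeated indices are merged with their multiplicity. The freedom in [S] allows two elements of
    the span to be written over a common list. *)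
Lemma span_lincomb (P : d.-tuple C -> C) : Phi_span kappa P ->
  exists S0 c, [/\ uniq S0, forall al, al \notin S0 -> c al = 0 &
    forall S, uniq S -> {subset S0 <= S} -> P = lincomb kappa S c].
Proof.
move=> [s [c ->]]; exists (undup s), (fun al => c al *+ count_mem al s); split.
- exact: undup_uniq.
- by move=> al; rewrite mem_undup => /count_memPn ->.
move=> S uS sS; apply/funext => z.
rewrite /lincomb (sum_ext (undup_uniq s) uS sS); last first.
  by move=> al; rewrite mem_undup => /count_memPn ->; rewrite mulr0n mul0r.
rewrite -big_undup_iterop_count; apply: eq_bigr => al _.
by rewrite mulrnAl -[RHS]/(iterop _ _ _ _).
Qed.

Lemma measurable_span (P : d.-tuple C -> C) : Phi_span kappa P -> measurable_fun setT P.
Proof.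
by move=> /span_lincomb[S0 [c [uS _ /(_ S0 uS)->//]]]; exact: measurable_lincomb.
Qed.

Lemma unimodular_align (v w : C) : w != 0 ->
  exists2 lam : C, nm lam = 1 & exists2 s : R, 0 <= s & cj lam * v = s%:C * w.
Proof.
move=> w0; have [->|v0] := eqVneq v 0.
  by exists 1; [exact: nm1|exists 0 => //; rewrite mulr0 mul0r].
pose s := nm (v / w).
have s0 : s != 0 by rewrite nm_eq0 mulf_neq0// invr_eq0.
have sC0 : s%:C != 0 by rewrite fmorph_eq0.
pose lam := v / w / s%:C.
have lam1 : nm lam = 1.
  by rewrite nmM -fmorphV nm_real -/s ger0_norm ?invr_ge0 ?nm_ge0// mulfV.
exists lam => //; exists s; first exact: nm_ge0.
have {1}-> : v = lam * s%:C * w by rewrite !divfK.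
by rewrite -[RHS]mul1r -(mulzJ lam1); move: lam {lam1} => l; ring.
Qed.

Lemma span_stability (P : d.-tuple C -> C) : Phi_span kappa P ->
  exists2 M : R, 0 < M & forall F, Phi_span kappa F ->
    exists2 lam : C, nm lam = 1 &
      (Ex (fun z => (nm (F z - lam * P z) ^+ 2)%R) <=
       M%:E * Ex (fun z => ((nm (F z) - nm (P z)) ^+ 2)%R))%E.
Proof.
move=> /span_lincomb[S0 [c [uS0 c0 hP]]].
have [/hasP[al0 al0S0 ca0]|/hasPn cz] := boolP (has (fun al => c al != 0) S0); last first.
  have Pz z : P z = 0.
    rewrite (hP S0 uS0)// /lincomb big1_seq// => al /andP[_ /cz].
    by rewrite negbK => /eqP ->; rewrite mul0r.
  exists 1 => // F _; exists 1; first exact: nm1.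
  rewrite mul1e le_eqVlt; apply/orP; left; apply/eqP; apply: eq_Ex => z.
  by rewrite Pz mulr0 subr0 nm0 subr0.
have [m hm] := sizeS_bound S0.
have S0m al : al \in S0 -> forall q, (tnth al q <= m)%N by move=> aS q; exact/ltnW/hm.
have [K K0 hK] := local_bound kappa uS0 c0 S0m al0S0 ca0.
have e0 : 0 < (2 * K)^-1 by rewrite invr_gt0 mulr_gt0.
have [del del0 hdel] := global_small kappa uS0 c0 S0m al0S0 ca0 e0.
pose p := \sum_(al <- S0) nm (c al) ^+ 2.
have p0 : 0 <= p by apply: sumr_ge0 => *; exact: sqr_ge0.
(* [2 K] serves when [U <= del]; otherwise the energy is at most [6 p + 4 U], and
   [6 p <= (6 p / del) U]. *)
pose M := 2 * K + 6 * p / del + 4.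
have pd0 : 0 <= 6 * p / del by rewrite divr_ge0 ?mulr_ge0// ltW.
have M0 : 0 < M by rewrite ltr_wpDl// addr_ge0// mulr_ge0// ltW.
exists M => // F /span_lincomb[S1 [f0 [uS1 f00 hF]]].
have [lam lam1 [s s0 hs]] := unimodular_align (f0 al0) ca0.
exists lam => //; pose S := undup (S0 ++ S1).
have uS : uniq S by exact: undup_uniq.
have sS : {subset S0 <= S} by move=> al h; rewrite mem_undup mem_cat h.
have sS1 : {subset S1 <= S} by move=> al h; rewrite mem_undup mem_cat h orbT.
rewrite (hP S uS sS) (hF S uS sS1).
pose f al := cj lam * f0 al.
have fE z : lincomb kappa S f z = cj lam * lincomb kappa S f0 z.
  by rewrite /lincomb mulr_sumr; apply: eq_bigr => al _; rewrite mulrA.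
have gE z : nm (lincomb kappa S f0 z) - nm (lincomb kappa S c z) = gap kappa S f c z.
  by rewrite /gap fE nmM nmJ lam1 mul1r.
have -> : Ex (fun z => (nm (lincomb kappa S f0 z) - nm (lincomb kappa S c z)) ^+ 2) =
    Ex (fun z => gap kappa S f c z ^+ 2) by apply: eq_Ex => z; rewrite gE.
pose a al := f al - c al.
have aE z : nm (lincomb kappa S f0 z - lam * lincomb kappa S c z) = nm (lincomb kappa S a z).
  have -> : lincomb kappa S a z = cj lam * (lincomb kappa S f0 z - lam * lincomb kappa S c z).
    rewrite mulrBr mulrA [cj lam * lam]mulrC mulzJ// mul1r -fE.
    by rewrite /lincomb -sumrB; apply: eq_bigr => al _; rewrite mulrBl.
  by rewrite nmM nmJ lam1 mul1r.
rewrite (eq_Ex (g := fun z => nm (lincomb kappa S a z) ^+ 2)) => [|z]; last by rewrite aE.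
rewrite Ex_lincomb//; set E2 := \sum_(al <- S) _.
have dE : Ex (fun z => defect kappa S c a z ^+ 2) = Ex (fun z => gap kappa S f c z ^+ 2).
  by apply: eq_Ex => z; rewrite defect_gap.
have [U U0 hU] : exists2 U : R, 0 <= U & Ex (fun z => gap kappa S f c z ^+ 2) = U%:E.
  rewrite -dE; apply: (@Ex_fin _ _ _ (fun z => nm (lincomb kappa S a z) ^+ 2) E2).
  - exact: nnm_defect.
  - by apply: nnm_sqr; apply: measurable_nm; exact: measurable_lincomb.
  - by move=> z; exact: defect_le.
  - exact: Ex_lincomb.
rewrite hU -EFinM lee_fin.
(* For small [U], [E2 <= 1 / (2 K)] turns [K E2^2] into at most [E2 / 2], which is absorbed. *)
have [Ud|dU] := leP U del.
  have h1 : E2 <= (2 * K)^-1.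
    by apply: (hdel S f s uS sS s0 hs); rewrite hU lee_fin.
  have h2 : E2 <= K * (U + E2 ^+ 2).
    apply: (hK S a (s - 1) uS sS); last by rewrite dE.
    by rewrite /a /f hs rmorphB rmorph1 /= mulrBl mul1r.
  have E20 : 0 <= E2 by apply: sumr_ge0 => *; exact: sqr_ge0.
  have h3 : 2 * K * E2 <= 1.
    by rewrite mulrC -ler_pdivlMr ?mulr_gt0// mul1r.
  have h4 := ler_wpM2r E20 h3.
  have h5 : 0 <= (6 * p / del + 4) * U by rewrite mulr_ge0// addr_ge0.
  by move: h5; rewrite /M -addrA [leRHS]mulrDl; nra.
have h1 : E2 <= 2 * (\sum_(al <- S) nm (f al) ^+ 2) + 2 * p.
  rewrite /p -(energy_ext uS0 c0 uS sS) -!mulrDr -big_split/= mulr_sumr.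
  apply: ler_sum => al _; rewrite /a.
  have := nmB (f al) (c al); have := nm_ge0 (f al - c al).
  move: (nm (f al)) (nm (c al)) (nm _) => u v w w0 h.
  apply: (@le_trans _ _ ((u + v) ^+ 2)).
    by rewrite ler_pXn2r ?nnegrE//; exact: le_trans h.
  by have := sqr_ge0 (u - v); nra.
have h2 := lincomb_energy_le uS hU; rewrite (energy_ext uS0 c0 uS sS) -/p in h2.
have h3 : 6 * p <= 6 * p / del * U.
  by rewrite mulrAC ler_pdivlMr//; apply: ler_wpM2l; [rewrite mulr_ge0|exact: ltW].
have h4 : 0 <= 2 * K * U by rewrite !mulr_ge0// ltW.
by rewrite /M !mulrDl; lra.
Qed.

End Stability.

Theorem theorem1p5 (R : realType) (d : nat) (hd : (1 <= d)%N)
    (kappa : d.-tuple nat) (P0 : d.-tuple R[i] -> R[i])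
    (hP0 : Phi_span kappa P0) :
  exists2 M : R, 0 < M & forall F : d.-tuple R[i] -> R[i], Hspace kappa F ->
    (ereal_inf [set gauss_norm (fun z => F z - lambda * P0 z)%R
               | lambda in [set lambda : R[i] | `|lambda|%R = 1%R]]
     <= M%:E * gauss_norm (fun z => `|F z| - `|P0 z|)%R)%E.
Proof.
have [M M0 hM] := span_stability hP0.
have mP0 := measurable_span hP0.
pose s := Num.sqrt M.
have s0 : 0 < s by rewrite sqrtr_gt0.
exists s => // F [mF _ dens].
set u := (fun z => `|F z| - `|P0 z|).
have nu z : Normc.normc (u z) = `|Normc.normc (F z) - Normc.normc (P0 z)| by exact: nm_abs_sub.
case eb : (gauss_norm u) => [b| |].
- have b0 : 0 <= b by rewrite -lee_fin -eb; exact: sqrte_ge0.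
  apply/lee_addgt0Pr => e e0.
  (* Replacing [F] by an element [P] of the span at distance [e1] costs [e1] on the left and
     [s * e1] on the right, in total [e]. *)
  pose e1 := e / (1 + s).
  have s1 : 0 < 1 + s by rewrite addr_gt0.
  have e10 : 0 < e1 by rewrite divr_gt0.
  have [P sP /ltW FP] := dens e1 e10; have mP := measurable_span sP.
  have [lam lam1 hlam] := hM P sP.
  have mcst (k : R[i]) : measurable_fun setT (fun _ : d.-tuple R[i] => k) by exact: measurable_cst.
  have mlP : measurable_fun setT (fun z => lam * P0 z) by exact: measurable_mulc.
  have mN (G : d.-tuple R[i] -> R[i]) : measurable_fun setT G ->
      measurable_fun setT (fun z => - G z).
    move=> mG; rewrite (_ : (fun z => - G z) = (fun z => (-1) * G z)).
      exact: measurable_mulc.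
    by apply/funext => z; rewrite mulN1r.
  have mB (G H : d.-tuple R[i] -> R[i]) : measurable_fun setT G -> measurable_fun setT H ->
      measurable_fun setT (fun z => G z - H z).
    by move=> mG mH; apply: measurable_addc => //; exact: mN.
  have mR (G : d.-tuple R[i] -> R[i]) : measurable_fun setT G ->
      measurable_fun setT (fun z => (`|G z| : R[i])).
    move=> mG; rewrite (_ : (fun z => _) = (fun z => (Normc.normc (G z))%:C%C)).
      by apply: measurable_Complex => //; exact: measurable_nm.
    by apply/funext => z; rewrite normcE.
  have mu : measurable_fun setT u by apply: mB; exact: mR.
  pose u' z := `|P z| - `|P0 z|.
  have mu' : measurable_fun setT u' by apply: mB; exact: mR.
  have hu' : (gauss_norm u' <= (b + e1)%:E)%E.
    apply: (gauss_norm_minkowski mu (mB _ _ mF mP) mu' b0 (ltW e10) _ _ FP); last by rewrite eb.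
    move=> z; rewrite nu nm_abs_sub.
    have := nm_lip (P z) (F z); rewrite nm_distC.
    have := ler_normD (Normc.normc (P z) - Normc.normc (F z))
      (Normc.normc (F z) - Normc.normc (P0 z)).
    by rewrite addrA subrK; lra.
  have be0 : 0 <= b + e1 by rewrite addr_ge0// ltW.
  have hPl : (gauss_norm (fun z => P z - lam * P0 z)%R <= (s * (b + e1))%:E)%E.
    have sb0 : 0 <= s * (b + e1) by rewrite mulr_ge0// ltW.
    rewrite gauss_norm_le_real//; apply: le_trans hlam _.
    rewrite exprMn sqr_sqrtr ?(ltW M0)// EFinM; apply: lee_wpmul2l; first by rewrite lee_fin ltW.
    move: hu'; rewrite gauss_norm_le_real//; apply: le_trans.
    rewrite le_eqVlt; apply/orP; left; apply/eqP; apply: eq_Ex => z.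
    by rewrite nm_abs_sub real_normK ?num_real.
  apply: ge_ereal_inf; exists (gauss_norm (fun z => F z - lam * P0 z)%R).
    by exists lam => //=; rewrite normcE lam1.
  have sb0 : 0 <= s * (b + e1) by rewrite mulr_ge0// ltW.
  apply: le_trans (gauss_norm_minkowski (mB _ _ mF mP) (mB _ _ mP mlP) (mB _ _ mF mlP)
    (ltW e10) sb0 _ FP hPl) _.
    by move=> z; rewrite (_ : F z - lam * P0 z = (F z - P z) + (P z - lam * P0 z)) ?nmD//
      addrA subrK.
  rewrite -EFinM -EFinD lee_fin.
  have -> : e = e1 * (1 + s) by rewrite divfK// gt_eqF.
  by lra.
- by rewrite gt0_muley ?leey// lte_fin.
- by have := sqrte_ge0 (gexp (fun z => (Normc.normc (u z) ^+ 2)%:E)); rewrite -gauss_normE eb.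
Qed.
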